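(* Let $\mathcal F=\{f_1,\dots,f_m\}$ be a set of functions in $L^2(\mathbb R^d)$, let $n$ be a positive integer with $n<m$, and let $l$ be an integer with $1\le l\le m$. Then there exists a bundle $\mathbf S_0=\{S_1^0,\dots,S_l^0\}\in\mathcal S$ such that $$e(\mathcal F,\mathbf S_0)=\sum_{i=1}^m\min_{1\le j\le l}d_2^2(f_i,S_j^0)\le\sum_{i=1}^m\min_{1\le j\le l}d_2^2(f_i,S_j)$$ for all bundles $\mathbf S=\{S_1,\dots,S_l\}\in\mathcal S$.
   Context: For a finite set $\Phi=\{\varphi_1,\dots,\varphi_s\}\subset L^2(\mathbb R^d)$, let $S(\Phi)$ be the closure in $L^2(\mathbb R^d)$ of $\operatorname{span}\{\varphi_i(\cdot-k):i=1,\dots,s,\ k\in\mathbb Z^d\}$. Such a space is called a finitely generated shift-invariant space, and $\varphi_1,\dots,\varphi_s$ are called a set of generators for it. The length of a finitely generated shift-invariant space $S\ne\{0\}$ is the smallest $\ell\in\mathbb N$ for which there exist $\varphi_1,\dots,\varphi_\ell\in S$ with $S=S(\{\varphi_1,\dots,\varphi_\ell\})$; the length of $\{0\}$ is $0$. $\mathcal L_n$ denotes the set of all shift-invariant spaces of length less than or equal to $n$. $\mathcal S$ is the set of all sequences (bundles) $\{S_1,\dots,S_l\}$ of length $l$ with $S_i\in\mathcal L_n$ for all $i$ (repetitions allowed). $d_2$ is the $L^2(\mathbb R^d)$ distance, $d_2(f,S)=\inf_{g\in S}\|f-g\|_{L^2(\mathbb R^d)}$, and $e(\mathcal F,\mathbf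 S)=\sum_{i=1}^m\min_{1\le j\le l}d_2^2(f_i,S_j)$ for $\mathbf S=\{S_1,\dots,S_l\}\in\mathcal S$. *)

(* Defs.v *)
From HB Require Import structures.
From mathcomp Require Import all_boot all_order all_algebra.
From mathcomp Require Import complex.
From mathcomp Require Import all_classical all_reals all_analysis.

Set Implicit Arguments.
Unset Strict Implicit.
Unset Printing Implicit Defensive.

Import Order.TTheory GRing.Theory Num.Theory.

Local Open Scope classical_set_scope.
Local Open Scope ring_scope.
Local Open Scope complex_scope.

(* R^d as d-tuples of reals; its sigma-algebra is the one generated by the
   coordinates, i.e. the Borel one. *)
Notation Rd R d := (d.-tuple (measurableTypeR R)).

Section cons_pushforward.
Context (R : realType) (d : nat).
Variable mu : {sigma_finite_measure set (Rd R d) -> \bar R}.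

Definition tcons (x : measurableTypeR R * Rd R d) : Rd R d.+1 :=
  [the d.+1.-tuple (measurableTypeR R) of x.1 :: x.2].

Lemma measurable_tcons : measurable_fun [set: measurableTypeR R * Rd R d] tcons.
Proof. by apply: measurable_cons. Qed.

Definition cons_measure : set (Rd R d.+1) -> \bar R :=
  pushforward (@lebesgue_measure R \x mu)%E tcons.

Let cons_measure0 : cons_measure set0 = 0%E.
Proof. by rewrite /cons_measure /pushforward preimage_set0 measure0. Qed.

Let cons_measure_ge0 A : (0 <= cons_measure A)%E.
Proof. by rewrite /cons_measure /pushforward measure_ge0. Qed.

Let cons_measure_sigma_additive : semi_sigma_additive cons_measure.
Proof.
exact: (@measure_semi_sigma_additive _ _ _
  (measure_function_pushforward__canonical__measure_function_Measure
    (@lebesgue_measure R \x mu)%E measurable_tcons)).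
Qed.

HB.instance Definition _ := isMeasure.Build _ _ _ cons_measure
  cons_measure0 cons_measure_ge0 cons_measure_sigma_additive.

Lemma cons_measure_sigma_finite : sigma_finite setT cons_measure.
Proof.
have /sigma_finiteP[F [FT ndF mF]] := sigma_finiteT (@lebesgue_measure R).
have /sigma_finiteP[G [GT ndG mG]] := sigma_finiteT mu.
pose g (t : Rd R d.+1) : measurableTypeR R * Rd R d :=
  (thead t, [tuple of behead t]).
have mg : measurable_fun setT g.
  apply/measurable_fun_pairP; split; first exact: measurable_tnth.
  exact: measurable_behead.
have gK A : tcons @^-1` (g @^-1` A) = A.
  rewrite -comp_preimage (_ : _ \o _ = id)//; apply/funext => -[x t]/=.
  by rewrite /g /tcons theadE; congr pair; apply: val_inj.
exists (fun n => g @^-1` (F n `*` G n)).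
  rewrite -preimage_bigcup -[LHS](preimage_setT g); congr (g @^-1` _).
  rewrite -setXTT FT GT predeqE => -[x y]; split.
    move=> [/= [n _ Fnx] [k _ Gky]]; exists (maxn n k) => //; split.
    - by move: x Fnx; exact/subsetPset/ndF/leq_maxl.
    - by move: y Gky; exact/subsetPset/ndG/leq_maxr.
  by move=> [n _ []/= ? ?]; split; exists n.
move=> n; have [mFn Foo] := mF n; have [mGn Goo] := mG n; split.
  by rewrite -[X in measurable X]setTI; apply: mg => //; exact: measurableX.
rewrite /cons_measure /pushforward gK.
by rewrite product_measure1E// lte_mul_pinfty// ge0_fin_numE.
Qed.

HB.instance Definition _ :=
  Measure_isSigmaFinite.Build _ _ _ cons_measure cons_measure_sigma_finite.

End cons_pushforward.

(* Lebesgue measure on R^d, transported along R * R^d ~ R^d.+1. *)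
Fixpoint lebesgue_measured (R : realType) (d : nat) :
    {sigma_finite_measure set (Rd R d) -> \bar R} :=
  match d with
  | 0 => [the {sigma_finite_measure set (Rd R 0) -> \bar R} of
           dirac ([tuple] : Rd R 0)]
  | d'.+1 => [the {sigma_finite_measure set (Rd R d'.+1) -> \bar R} of
           cons_measure (lebesgue_measured R d')]
  end.

Section shift_invariant.
Context (R : realType) (d : nat).
Local Notation fn := (Rd R d -> R[i]).

(* Elements of L^2(R^d) are represented by functions rather than by classes
   modulo a.e. equality.  The sets S(Phi) (SI_span) are closures for the L^2
   seminorm, hence stable under a.e. equality, so that they are the same thing
   as subspaces of the quotient. *)
Definition L2norm (f : fn) : \bar R :=
  Lnorm (lebesgue_measured R d) 2%:E (fun x => (Normc.normc (f x))%:E).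

Definition L2 : set fn := [set f |
  [/\ measurable_fun setT (fun x => complex.Re (f x) : measurableTypeR R),
      measurable_fun setT (fun x => complex.Im (f x) : measurableTypeR R) &
      (L2norm f < +oo)%E]].

Definition translate (k : 'I_d -> int) (f : fn) : fn :=
  fun x => f [tuple tnth x i - (k i)%:~R | i < d].

Definition cspan (A : set fn) : set fn := [set g |
  exists (N : nat) (c : 'I_N -> R[i]) (h : 'I_N -> fn),
    (forall j, A (h j)) /\ g = (fun x => \sum_(j < N) c j * h j x)].

Definition L2closure (A : set fn) : set fn := [set f | L2 f /\
  forall eps : R, 0 < eps ->
    exists2 g, A g & (L2norm (fun x => f x - g x)%R < eps%:E)%E].

Definition SI_span (s : nat) (phi : 'I_s -> fn) : set fn :=
  L2closure (cspan [set g | exists i k, g = translate k (phi i)]).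

Definition fg_shift_invariant (S : set fn) : Prop :=
  exists (s : nat) (phi : 'I_s -> fn),
    (forall i, L2 (phi i)) /\ S = SI_span phi.

Definition generated_by (S : set fn) (l : nat) : Prop :=
  exists phi : 'I_l -> fn, (forall i, S (phi i)) /\ S = SI_span phi.

(* The zero subspace of L^2: all functions vanishing almost everywhere. *)
Definition zero_space : set fn := [set f | L2 f /\ L2norm f = 0%E].

Definition has_length (S : set fn) (l : nat) : Prop :=
  (S = zero_space /\ l = 0%N) \/
  [/\ S <> zero_space, (0 < l)%N, generated_by S l &
      forall k : nat, (0 < k)%N -> generated_by S k -> (l <= k)%N].

Definition length_le (n : nat) : set (set fn) := [set S |
  fg_shift_invariant S /\ exists2 l, has_length S l & (l <= n)%N].

Definition bundle (n l : nat) : set ('I_l -> set fn) :=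
  [set S | forall j, length_le n (S j)].

Definition d2 (f : fn) (S : set fn) : \bar R :=
  ereal_inf [set L2norm (fun x => f x - g x)%R | g in S].

(* The values are extended reals so that the minimum over an index set has a
   neutral element; for 0 < l everything is finite when f_i is in L^2 and
   S_j is in L_n. *)
Definition bundle_error (m l : nat) (f : 'I_m -> fn) (S : 'I_l -> set fn) :
    \bar R :=
  (\sum_(i < m) \big[mine/+oo]_(j < l) d2 (f i) (S j) ^+ 2)%E.

End shift_invariant.

(* Main.v *)
Require Import Defs.
From mathcomp Require Import all_boot all_order all_algebra.
From mathcomp Require Import complex.
From mathcomp Require Import all_classical all_reals all_analysis.
From mathcomp Require Import measurable_realfun.
From mathcomp Require Import ring lra.

(** The translates of a function by the lattice Z^d become simple after a Zak
    transform. Cut [f] along the lattice translates of the unit cube and let the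
    pieces be the Fourier coefficients of a function of a frequency [w] in the
    torus: the result [h (y, w)], with [y] in the cube, has the same L2 norm as
    [f], and translating [f] by [k] multiplies [h] by the character [echar k w].
    A shift-invariant space with generators [phi_1, ..., phi_n] thus becomes a
    field of subspaces: the fibre at [w] is spanned by the [n] functions
    [y |-> eta_j (y, w)], where [eta_j] is the transform of [phi_j]. Only the
    part of the theory needed for this is built: the transform is a relation
    [zak f h], obtained by closing its values on finite sums of translates of
    functions supported in the cube; it is isometric ([zak_isometry]), every
    square-integrable function has a transform ([zak_exists]), and bounded
    multipliers of the frequency preserve its range ([zak_multiplier]).

    For a single space, the problem splits into independent problems in the
    fibres: given [m] functions [h_k (., w)], find an [n]-dimensional space
    minimizing the sum of the squared distances. It is enough to look for this
    space inside the span of the data, with an orthogonal projection of C^m as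
    the unknown: if the competing approximations are [\sum_j c k j * v j], then
    projecting C^m away from the column space of [c] kills them, and shrinks the
    vector of the [h_k] ([residual_ge_projection]). Writing the projection as
    [B *m adjmx B] with [B] an [m] by [n] matrix bounded entrywise by one, the
    error is a continuous function of [B] on a compact set, and a minimizer can
    be chosen measurably in [w] ([measurable_minimizer], [optimal_matrices]).
    The generators are the inverse transforms of the functions
    [\sum_i conjc (B w i j) * h_i (y, w)].

    Two facts bring this back to closed spans of translates. A combination of
    translates of generators is, fibrewise, a combination of their transforms,
    which gives the lower bound ([cspan_zak]). Conversely a combination with
    bounded measurable coefficients is a limit of combinations with trigonometric
    polynomials as coefficients ([d2_SI_span_le]), because bounded
    functions of the frequency are limits of trigonometric polynomials in L2 of
    the finite measure defined by the transform ([trig_dense]). Together they give [best_generators].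

    For bundles, the error is a minimum over the assignments of the functions to
    the [l] spaces. There are finitely many assignments, and for each of them the
    spaces are optimized separately, one for each block of functions
    ([best_space]). *)

Set Implicit Arguments.
Unset Strict Implicit.
Unset Printing Implicit Defensive.

Import Order.TTheory GRing.Theory Num.Theory.
Import numFieldNormedType.Exports.

Local Open Scope classical_set_scope.
Local Open Scope ring_scope.
Local Open Scope complex_scope.

Local Notation Re := complex.Re.
Local Notation Im := complex.Im.

(** * Complex-valued functions on a measure space *)

Section squared_modulus.
Context {R : realType}.
Implicit Types u v z : R[i].

Definition sqmod z : R := Re z ^+ 2 + Im z ^+ 2.

(** The real inner product of the plane. *)
Definition cdot u v : R := Re u * Re v + Im u * Im v.

Lemma sqmod_ge0 z : 0 <= sqmod z.
Proof. by rewrite /sqmod addr_ge0// sqr_ge0. Qed.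

Lemma normc_sqmod z : Normc.normc z ^+ 2 = sqmod z.
Proof. by case: z => a b /=; rewrite sqr_sqrtr ?addr_ge0 ?sqr_ge0. Qed.

Lemma sqmod0 : sqmod 0 = 0.
Proof. by rewrite /sqmod /= !expr0n addr0. Qed.

Lemma sqmod_eq0 z : (sqmod z == 0) = (z == 0).
Proof.
case: z => a b; rewrite /sqmod/= paddr_eq0 ?sqr_ge0// !sqrf_eq0.
by rewrite eq_complex.
Qed.

Lemma sqmodM u v : sqmod (u * v) = sqmod u * sqmod v.
Proof. by case: u v => a b [c d]; rewrite /sqmod /=; ring. Qed.

Lemma sqmodN u : sqmod (- u) = sqmod u.
Proof. by case: u => a b; rewrite /sqmod/= !sqrrN. Qed.

Lemma sqmodJ u : sqmod (conjc u) = sqmod u.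
Proof. by case: u => a b; rewrite /sqmod/= sqrrN. Qed.

Lemma sqmodB u v : sqmod (u - v) = sqmod (v - u).
Proof. by rewrite -sqmodN opprB. Qed.

Lemma cReD u v : Re (u + v) = Re u + Re v. Proof. by case: u v => a b []. Qed.
Lemma cImD u v : Im (u + v) = Im u + Im v. Proof. by case: u v => a b []. Qed.
Lemma cReM u v : Re (u * v) = Re u * Re v - Im u * Im v.
Proof. by case: u v => a b []. Qed.
Lemma cImM u v : Im (u * v) = Re u * Im v + Im u * Re v.
Proof. by case: u v => a b []. Qed.
Lemma cReN u : Re (- u) = - Re u. Proof. by case: u. Qed.
Lemma cImN u : Im (- u) = - Im u. Proof. by case: u. Qed.
Lemma cReJ u : Re (conjc u) = Re u. Proof. by case: u. Qed.
Lemma cImJ u : Im (conjc u) = - Im u. Proof. by case: u. Qed.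

Lemma sqmod_real (a : R) : sqmod a%:C = a ^+ 2.
Proof. by rewrite /sqmod /= expr0n addr0. Qed.

Lemma cdot_le u v : `|cdot u v| <= (sqmod u + sqmod v) / 2.
Proof.
case: u v => a b [c d]; rewrite /cdot /sqmod/= ler_norml.
have := sqr_ge0 (a - c); have := sqr_ge0 (b - d).
have := sqr_ge0 (a + c); have := sqr_ge0 (b + d).
rewrite !expr2 => h1 h2 h3 h4; apply/andP; split; lra.
Qed.

(** The elementary substitute for the triangle inequality: it bounds squared
    norms directly. *)
Lemma sqmodD_le (e : R) u v : 0 < e ->
  sqmod (u + v) <= (1 + e) * sqmod u + (1 + e^-1) * sqmod v.
Proof.
move=> e0; case: u v => a b [c d]; rewrite /sqmod/= -subr_ge0.
have -> : (1 + e) * (a ^+ 2 + b ^+ 2) + (1 + e^-1) * (c ^+ 2 + d ^+ 2) -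
    ((a + c) ^+ 2 + (b + d) ^+ 2) =
    e^-1 * ((e * a - c) ^+ 2 + (e * b - d) ^+ 2).
  by field; rewrite gt_eqF.
by rewrite mulr_ge0 ?invr_ge0 ?(ltW e0) ?addr_ge0 ?sqr_ge0.
Qed.

Lemma sqmodD_le2 u v : sqmod (u + v) <= 2 * sqmod u + 2 * sqmod v.
Proof. by have := @sqmodD_le 1 u v ltr01; rewrite invr1 !mulrDl !mul1r. Qed.

Lemma sqmodB_le2 u v : sqmod (u - v) <= 2 * sqmod u + 2 * sqmod v.
Proof. by rewrite -(sqmodN v) sqmodD_le2. Qed.

Lemma cdotDl u v z : cdot (u + v) z = cdot u z + cdot v z.
Proof. by case: u v z => a b [c d] [e f]; rewrite /cdot/=; ring. Qed.

Lemma cdotC u v : cdot u v = cdot v u.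
Proof. by case: u v => a b [c d]; rewrite /cdot/=; ring. Qed.

Lemma cdot0 v : cdot 0 v = 0.
Proof. by rewrite /cdot/= !mul0r addr0. Qed.

Lemma sqmod_cdot u : sqmod u = cdot u u.
Proof. by rewrite /sqmod /cdot !expr2. Qed.

Lemma cdot_suml I (s : seq I) (F : I -> R[i]) v :
  cdot (\sum_(i <- s) F i) v = \sum_(i <- s) cdot (F i) v.
Proof. exact: (big_morph (cdot^~ v) (fun x y => cdotDl x y v) (cdot0 v)). Qed.

Lemma sqmod_sum I (s : seq I) (F : I -> R[i]) :
  sqmod (\sum_(i <- s) F i) = \sum_(i <- s) \sum_(j <- s) cdot (F i) (F j).
Proof.
rewrite sqmod_cdot cdot_suml; apply: eq_bigr => i _.
by rewrite cdotC cdot_suml; apply: eq_bigr => j _; rewrite cdotC.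
Qed.

(** A crude bound, in which only the existence of the constant matters. *)
Lemma sqmod_sum_le I (s : seq I) (P : pred I) (F : I -> R[i]) :
  sqmod (\sum_(i <- s | P i) F i)
  <= 2 ^+ size s * \sum_(i <- s | P i) sqmod (F i).
Proof.
have le2 k : 1 <= 2 ^+ k :> R by rewrite exprn_ege1// ler1n.
elim: s => [|i s ih].
  by rewrite !big_nil sqmod0 mulr0.
rewrite !big_cons /= exprS; case: ifP => Pi; last first.
  apply: (le_trans ih); rewrite -mulrA ler_peMl ?ler1n// mulr_ge0//.
  by apply: sumr_ge0 => j _; exact: sqmod_ge0.
apply: (le_trans (sqmodD_le2 _ _)); rewrite [leRHS]mulrDr lerD//.
  by rewrite -mulrA ler_wpM2l// ler_peMl// sqmod_ge0.
by rewrite -mulrA ler_wpM2l.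
Qed.

End squared_modulus.

Section measurable_complex.
Context {R : realType} d (T : measurableType d).
Implicit Types f g : T -> R[i].

Definition cmeasurable f := measurable_fun setT (fun x => Re (f x)) /\
  measurable_fun setT (fun x => Im (f x)).

Lemma cmeasurable_cst c : cmeasurable (fun=> c).
Proof. by split; exact: measurable_cst. Qed.

Lemma cmeasurableD f g : cmeasurable f -> cmeasurable g ->
  cmeasurable (fun x => f x + g x).
Proof.
move=> [f1 f2] [g1 g2]; split.
- by under eq_fun do rewrite cReD; exact: measurable_funD.
- by under eq_fun do rewrite cImD; exact: measurable_funD.
Qed.

Lemma cmeasurableN f : cmeasurable f -> cmeasurable (fun x => - f x).
Proof.
move=> [f1 f2]; split.
- by under eq_fun do rewrite cReN; exact: measurableT_comp.
- by under eq_fun do rewrite cImN; exact: measurableT_comp.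
Qed.

Lemma cmeasurableB f g : cmeasurable f -> cmeasurable g ->
  cmeasurable (fun x => f x - g x).
Proof. by move=> mf mg; apply: cmeasurableD => //; exact: cmeasurableN. Qed.

Lemma cmeasurableM f g : cmeasurable f -> cmeasurable g ->
  cmeasurable (fun x => f x * g x).
Proof.
move=> [f1 f2] [g1 g2]; split.
- by under eq_fun do rewrite cReM; apply: measurable_funB; exact: measurable_funM.
- by under eq_fun do rewrite cImM; apply: measurable_funD; exact: measurable_funM.
Qed.

Lemma cmeasurableJ f : cmeasurable f -> cmeasurable (fun x => conjc (f x)).
Proof.
move=> [f1 f2]; split.
- by under eq_fun do rewrite cReJ.
- by under eq_fun do rewrite cImJ; exact: measurableT_comp.
Qed.

Lemma cmeasurable_real (f : T -> R) : measurable_fun setT f ->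
  cmeasurable (fun x => (f x)%:C).
Proof. by move=> mf; split => //=; exact: measurable_cst. Qed.

Lemma cmeasurable_sum I (s : seq I) (P : pred I) (F : I -> T -> R[i]) :
  (forall i, cmeasurable (F i)) ->
  cmeasurable (fun x => \sum_(i <- s | P i) F i x).
Proof.
move=> mF; elim: s => [|i s ih].
  by under eq_fun do rewrite big_nil; exact: cmeasurable_cst.
under eq_fun do rewrite big_cons; case: (P i) => //.
exact: cmeasurableD.
Qed.

Lemma measurable_sqmod f : cmeasurable f ->
  measurable_fun setT (fun x => sqmod (f x)).
Proof. by move=> [f1 f2]; apply: measurable_funD; exact: measurable_funX. Qed.

Lemma measurable_Esqmod f : cmeasurable f ->
  measurable_fun setT (fun x => (sqmod (f x))%:E).
Proof. by move=> mf; apply/measurable_EFinP; exact: measurable_sqmod. Qed.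

Lemma measurable_cdot f g : cmeasurable f -> cmeasurable g ->
  measurable_fun setT (fun x => cdot (f x) (g x)).
Proof.
by move=> [? ?] [? ?]; apply: measurable_funD; exact: measurable_funM.
Qed.

End measurable_complex.

Lemma cmeasurable_comp (R : realType) d1 d2 (T1 : measurableType d1)
    (T2 : measurableType d2) (g : T1 -> T2) (f : T2 -> R[i]) :
  measurable_fun setT g -> cmeasurable f -> cmeasurable (fun x => f (g x)).
Proof.
move=> mg [f1 f2]; split.
- exact: (measurableT_comp f1 mg).
- exact: (measurableT_comp f2 mg).
Qed.

Section squared_norm.
Context {R : realType} d (T : measurableType d).
Variable mu : {measure set T -> \bar R}.
Implicit Types f g : T -> R[i].

Definition sqnorm f : \bar R := (\int[mu]_x (sqmod (f x))%:E)%E.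

Definition sqintegrable f := cmeasurable f /\ (sqnorm f < +oo)%E.

Lemma sqnorm_ge0 f : (0 <= sqnorm f)%E.
Proof. by apply: integral_ge0 => x _; rewrite lee_fin sqmod_ge0. Qed.

Lemma eq_sqnorm f g : (forall x, sqmod (f x) = sqmod (g x)) ->
  sqnorm f = sqnorm g.
Proof. by move=> fg; apply: eq_integral => x _; rewrite fg. Qed.

Lemma sqnormB f g : sqnorm (fun x => f x - g x) = sqnorm (fun x => g x - f x).
Proof. by apply: eq_sqnorm => x; rewrite sqmodB. Qed.

Lemma sqnorm0 : sqnorm (fun=> 0) = 0%E.
Proof. by rewrite /sqnorm integral0_eq// => x _; rewrite sqmod0. Qed.

Lemma le_sqnorm f g : cmeasurable f -> cmeasurable g ->
  (forall x, sqmod (f x) <= sqmod (g x)) -> (sqnorm f <= sqnorm g)%E.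
Proof.
move=> mf mg fg; apply: ge0_le_integral => //.
- by move=> x _; rewrite lee_fin sqmod_ge0.
- exact: measurable_Esqmod.
- exact: measurable_Esqmod.
- by move=> x _; rewrite lee_fin.
Qed.

(** All the estimates of squared norms come from pointwise ones. *)
Lemma sqnorm_le_comb (a b : R) f g h : 0 <= a -> 0 <= b ->
  cmeasurable f -> cmeasurable g -> cmeasurable h ->
  (forall x, sqmod (h x) <= a * sqmod (f x) + b * sqmod (g x)) ->
  (sqnorm h <= a%:E * sqnorm f + b%:E * sqnorm g)%E.
Proof.
move=> a0 b0 mf mg mh fgh.
have s0 (k : T -> R[i]) x : (0 <= (sqmod (k x))%:E)%E by rewrite lee_fin sqmod_ge0.
rewrite /sqnorm -!ge0_integralZl//; try exact: measurable_Esqmod.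
rewrite -ge0_integralD//; last 4 first.
- by move=> x _; rewrite mule_ge0 ?s0.
- by apply: measurable_funeM; exact: measurable_Esqmod.
- by move=> x _; rewrite mule_ge0 ?s0.
- by apply: measurable_funeM; exact: measurable_Esqmod.
apply: ge0_le_integral => //.
- exact: measurable_Esqmod.
- by apply: emeasurable_funD; apply: measurable_funeM; exact: measurable_Esqmod.
- by move=> x _; rewrite -!EFinM -EFinD lee_fin.
Qed.

Lemma sqnormD_le (e : R) f g : 0 < e -> cmeasurable f -> cmeasurable g ->
  (sqnorm (fun x => (f x + g x)%R)
   <= (1 + e)%:E * sqnorm f + (1 + e^-1)%:E * sqnorm g)%E.
Proof.
move=> e0 mf mg; apply: sqnorm_le_comb => //.
- by rewrite addr_ge0// ltW.
- by rewrite addr_ge0// ltW// invr_gt0.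
- exact: cmeasurableD.
- by move=> x; exact: sqmodD_le.
Qed.

Lemma sqnormD_le2 f g : cmeasurable f -> cmeasurable g ->
  (sqnorm (fun x => (f x + g x)%R) <= 2%:E * sqnorm f + 2%:E * sqnorm g)%E.
Proof.
move=> mf mg; apply: sqnorm_le_comb => //; first exact: cmeasurableD.
by move=> x; exact: sqmodD_le2.
Qed.

Lemma sqnormZ (c : R[i]) f : cmeasurable f ->
  sqnorm (fun x => (c * f x)%R) = ((sqmod c)%:E * sqnorm f)%E.
Proof.
move=> mf; rewrite /sqnorm -ge0_integralZl//; last 3 first.
- exact: measurable_Esqmod.
- by move=> x _; rewrite lee_fin sqmod_ge0.
- by rewrite lee_fin sqmod_ge0.
by apply: eq_integral => x _; rewrite sqmodM.
Qed.

Lemma sqintegrable0 : sqintegrable (fun=> 0).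
Proof. by split; [exact: cmeasurable_cst|rewrite sqnorm0]. Qed.

Lemma sqintegrableD f g : sqintegrable f -> sqintegrable g ->
  sqintegrable (fun x => f x + g x).
Proof.
move=> [mf f2] [mg g2]; split; first exact: cmeasurableD.
by apply: (le_lt_trans (sqnormD_le2 mf mg)); rewrite lte_add_pinfty// lte_mul_pinfty.
Qed.

Lemma sqintegrable_le (a : R) f g : 0 <= a -> cmeasurable f -> sqintegrable g ->
  (forall x, sqmod (f x) <= a * sqmod (g x)) -> sqintegrable f.
Proof.
move=> a0 mf [mg g2] fg; split => //.
have := @sqnorm_le_comb a 0 g (fun=> 0) f a0 (lexx _) mg (cmeasurable_cst _ _) mf.
rewrite mul0e adde0 => h; apply: (le_lt_trans (h _)) => [x|].
  by rewrite mul0r addr0.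
by rewrite lte_mul_pinfty// ge0_fin_numE ?sqnorm_ge0.
Qed.

Lemma sqintegrableZ (c : R[i]) f : sqintegrable f ->
  sqintegrable (fun x => c * f x).
Proof.
move=> if2; apply: (@sqintegrable_le (sqmod c) _ f) => //.
- exact: sqmod_ge0.
- by apply: cmeasurableM; [exact: cmeasurable_cst|case: if2].
- by move=> x; rewrite sqmodM.
Qed.

Lemma sqintegrableN f : sqintegrable f -> sqintegrable (fun x => - f x).
Proof.
by move=> /(sqintegrableZ (-1)); under eq_fun do rewrite mulN1r.
Qed.

Lemma sqintegrableB f g : sqintegrable f -> sqintegrable g ->
  sqintegrable (fun x => f x - g x).
Proof. by move=> f2 /sqintegrableN; exact: sqintegrableD. Qed.

Lemma sqintegrable_sum I (s : seq I) (P : pred I) (F : I -> T -> R[i]) :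
  (forall i, sqintegrable (F i)) ->
  sqintegrable (fun x => \sum_(i <- s | P i) F i x).
Proof.
move=> mF; elim: s => [|i s ih].
  by under eq_fun do rewrite big_nil; exact: sqintegrable0.
under eq_fun do rewrite big_cons; case: (P i) => //.
exact: sqintegrableD.
Qed.

Lemma sqnorm_fin f : sqintegrable f -> sqnorm f \is a fin_num.
Proof. by move=> [_ f2]; rewrite ge0_fin_numE// sqnorm_ge0. Qed.

Lemma integrable_sqmod f : sqintegrable f ->
  mu.-integrable setT (fun x => (sqmod (f x))%:E).
Proof.
move=> [mf f2]; apply/integrableP; split; first exact: measurable_Esqmod.
by under eq_integral do rewrite gee0_abs ?lee_fin ?sqmod_ge0//.
Qed.

Lemma integrable_cdot f g : sqintegrable f -> sqintegrable g ->
  mu.-integrable setT (fun x => (cdot (f x) (g x))%:E).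
Proof.
move=> f2 g2; have [mf _] := f2; have [mg _] := g2.
apply: (@le_integrable _ _ _ mu setT measurableT _
    (fun x => (sqmod (f x))%:E + (sqmod (g x))%:E)%E).
- by apply/measurable_EFinP; exact: measurable_cdot.
- move=> x _; rewrite -EFinD !abse_EFin lee_fin.
  apply: (le_trans (cdot_le _ _)).
  rewrite [leRHS]ger0_norm ?(addr_ge0 (sqmod_ge0 _) (sqmod_ge0 _))//.
  by have := sqmod_ge0 (f x); have := sqmod_ge0 (g x); lra.
- exact: (integrableD measurableT (integrable_sqmod f2) (integrable_sqmod g2)).
Qed.

Lemma sqnorm_sum_le I (s : seq I) (F : I -> T -> R[i]) :
  (forall i, cmeasurable (F i)) ->
  (sqnorm (fun x => (\sum_(i <- s) F i x)%R)
   <= (2 ^+ size s)%:E * \sum_(i <- s) sqnorm (F i))%E.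
Proof.
move=> mF; rewrite /sqnorm -ge0_integral_sum//; last 2 first.
- by move=> i; exact: measurable_Esqmod.
- by move=> i x _; rewrite lee_fin sqmod_ge0.
rewrite -ge0_integralZl//; last 2 first.
- by apply: emeasurable_sum => i; exact: measurable_Esqmod.
- by move=> x _; apply: sume_ge0 => i _; rewrite lee_fin sqmod_ge0.
apply: ge0_le_integral => //.
- by move=> x _; rewrite lee_fin sqmod_ge0.
- by apply: measurable_Esqmod; exact: cmeasurable_sum.
- apply: measurable_funeM.
  by apply: emeasurable_sum => i; exact: measurable_Esqmod.
- move=> x _; rewrite sumEFin -EFinM lee_fin; exact: sqmod_sum_le.
Qed.

End squared_norm.

(** * Completeness of the space of square-integrable functions *)

Section completeness.
Context {R : realType} d (T : measurableType d).
Variable mu : {measure set T -> \bar R}.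

Lemma geometric_dominated_cvg (u : R^nat) (M : R) :
  (forall n, `|u n.+1 - u n| <= M / 2 ^+ n) -> cvgn u.
Proof.
move=> uM; have -> : u = (fun n => u 0 + series (telescope u) n).
  by apply/funext => n; rewrite -eq_sum_telescope.
apply: is_cvgD; first exact: is_cvg_cst.
apply: normed_cvg.
apply: (@series_le_cvg _ _ (geometric M 2^-1)) => [n|n|n|].
- exact: normr_ge0.
- rewrite /= mulr_ge0 ?exprn_ge0 ?invr_ge0//.
  by have := uM 0; rewrite expr0 divr1; exact: le_trans.
- by rewrite /telescope/= exprVn; exact: uM.
- by apply: is_cvg_geometric_series; rewrite ger0_norm ?invr_ge0// invf_lt1// ltr1n.
Qed.

Variable f : nat -> T -> R[i].
Hypothesis f2 : forall r, sqintegrable mu (f r).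
Hypothesis f_fast : forall r,
  (sqnorm mu (fun x => (f r.+1 x - f r x)%R) <= (8 ^- r)%:E)%E.

Let mf r : cmeasurable (f r). Proof. by case: (f2 r). Qed.

Let D (r : nat) x := f r.+1 x - f r x.

Let mD r : cmeasurable (D r). Proof. exact: cmeasurableB. Qed.

(* The constant 4 reproduces itself: 2 * (4 / 8) + 2 <= 4. *)
Let tail_le k r :
  (sqnorm mu (fun x => (f r x - f (r + k)%N x)%R) <= (4 * 8 ^- r)%:E)%E.
Proof.
elim: k r => [r|k ih r].
  have -> : (fun x => f r x - f (r + 0)%N x) = fun=> 0.
    by apply/funext => x; rewrite addn0 subrr.
  by rewrite sqnorm0 lee_fin mulr_ge0// invr_ge0 exprn_ge0.
have -> : (fun x => f r x - f (r + k.+1)%N x) =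
    (fun x => (f r.+1 x - f (r.+1 + k)%N x) + (f r x - f r.+1 x)).
  by apply/funext => x; rewrite addnS addSn [RHS]addrC subrKA.
apply: (le_trans (sqnormD_le2 _ _ _)); [exact: cmeasurableB|exact: cmeasurableB|].
apply: (@le_trans _ _ (2%:E * (4 * 8 ^- r.+1)%:E + 2%:E * (8 ^- r)%:E)%E).
  apply: leeD.
    by rewrite lee_pmul2l ?lte_fin//; exact: ih.
  by rewrite lee_pmul2l ?lte_fin// sqnormB; exact: f_fast.
rewrite -!EFinM -EFinD lee_fin exprS invfM.
have : 0 <= (8 ^+ r)^-1 :> R by rewrite invr_ge0 exprn_ge0.
lra.
Qed.

(* The weights [4 ^+ r] force geometric decay of the increments wherever the sum is
   finite, and are small enough for its integral to be finite. *)
Let S x : \bar R := (\sum_(r <oo) (4 ^+ r * sqmod (D r x))%:E)%E.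

Let mS : measurable_fun setT S.
Proof.
apply: ge0_emeasurable_sum => [r x _ _|r _].
  by rewrite lee_fin mulr_ge0 ?exprn_ge0 ?sqmod_ge0.
by apply/measurable_EFinP; apply: measurable_funM => //; exact: measurable_sqmod.
Qed.

Let S0 x : (0 <= S x)%E.
Proof.
by apply: nneseries_ge0 => r _ _; rewrite lee_fin mulr_ge0 ?exprn_ge0 ?sqmod_ge0.
Qed.

Let S_ae : {ae mu, forall x, setT x -> S x \is a fin_num}.
Proof.
apply: (integrable_ae measurableT); apply/integrableP; split => //.
under eq_integral do rewrite gee0_abs ?S0//.
rewrite integral_nneseries//; last 2 first.
- move=> r; apply/measurable_EFinP; apply: measurable_funM => //.
  exact: measurable_sqmod.
- by move=> r x _; rewrite lee_fin mulr_ge0 ?exprn_ge0 ?sqmod_ge0.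
apply: (@le_lt_trans _ _ (\sum_(r <oo) (2 / (2 ^ (r + 1))%:R)%:E)%E); last first.
  by have /cvg_lim -> := @cvg_geometric_eseries_half R 2 0; rewrite // ltry.
apply: lee_nneseries => [r _ _|r _].
  by apply: integral_ge0 => x _; rewrite lee_fin mulr_ge0 ?exprn_ge0 ?sqmod_ge0.
under eq_integral do rewrite EFinM.
rewrite ge0_integralZl//; last 2 first.
- exact: measurable_Esqmod.
- by move=> x _; rewrite lee_fin sqmod_ge0.
apply: (@le_trans _ _ ((4 ^+ r)%:E * (8 ^- r)%:E)%E).
  by rewrite lee_wpmul2l ?lee_fin ?exprn_ge0//; exact: f_fast.
rewrite -EFinM lee_fin addn1 expnS natrM invfM mulrA divff// mul1r natrX.
have -> : 8 ^+ r = 4 ^+ r * 2 ^+ r :> R by rewrite -exprMn_comm ?natrM//; [congr (_ ^+ _); ring|rewrite /GRing.comm mulrC].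
by rewrite invfM mulrA divff ?mul1r// expf_neq0.
Qed.

Let E := [set x | S x \is a fin_num].

Let mE : measurable E.
Proof. by rewrite -[E]setTI; exact: emeasurable_fin_num. Qed.

Let D_le r x : E x -> 4 ^+ r * sqmod (D r x) <= fine (S x).
Proof.
move=> Ex; rewrite -lee_fin fineK//.
have h0 k : (0 <= (4 ^+ k * sqmod (D k x))%:E)%E.
  by rewrite lee_fin mulr_ge0 ?exprn_ge0 ?sqmod_ge0.
have hS := @nneseries_lim_ge R _ xpredT 0 r.+1 (fun k _ _ => h0 k).
apply: le_trans hS.
by rewrite big_mkord big_ord_recr/= leeDr// sume_ge0.
Qed.

Let coord_cvg (p : R[i] -> R) x : (forall z, p z ^+ 2 <= sqmod z) ->
  (forall u v, p (u - v) = p u - p v) -> E x -> cvgn (fun r => p (f r x)).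
Proof.
move=> p2 pB Ex; apply: (@geometric_dominated_cvg _ (1 + fine (S x))) => r.
rewrite -pB ler_pdivlMr ?exprn_gt0//.
have s0 : 0 <= fine (S x) by apply: fine_ge0; exact: S0.
have : (`|p (D r x)| * 2 ^+ r) ^+ 2 <= fine (S x).
  apply: le_trans (D_le r Ex); rewrite exprMn real_normK ?num_real// mulrC.
  have -> : (2 ^+ r) ^+ 2 = 4 ^+ r :> R.
    by rewrite -exprM mulnC exprM; congr (_ ^+ _); rewrite expr2 -natrM.
  by rewrite ler_wpM2l// exprn_ge0.
rewrite -/(D r x); set a := _ * _ => a2.
have a0 : 0 <= a by rewrite mulr_ge0// exprn_ge0.
by nra.
Qed.

Let g x := if pselect (E x) then Complex (limn (fun r => Re (f r x)))
  (limn (fun r => Im (f r x))) else 0.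

Let g_cvg x : E x -> (fun r => Re (f r x)) @ \oo --> Re (g x) /\
  (fun r => Im (f r x)) @ \oo --> Im (g x).
Proof.
move=> Ex; rewrite /g; case: pselect => // _ /=.
split; apply: coord_cvg => //.
- by move=> z; rewrite /sqmod lerDl sqr_ge0.
- by move=> u v; rewrite cReD cReN.
- by move=> z; rewrite /sqmod lerDr sqr_ge0.
- by move=> u v; rewrite cImD cImN.
Qed.

Let mg : cmeasurable g.
Proof.
have mfE r : cmeasurable (fun x => (\1_E x)%:C * f r x).
  apply: cmeasurableM => //; apply: cmeasurable_real; exact: measurable_indic.
have fE r x : E x -> (\1_E x)%:C * f r x = f r x.
  by move=> Ex; rewrite indicE mem_set//= mul1r.
have fN r x : ~ E x -> (\1_E x)%:C * f r x = 0.
  by move=> Ex; rewrite indicE memNset//= mul0r.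
split.
- apply: (@measurable_fun_cvg _ _ _ _ (fun r x => Re ((\1_E x)%:C * f r x))).
    by move=> r; case: (mfE r).
  move=> x _; have [Ex|Ex] := pselect (E x).
    by under eq_fun do rewrite fE//; exact: (proj1 (g_cvg Ex)).
  under eq_fun do rewrite fN//; rewrite /g; case: pselect => [//|nE].
  exact: cvg_cst.
- apply: (@measurable_fun_cvg _ _ _ _ (fun r x => Im ((\1_E x)%:C * f r x))).
    by move=> r; case: (mfE r).
  move=> x _; have [Ex|Ex] := pselect (E x).
    by under eq_fun do rewrite fE//; exact: (proj2 (g_cvg Ex)).
  under eq_fun do rewrite fN//; rewrite /g; case: pselect => [//|nE].
  exact: cvg_cst.
Qed.

(** A sequence with geometrically small increments converges almost everywhere,
    and Fatou's lemma makes the pointwise limit a limit in squared norm. *)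
Lemma sqnorm_complete : exists2 g0, sqintegrable mu g0 &
  forall r, (sqnorm mu (fun x => (f r x - g0 x)%R) <= (4 * 8 ^- r)%:E)%E.
Proof.
have gle r : (sqnorm mu (fun x => (f r x - g x)%R) <= (4 * 8 ^- r)%:E)%E.
  pose F k x := (sqmod (f r x - f (r + k)%N x))%:E.
  have mF k : measurable_fun setT (F k).
    by apply: measurable_Esqmod; exact: cmeasurableB.
  have F0 k x : setT x -> (0 <= F k x)%E by rewrite lee_fin sqmod_ge0.
  apply: (@le_trans _ _ (\int[mu]_x limn_einf (F ^~ x))%E).
    apply: ae_ge0_le_integral => //.
    - by move=> x _; rewrite lee_fin sqmod_ge0.
    - by apply: measurable_Esqmod; exact: cmeasurableB.
    - move=> x _; rewrite limn_einf_lim; apply: lime_ge; first exact: is_cvg_einfs.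
      by apply: nearW => k; apply: le_ereal_inf_tmp => _ [m _ <-]; exact: F0.
    - have := measurable_fun_limn_esup (fun k => measurableT_comp (@oppe_measurable R setT) (mF k)).
      move=> /(measurableT_comp (@oppe_measurable R setT)).
      exact.
    apply: filterS S_ae => x Sx _; have Ex : E x by exact: Sx.
    have [Rc Ic] := g_cvg Ex.
    have : F ^~ x @ \oo --> (sqmod (f r x - g x))%:E.
      apply: cvg_EFin; first by apply: nearW.
      rewrite /comp /F /sqmod /=; under eq_fun do rewrite !cReD !cImD !cReN !cImN !expr2.
      rewrite !cReD !cImD !cReN !cImN !expr2.
      have Rc' : (fun k => Re (f r x) - Re (f (r + k)%N x)) @ \oo --> Re (f r x) - Re (g x).
        apply: cvgB; first exact: cvg_cst.
        by move: Rc; rewrite -(cvg_shiftn r)/=; under eq_fun do rewrite addnC.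
      have Ic' : (fun k => Im (f r x) - Im (f (r + k)%N x)) @ \oo --> Im (f r x) - Im (g x).
        apply: cvgB; first exact: cvg_cst.
        by move: Ic; rewrite -(cvg_shiftn r)/=; under eq_fun do rewrite addnC.
      by apply: cvgD; apply: cvgM.
    by move/cvg_limn_einf_sup => [->].
  apply: (le_trans (fatou mu measurableT mF F0)).
  rewrite limn_einf_lim; apply: lime_le; first exact: is_cvg_einfs.
  apply: nearW => k; apply: le_trans (tail_le k r).
  by apply: ereal_inf_lbound; exists k => /=.
exists g => //; split => //.
have -> : g = (fun x => f 0 x - (f 0 x - g x)).
  by apply/funext => x; rewrite opprB addrC subrK.
have [_ f0] := f2 0; have := gle 0.
move=> /le_lt_trans /(_ (ltry _)) h.
have := sqintegrableB (f2 0) (conj (cmeasurableB (mf 0) mg) h).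
by case.
Qed.

End completeness.

(** * Measurable selection of minimizers *)

Section measurable_selection.
Context {R : realType} d (T : measurableType d).

Lemma measurable_nat_fibers (r : T -> nat) :
  (forall k, measurable [set w | r w = k]) -> measurable_fun setT r.
Proof.
move=> mr _ B _; rewrite setTI.
have -> : r @^-1` B = \bigcup_(k in B) [set w | r w = k].
  apply/seteqP; split => [w Bw|w [k Bk /= rk]]; first by exists (r w).
  by rewrite /preimage/= rk.
exact: bigcup_measurable.
Qed.

Lemma measurable_diagonal d' (U : measurableType d') (a : nat -> T -> U)
    (r : T -> nat) : (forall k, measurable_fun setT (a k)) ->
  measurable_fun setT r -> measurable_fun setT (fun w => a (r w) w).
Proof.
move=> ma mr _ B mB; rewrite setTI.
have -> : (fun w => a (r w) w) @^-1` B =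
    \bigcup_k (r @^-1` [set k] `&` a k @^-1` B).
  apply/seteqP; split => [w Bw|w [k _ [/= rk]]]; first by exists (r w).
  by rewrite /preimage/= rk.
apply: bigcupT_measurable => k; apply: measurableI.
  by rewrite -[X in measurable X]setTI; apply: mr.
by rewrite -[X in measurable X]setTI; apply: ma.
Qed.

(** A selection is made measurable by always taking the first valid index. *)
Lemma measurable_first_index (P : nat -> set T) :
  (forall k, measurable (P k)) -> (forall w, exists k, P k w) ->
  exists2 r : T -> nat, measurable_fun setT r & forall w, P (r w) w.
Proof.
move=> mP exP; have exb w : exists k, `[< P k w >].
  by have [k Pk] := exP w; exists k; apply/asboolP.
exists (fun w => ex_minn (exb w)); last first.
  by move=> w; case: ex_minnP => k /asboolP.
apply: measurable_nat_fibers => k.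
have -> : [set w | ex_minn (exb w) = k] =
    P k `&` \bigcap_(j in [set j | (j < k)%N]) ~` P j.
  apply/seteqP; split => [w /= <-|w [/= Pk kmin]].
    case: ex_minnP => m /asboolP Pm min; split => // j /= jm Pj.
    by have /min := asboolT Pj; rewrite leqNgt jm.
  case: ex_minnP => m /asboolP Pm min; apply/eqP; rewrite eqn_leq.
  rewrite min; last exact/asboolP.
  by rewrite leqNgt; apply/negP => mk; exact: (kmin m mk).
apply: measurableI => //; apply: bigcap_measurableType.
by move=> j _; exact: measurableC.
Qed.

Lemma limn_sup_cluster (u : R^nat) (M : R) (n : nat) (e : R) : 0 < e ->
  (forall k, `|u k| <= M) -> exists2 k, (n <= k)%N & `|u k - limn_sup u| < e.
Proof.
move=> e0 uM.
have ubu : has_ubound (range u).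
  by exists M => _ [k _ <-]; exact: le_trans (ler_norm _) (uM k).
have lbu : has_lbound (range u).
  exists (- M) => _ [k _ <-]; rewrite lerNl; apply: le_trans (uM k).
  by rewrite -normrN ler_norm.
have bu : bounded_fun u.
  by exists M; split; [exact: num_real|move=> x Mx k _; exact: le_trans (uM k) (ltW Mx)].
have lbs := bounded_fun_has_lbound_sups bu.
have [s [m _ <-] sm] : exists2 s, range (sups u) s & s < limn_sup u + e.
  have [|s rs] := @inf_adherent _ (range (sups u)) e e0.
    by split => //; exists (sups u 0); exists 0.
  by rewrite -limn_supE//; exists s.
pose p := maxn n m.
have sp : sups u p < limn_sup u + e.
  by apply: le_lt_trans sm; apply: nonincreasing_sups => //; rewrite leq_maxr.
have tp : limn_sup u <= sups u p.
  by rewrite limn_supE//; apply: inf_lbound => //; exists p.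
have [|_ [k /= pk <-] uk] := @sup_adherent _ (sdrop u p) e e0.
  by split; [exists (u p); exists p => /=|exact: has_ubound_sdrop].
exists k; first by rewrite (leq_trans _ pk)// leq_maxl.
have ku : u k <= sups u p.
  by apply: ub_le_sup; [exact: has_ubound_sdrop|exists k].
have {}uk : sups u p - e < u k by exact: uk.
by rewrite ltr_norml; apply/andP; split; lra.
Qed.

Lemma measurable_convergent_subsequence1 (a : nat -> T -> R) (M : R) :
  (forall k, measurable_fun setT (a k)) -> (forall k w, `|a k w| <= M) ->
  exists r : nat -> T -> nat, [/\ forall k, measurable_fun setT (r k),
    forall k w, (k <= r k w)%N & forall w, cvgn (fun k => a (r k w) w)].
Proof.
move=> ma aM; pose t w := limn_sup (a ^~ w).
have mt : measurable_fun setT t.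
  apply: measurable_fun_limn_sup => // w _.
    by exists M => _ [k _ <-]; exact: le_trans (ler_norm _) (aM k w).
  exists (- M) => _ [k _ <-]; rewrite lerNl; apply: le_trans (aM k w).
  by rewrite -normrN ler_norm.
have ex k : exists r : T -> nat, [/\ measurable_fun setT r,
    forall w, (k <= r w)%N & forall w, `|a (r w) w - t w| < k.+1%:R^-1].
  pose P j := if (k <= j)%N then [set w | `|a j w - t w| < k.+1%:R^-1] else set0.
  have [|w|r mr rP] := @measurable_first_index P.
  - move=> j; rewrite /P; case: ifP => _; last exact: measurable0.
    rewrite -[X in measurable X]setTI.
    apply: (@measurable_fun_ltr _ _ _ setT (fun w => `|a j w - t w|)
      (fun=> k.+1%:R^-1) _ _ measurableT [set true]) => //.
    by apply: measurableT_comp => //; exact: measurable_funB.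
  - have [//|j kj ajt] := @limn_sup_cluster (a ^~ w) M k (k.+1%:R^-1) _ (aM ^~ w).
    by exists j; rewrite /P kj.
  by exists r; split => // w; have := rP w; rewrite /P; case: ifP.
have [r rP] := choice ex.
exists r; split => [k|k w|w]; [by have [] := rP k|by have [] := rP k|].
apply/cvg_ex; exists (t w); apply/cvgrPdist_lt => e e0.
near=> k; rewrite distrC; have [_ _ /(_ w)/lt_trans] := rP k; apply.
by near: k; exact: (near_infty_natSinv_lt (PosNum e0)).
Unshelve. all: by end_near. Qed.

(** Measurable Bolzano-Weierstrass: the coordinates are made convergent one
    after the other, each time along indices where the sequence is close to its
    upper limit. *)
Lemma measurable_convergent_subsequence (I : finType) (a : nat -> T -> I -> R)
    (M : R) : (forall k i, measurable_fun setT (fun w => a k w i)) ->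
  (forall k w i, `|a k w i| <= M) ->
  exists r : nat -> T -> nat, [/\ forall k, measurable_fun setT (r k),
    forall k w, (k <= r k w)%N & forall w i, cvgn (fun k => a (r k w) w i)].
Proof.
move=> ma aM.
suff [r [mr rk rc]] : exists r : nat -> T -> nat,
    [/\ forall k, measurable_fun setT (r k), forall k w, (k <= r k w)%N &
      forall w i, i \in enum I -> cvgn (fun k => a (r k w) w i)].
  by exists r; split => // w i; apply: rc; rewrite mem_enum.
elim: (enum I) => [|i s [r [mr rk rc]]].
  by exists (fun k _ => k); split => // k; exact: measurable_cst.
have [||r' [mr' rk' rc']] :=
  @measurable_convergent_subsequence1 (fun k w => a (r k w) w i) M.
- by move=> k; apply: (measurable_diagonal (a := fun k w => a k w i)).
- by [].
exists (fun k w => r (r' k w) w); split => [k|k w|w j].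
- exact: measurable_diagonal.
- exact: leq_trans (rk' k w) (rk _ _).
- rewrite inE => /predU1P[->|js]; first exact: rc'.
  have /cvg_ex[/= l al] := rc w j js; apply/cvg_ex; exists l => /=.
  apply: cvg_trans al.
  apply: (@cvg_comp _ _ _ (fun k => r' k w) (fun k => a (r k w) w j) \oo \oo) => //.
  move=> A [m _ mA]; exists m => // k /= mk; apply: mA => /=.
  exact: leq_trans mk (rk' k w).
Qed.

Section minimizer.
Variables (I : finType) (M : R).

(* The points with rational coordinates in a slightly larger box. *)
Let q (k : nat) (i : I) : R :=
  if @unpickle {ffun I -> rat} k is Some g then
    if `|ratr (g i) : R| <= M + 1 then ratr (g i) else 0
  else 0.

Let q_dense (y : I -> R) (n : nat) : (forall i, `|y i| <= M) ->
  exists k, forall i, `|q k i - y i| < n.+1%:R^-1.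
Proof.
move=> yM.
have ex i : exists g : rat, `|ratr g - y i| < n.+1%:R^-1.
  have [|g] := @rat_in_itvoo R (y i - n.+1%:R^-1) (y i + n.+1%:R^-1).
    by rewrite ltrBlDr -addrA ltrDl addr_gt0.
  rewrite in_itv/= => /andP[g1 g2]; exists g; rewrite ltr_norml ltrBlDr ltrBrDl.
  by rewrite g1 [X in _ < X]addrC g2.
have [g gP] := choice ex.
exists (pickle [ffun i => g i]) => i; rewrite /q pickleK ffunE ifT; first exact: gP.
rewrite -[ratr (g i)](subrK (y i)) addrC; apply: (le_trans (ler_normD _ _)).
apply: lerD; first exact: yM.
by rewrite (le_trans (ltW (gP i)))// invf_le1// ler1n.
Qed.

Let q_bound k i : 0 <= M -> `|q k i| <= M + 1.
Proof.
move=> M0; have M1 : 0 <= M + 1 by rewrite addr_ge0.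
by rewrite /q; case: unpickle => [g|]; [case: ifPn => //|]; rewrite normr0.
Qed.

(** Near-minimizers are found measurably among countably many points; a
    convergent subsequence of them leads to a minimizer. *)
Lemma measurable_minimizer (f : T -> (I -> R) -> R) : 0 <= M ->
  (forall y, measurable_fun setT (f ^~ y)) ->
  (forall w y, 0 <= f w y) ->
  (forall w (u : nat -> I -> R) y, (forall i, u ^~ i @ \oo --> y i) ->
    (fun k => f w (u k)) @ \oo --> f w y) ->
  exists x : T -> I -> R, [/\ forall i, measurable_fun setT (x ^~ i),
    forall w i, `|x w i| <= M + 1 &
    forall w y, (forall i, `|y i| <= M) -> f w (x w) <= f w y].
Proof.
move=> M0 mf f0 fc.
have ex n : exists2 r : T -> nat, measurable_fun setT r &
    forall w j, f w (q (r w)) <= f w (q j) + n.+1%:R^-1.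
  pose P k := \bigcap_j [set w | f w (q k) <= f w (q j) + n.+1%:R^-1].
  have [|w|r mr rP] := @measurable_first_index P.
  - move=> k; apply: bigcapT_measurable => j; rewrite -[X in measurable X]setTI.
    apply: (@measurable_fun_ler _ _ _ setT (f ^~ (q k))
      (fun w => f w (q j) + n.+1%:R^-1) _ _ measurableT [set true]) => //.
    by apply: measurable_funD => //; exact: measurable_cst.
  - have [||_ [k _ <-] fk] :=
      @inf_adherent _ (range (fun j => f w (q j))) n.+1%:R^-1.
    + by rewrite invr_gt0.
    + by split; [exists (f w (q 0)); exists 0|exists 0 => _ [j _ <-]].
    exists k => j _ /=; apply: (le_trans (ltW fk)); rewrite lerD2r.
    by apply: inf_lbound; [exists 0 => _ [i _ <-]|exists j].
  by exists r => // w j; exact: rP.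
have /choice[r0 r0P] : forall n, exists r : T -> nat,
    measurable_fun setT r /\ forall w j, f w (q (r w)) <= f w (q j) + n.+1%:R^-1.
  by move=> n; have [r] := ex n; exists r.
have [||r [mr rk rc]] := @measurable_convergent_subsequence I
  (fun k w i => q (r0 k w) i) (M + 1).
- move=> k i; apply: (measurable_diagonal (a := fun k _ => q k i)).
    by move=> j; exact: measurable_cst.
  by have [] := r0P k.
- by move=> k w i; exact: q_bound.
pose x w i := limn (fun k => q (r0 (r k w) w) i).
have xc w i : (fun k => q (r0 (r k w) w) i) @ \oo --> x w i by exact: rc.
exists x; split.
- move=> i; apply: (@measurable_fun_cvg _ _ _ _
    (fun k w => q (r0 (r k w) w) i)) => [k|w _]; last exact: xc.
  apply: (measurable_diagonal (a := fun k w => q (r0 k w) i)) => //.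
  move=> j; apply: (measurable_diagonal (a := fun k _ => q k i)).
    by move=> ?; exact: measurable_cst.
  by have [] := r0P j.
- move=> w i; apply: (cvgr_to_le (cvg_norm (xc w i))).
  by apply: nearW => k; exact: q_bound.
- move=> w y yM.
  have fq j : f w (x w) <= f w (q j).
    have h1 : (fun k => f w (q (r0 (r k w) w))) @ \oo --> f w (x w).
      exact: fc.
    have h2 : (fun k : nat => f w (q j) + k.+1%:R^-1) @ \oo --> f w (q j) + 0.
      by apply: cvgD; [exact: cvg_cst|exact: cvg_harmonic].
    rewrite addr0 in h2; apply: (ler_cvg_to h1 h2); apply: nearW => k.
    have [_ /(_ w j) h] := r0P (r k w); apply: (le_trans h).
    by rewrite lerD2l lef_pV2 ?posrE// ler_nat ltnS.
  have [j jP] := choice (fun n => q_dense n yM).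
  have : (fun n => f w (q (j n))) @ \oo --> f w y.
    apply: fc => i; apply/cvgrPdist_lt => e e0; near=> n.
    rewrite distrC (lt_trans (jP n i))//.
    by near: n; exact: (near_infty_natSinv_lt (PosNum e0)).
  by move=> /cvgr_to_ge; apply; apply: nearW => n; exact: fq.
Unshelve. all: by end_near. Qed.

End minimizer.
End measurable_selection.

(** * Orthogonal projections in finite dimension *)

Section projection.
Context {R : realType}.
Local Notation C := R[i].

Definition adjmx m n (A : 'M[C]_(m, n)) : 'M[C]_(n, m) := (map_mx conjc A)^T.

Lemma adjmxE m n (A : 'M[C]_(m, n)) i j : adjmx A i j = conjc (A j i).
Proof. by rewrite !mxE. Qed.

Lemma adjmxK m n (A : 'M[C]_(m, n)) : adjmx (adjmx A) = A.
Proof. by apply/matrixP => i j; rewrite !adjmxE conjcK. Qed.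

Lemma adjmxM m n p (A : 'M[C]_(m, n)) (B : 'M[C]_(n, p)) :
  adjmx (A *m B) = adjmx B *m adjmx A.
Proof. by rewrite /adjmx map_mxM trmx_mul. Qed.

Lemma adjmxD m n (A B : 'M[C]_(m, n)) : adjmx (A + B) = adjmx A + adjmx B.
Proof. by rewrite /adjmx map_mxD linearD. Qed.

Lemma adjmxN m n (A : 'M[C]_(m, n)) : adjmx (- A) = - adjmx A.
Proof. by rewrite /adjmx map_mxN linearN. Qed.

Lemma adjmxB m n (A B : 'M[C]_(m, n)) : adjmx (A - B) = adjmx A - adjmx B.
Proof. by rewrite adjmxD adjmxN. Qed.

Lemma adjmxZ m n (a : C) (A : 'M[C]_(m, n)) : adjmx (a *: A) = conjc a *: adjmx A.
Proof. by rewrite /adjmx map_mxZ linearZ. Qed.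

Lemma mul_conjc (z : C) : conjc z * z = (sqmod z)%:C.
Proof. by case: z => a b; rewrite /sqmod; simpc; congr (_ +i* _); ring. Qed.

Lemma adjmx_mul_self m (w : 'cV[C]_m) :
  adjmx w *m w = ((\sum_i sqmod (w i 0))%:C)%:M.
Proof.
rewrite [LHS]mx11_scalar mxE; congr (scalar_mx _); rewrite rmorph_sum.
by apply: eq_bigr => i _; rewrite adjmxE mul_conjc.
Qed.

(** Gram-Schmidt, written so that linearly dependent columns are harmless: each
    column of [B] is a unit vector or zero. *)
Lemma gram_schmidt_projection m l (c : 'M[C]_(m, l)) :
  exists B : 'M[C]_(m, l), let P := B *m adjmx B in
    [/\ P *m P = P, P *m c = c & forall i j, sqmod (B i j) <= 1].
Proof.
elim: l c => [c|l ih c].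
  exists 0; split; rewrite ?mul0mx ?mulmx0//; first by rewrite [c]thinmx0.
  by move=> i [].
have [B] := ih (rsubmx (c : 'M[C]_(m, 1 + l))).
set P := B *m adjmx B => -[/= PP Pc2 B1].
set c1 := lsubmx (c : 'M[C]_(m, 1 + l)); set c2 := rsubmx _ in Pc2.
have cE : c = row_mx c1 c2 by rewrite hsubmxK.
have Padj : adjmx P = P by rewrite /P adjmxM adjmxK.
pose w := c1 - P *m c1.
have Pw : P *m w = 0 by rewrite /w mulmxBr mulmxA PP subrr.
have wP : adjmx w *m P = 0 by rewrite -Padj -adjmxM Pw /adjmx map_mx0 trmx0.
have wc2 : adjmx w *m c2 = 0 by rewrite -Pc2 mulmxA wP mul0mx.
pose s := \sum_i sqmod (w i 0).
have s0 : 0 <= s by apply: sumr_ge0 => i _; exact: sqmod_ge0.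
have wi i : sqmod (w i 0) <= s.
  rewrite /s (bigD1 i)//= lerDl; apply: sumr_ge0 => j _; exact: sqmod_ge0.
(* For w = 0 the inverse of s vanishes and the new column is zero. *)
pose a : R := Num.sqrt s^-1.
have a2 : a ^+ 2 = s^-1 by rewrite sqr_sqrtr// invr_ge0.
have ws : s^-1%:C *: (w *m (adjmx w *m w)) = w.
  rewrite adjmx_mul_self -/s mul_mx_scalar scalerA -rmorphM.
  have [s_eq0|sn0] := eqVneq s 0; last by rewrite mulVf// rmorph1 scale1r.
  rewrite s_eq0 invr0 mul0r rmorph0 scale0r; apply/matrixP => i j.
  rewrite ord1 mxE; apply/esym/eqP; rewrite -sqmod_eq0 eq_le sqmod_ge0 andbT.
  by rewrite -s_eq0.
pose q := s^-1%:C *: (w *m adjmx w).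
have qq : q *m q = q.
  rewrite /q -scalemxAl -scalemxAr mulmxA -(mulmxA w) (scalemxAl _ (w *m _)).
  by rewrite ws.
have qP : q *m P = 0 by rewrite /q -scalemxAl -mulmxA wP mulmx0 scaler0.
have Pq : P *m q = 0 by rewrite /q -scalemxAr mulmxA Pw mul0mx scaler0.
have qw : q *m w = w by rewrite /q -scalemxAl -mulmxA ws.
have qc2 : q *m c2 = 0 by rewrite /q -scalemxAl -mulmxA wc2 mulmx0 scaler0.
pose B' : 'M[C]_(m, 1 + l) := row_mx (a%:C *: w) B.
have PE : B' *m adjmx B' = q + P.
  rewrite /B' /adjmx map_row_mx tr_row_mx mul_row_col -/(adjmx B) -/P.
  congr (_ + _); rewrite -/(adjmx _) adjmxZ conjc_real -scalemxAl -scalemxAr.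
  by rewrite scalerA -rmorphM -expr2 a2.
exists B'; rewrite PE; split.
- by rewrite mulmxDl !mulmxDr PP qq qP Pq addr0 add0r.
- rewrite cE; apply: (etrans (mul_mx_row (q + P) c1 c2)); congr row_mx.
  + have c1E : c1 = w + P *m c1 by rewrite /w subrK.
    rewrite mulmxDl [in q *m _]c1E mulmxDr qw mulmxA qP mul0mx addr0.
    by rewrite -c1E.
  + by rewrite mulmxDl qc2 add0r.
- move=> i j; case: (@split_ordP 1 l j) => j' ->.
    have -> : B' i (lshift l j') = (a%:C *: w) i j' by exact: row_mxEl.
    rewrite mxE sqmodM sqmod_real a2 ord1.
    have [s_eq0|sn0] := eqVneq s 0; first by rewrite s_eq0 invr0 mul0r.
    by rewrite mulrC ler_pdivrMr ?mul1r// lt_def sn0.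
  have -> : B' i (rshift 1 j') = B i j' by exact: row_mxEr.
  exact: B1.
Qed.

(** With [P], the matrix [1 - P] is an orthogonal projection, hence a contraction. *)
Lemma projection_residual_le m (P : 'M[C]_m) (x : 'cV[C]_m) :
  P *m P = P -> adjmx P = P ->
  \sum_i sqmod ((x - P *m x) i 0) <= \sum_i sqmod (x i 0).
Proof.
move=> PP Padj; rewrite -subr_ge0.
suff -> : \sum_i sqmod (x i 0) - \sum_i sqmod ((x - P *m x) i 0) =
    \sum_i sqmod ((P *m x) i 0).
  by apply: sumr_ge0 => i _; exact: sqmod_ge0.
have inj (a b : C) : a%:M = b%:M :> 'M[C]_1 -> a = b.
  by move=> /matrixP/(_ 0 0); rewrite !mxE.
apply: (@complexI R); apply: inj.
rewrite rmorphB raddfB/= -!adjmx_mul_self.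
rewrite adjmxB !adjmxM Padj; set y := adjmx x.
have e1 : y *m P *m (P *m x) = y *m P *m x by rewrite mulmxA -(mulmxA y) PP.
rewrite mulmxBl !mulmxBr e1 (mulmxA y P x) subrr subr0.
by rewrite opprB addrC subrK.
Qed.

(** Subtracting any combination of [l] vectors leaves at least the residual of an
    orthogonal projection of rank at most [l]: projecting away the coefficient
    space kills the combination and shrinks the rest. *)
Lemma residual_ge_projection m l n (c : 'M[C]_(m, l)) : (l <= n)%N ->
  exists2 B : 'M[C]_(m, n), forall i j, sqmod (B i j) <= 1 &
    forall (u : 'I_m -> C) (v : 'I_l -> C),
      \sum_k sqmod (u k - \sum_i (B *m adjmx B) k i * u i)
      <= \sum_i sqmod (u i - \sum_j c i j * v j).
Proof.
move=> ln; have [B0] := gram_schmidt_projection c.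
set P := B0 *m _ => -[/= PP Pc B01].
suff [B B1 BE] : exists2 B : 'M[C]_(m, n), forall i j, sqmod (B i j) <= 1 &
    B *m adjmx B = P.
  exists B => // u v; rewrite BE.
  pose U : 'cV_m := \col_i u i; pose V : 'cV_l := \col_j v j.
  have := @projection_residual_le _ P (U - c *m V) PP _.
  have -> : U - c *m V - P *m (U - c *m V) = U - P *m U.
    by rewrite mulmxBr mulmxA Pc opprB addrA subrK.
  have Padj : adjmx P = P by rewrite /P adjmxM adjmxK.
  move=> /(_ Padj); congr (_ <= _); apply: eq_bigr => i _.
    rewrite !mxE; congr (sqmod (_ - _)); apply: eq_bigr => j _.
    by rewrite !mxE.
  by rewrite !mxE; congr (sqmod (_ - _)); apply: eq_bigr => j _; rewrite !mxE.
move: (subnKC ln) => <-; exists (row_mx B0 0).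
  move=> i j; case: (split_ordP j) => j' ->; first by rewrite row_mxEl.
  by rewrite row_mxEr mxE sqmod0.
by rewrite /adjmx map_row_mx tr_row_mx mul_row_col mul0mx addr0.
Qed.

End projection.

(** * Lebesgue measure on R^d and the unit cube *)

Section one_dimension.
Context {R : realType}.
Local Notation mu := (@lebesgue_measure R).

Lemma ge0_integral_translate (c : R) (f : measurableTypeR R -> \bar R) :
  measurable_fun setT f -> (forall x, 0 <= f x)%E ->
  (\int[mu]_x f (x - c)%R = \int[mu]_x f x)%E.
Proof.
move=> mf f0; pose phi : measurableTypeR R -> measurableTypeR R := fun x => x - c.
have mphi : measurable_fun setT phi.
  by apply: measurable_funB => //; exact: measurable_cst.
rewrite -[LHS](@ge0_integral_pushforward _ _ _ _ R phi mphi mu setT f)//.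
apply: eq_measure_integral => A mA _; apply/esym.
apply: (@lebesgue_measure_unique R (pushforward mu phi)) => // _ [[a b]] _ <-.
change (mu `]a, b]%classic = mu (phi @^-1` `]a, b]%classic)).
have -> : phi @^-1` `]a, b]%classic = `](a + c), (b + c)]%classic.
  by apply/seteqP; split => x /=; rewrite !in_itv/= /phi ltrBrDr lerBlDr.
by rewrite !lebesgue_measure_itv/= !lte_fin ltrD2r -!EFinB opprD addrACA subrr addr0.
Qed.

Lemma periodic_int (g : R -> R) (k : int) (a : R) : periodic g (pi *+ 2) ->
  g (a + 2 * pi * k%:~R) = g a.
Proof.
move=> pg.
have pos (n : nat) b : g (b + 2 * pi * n%:R) = g b.
  rewrite -[RHS](periodicn pg n); congr (g (_ + _)).
  by rewrite -mulr_natr -[pi *+ 2]mulr_natr; ring.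
case: k => n; first exact: pos.
rewrite NegzE -(pos n.+1); congr g; rewrite mulrNz; ring.
Qed.

Lemma integral_cos_unit_interval (k : int) (a : R) : k != 0 ->
  (\int[mu]_(x in `[0%R, 1%R]) (cos (2 * pi * k%:~R * x + a))%:E = 0)%E.
Proof.
move=> k0; pose w : R := 2 * pi * k%:~R.
have w0 : w != 0 by rewrite !mulf_neq0 ?intr_eq0// gt_eqF// pi_gt0.
pose F x := sin (w * x + a) / w.
have dF (x : R) : is_derive x (1 : R) F (cos (w * x + a)).
  rewrite /F; apply: is_derive_eq.
  by rewrite /GRing.scale /=; field.
have cF (x : R) : {for x, continuous F}.
  by apply/differentiable_continuous/derivable1_diffP; case: (dF x).
have cf : continuous (fun x : R => cos (w * x + a)).
  move=> x; apply: (@continuous_comp _ _ _ (fun x => w * x + a) cos).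
    by apply: cvgD; [apply: cvgMr; exact: cvg_id|exact: cvg_cst].
  exact: continuous_cos.
rewrite (@continuous_FTC2 _ _ F)//.
- rewrite -EFinB /F mulr1 mulr0 add0r -mulrBl.
  suff -> : sin (w + a) = sin a by rewrite subrr mul0r.
  by rewrite /w addrC; apply: periodic_int; exact: sinD2pi.
- exact: continuous_subspaceT.
- split.
  + by move=> x _; case: (dF x).
  + by apply: cvg_at_right_filter; exact: cF.
  + by apply: cvg_at_left_filter; exact: cF.
- by move=> x _; rewrite derive1E; case: (dF x).
Qed.

End one_dimension.

Section euclidean_space.
Context {R : realType}.
Local Notation mu := (@lebesgue_measure R).
Local Notation lam d := (lebesgue_measured R d).

Lemma ge0_integral_cons d (f : Rd R d.+1 -> \bar R) :
  measurable_fun setT f -> (forall x, 0 <= f x)%E ->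
  (\int[lam d.+1]_x f x = \int[mu]_x \int[lam d]_t f (tcons (x, t)))%E.
Proof.
move=> mf f0; have mt := @measurable_tcons R d.
transitivity (\int[pushforward (mu \x lam d)%E (@tcons R d)]_x f x)%E => //.
rewrite (ge0_integral_pushforward mt)//.
rewrite preimage_setT fubini_tonelli1//; first exact: measurableT_comp.
by move=> x; exact: f0.
Qed.

Lemma integrable_cons d (f : Rd R d.+1 -> \bar R) :
  (lam d.+1).-integrable setT f ->
  (mu \x lam d)%E.-integrable setT (f \o (@tcons R d)).
Proof.
move=> /integrableP[mf fi]; apply/integrableP; split.
  by apply: measurableT_comp => //; exact: (@measurable_tcons R d).
move: fi; rewrite ge0_integral_cons//; last exact: measurableT_comp.
rewrite (fubini_tonelli1 (fun z => `|(f \o (@tcons R d)) z|%E))//.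
by do 2 apply: measurableT_comp => //; exact: (@measurable_tcons R d).
Qed.

Lemma integral_cons d (f : Rd R d.+1 -> \bar R) :
  (lam d.+1).-integrable setT f ->
  (\int[lam d.+1]_x f x = \int[mu]_x \int[lam d]_t f (tcons (x, t)))%E.
Proof.
move=> fi; have mt := @measurable_tcons R d.
transitivity (\int[pushforward (mu \x lam d)%E (@tcons R d)]_x f x)%E => //.
have fit := integrable_cons fi.
rewrite integral_pushforward ?preimage_setT//; last exact: measurable_int fi.
by rewrite -integral12_prod_meas1.
Qed.

Definition shiftv d (c : 'I_d -> R) (x : Rd R d) : Rd R d :=
  [tuple tnth x i - c i | i < d].

Lemma measurable_shiftv d (c : 'I_d -> R) : measurable_fun setT (shiftv c).
Proof.
apply/measurable_fun_tnthP => i.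
rewrite (_ : _ \o _ = fun x : Rd R d => tnth x i - c i); last first.
  by apply/funext => x /=; rewrite tnth_mktuple.
by apply: measurable_funB; [exact: measurable_tnth|exact: measurable_cst].
Qed.

Lemma shiftv_tcons d (c : 'I_d.+1 -> R) (x : R) (t : Rd R d) :
  shiftv c (tcons (x, t)) =
  tcons (x - c ord0, shiftv (fun i => c (lift ord0 i)) t).
Proof.
apply: eq_from_tnth => i; rewrite tnth_mktuple.
by case: (unliftP ord0 i) => [j|] ->; rewrite ?tnthS ?tnth0 ?tnth_mktuple.
Qed.

Lemma ge0_integral_shiftv d (c : 'I_d -> R) (f : Rd R d -> \bar R) :
  measurable_fun setT f -> (forall x, 0 <= f x)%E ->
  (\int[lam d]_x f (shiftv c x) = \int[lam d]_x f x)%E.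
Proof.
elim: d c f => [c f mf f0|d ih c f mf f0].
  by apply: eq_integral => x _; rewrite [shiftv c x]tuple0 [x]tuple0.
have mt := @measurable_tcons R d.
rewrite !ge0_integral_cons//; last first.
  by apply: measurableT_comp => //; exact: measurable_shiftv.
have mft x : measurable_fun setT (fun t => f (tcons (x, t))).
  apply: measurableT_comp => //.
  by apply: (measurableT_comp mt); exact: pair1_measurable.
under eq_integral => x _.
  under eq_integral do rewrite shiftv_tcons.
  rewrite (ih (fun i => c (lift ord0 i)) (fun t => f (tcons (x - c ord0, t))))//.
  over.
apply: (ge0_integral_translate (c ord0)
  (f := fun x => \int[lam d]_t f (tcons (x, t)))%E).
  apply: (measurable_fun_fubini_tonelli_F (fun z => f (tcons z))) => //.
  exact: measurableT_comp.
by move=> x; exact: integral_ge0.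
Qed.

(** The unit cube is the fundamental domain of the lattice Z^d, both for the space
    variable and for the frequency variable. *)
Definition cube d (x : Rd R d) : bool := [forall i, 0 <= tnth x i < 1].

Lemma measurable_cube d : measurable_fun setT (@cube d).
Proof.
apply: (measurable_fun_bool true); rewrite setTI.
have -> : @cube d @^-1` [set true] =
    \bigcap_(i in [set: 'I_d]) ((@tnth d R ^~ i) @^-1` `[0, 1[%classic).
  apply/seteqP; split => x.
    by move=> /forallP h i _; have := h i; rewrite /= in_itv.
  by move=> h; apply/forallP => i; have := h i I; rewrite /= in_itv.
apply: fin_bigcap_measurable => // i _.
rewrite -[X in measurable X]setTI.
exact: measurable_tnth.
Qed.

Lemma cube_tcons d (x : R) (t : Rd R d) :
  cube (tcons (x, t)) = (0 <= x < 1) && cube t.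
Proof.
apply/forallP/andP => [h|[x01 /forallP h] i].
  split; first by have := h ord0; rewrite tnth0.
  by apply/forallP => i; have := h (lift ord0 i); rewrite tnthS.
by case: (unliftP ord0 i) => [j|] ->; rewrite ?tnthS ?tnth0.
Qed.

Definition cubeI d (x : Rd R d) : R := (cube x)%:R.

Lemma measurable_cubeI d : measurable_fun setT (@cubeI d).
Proof.
rewrite (_ : @cubeI d = fun x => if cube x then 1 else 0); last first.
  by apply/funext => x; rewrite /cubeI; case: cube.
by apply: measurable_fun_ifT => //; exact: measurable_cube.
Qed.

Lemma cubeI_ge0 d (x : Rd R d) : 0 <= cubeI x. Proof. exact: ler0n. Qed.

Lemma integral_cubeI d : (\int[lam d]_x (cubeI x)%:E = 1)%E.
Proof.
elim: d => [|d ih].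
  rewrite integral_dirac// ?diracT ?mul1e; last first.
    by apply/measurable_EFinP; exact: measurable_cubeI.
  by rewrite /cubeI (_ : cube _)//; apply/forallP => -[].
rewrite ge0_integral_cons//; last 2 first.
- by apply/measurable_EFinP; exact: measurable_cubeI.
- by move=> x; rewrite lee_fin cubeI_ge0.
transitivity (\int[mu]_x (\1_(`[0%R, 1%R[%classic) x)%:E)%E; last first.
  rewrite integral_indic// setIT.
  apply: (etrans (@lebesgue_measure_itv R `[0%R, 1%R[)).
  by rewrite /= lte_fin ltr01 oppr0 adde0.
apply: eq_integral => x _; rewrite indicE mem_setE in_itv/=.
under eq_integral do rewrite /cubeI cube_tcons -mulnb natrM EFinM.
rewrite ge0_integralZl//; first by rewrite ih mule1.
by apply/measurable_EFinP; exact: measurable_cubeI.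
Qed.

Lemma measurable_cos : measurable_fun setT (@cos R).
Proof. exact: (continuous_measurable_fun (@continuous_cos R)). Qed.

Lemma measurable_sin : measurable_fun setT (@sin R).
Proof. exact: (continuous_measurable_fun (@continuous_sin R)). Qed.

Definition phase d (k : 'I_d -> int) (x : Rd R d) : R :=
  \sum_i (k i)%:~R * tnth x i.

Lemma measurable_phase d (k : 'I_d -> int) : measurable_fun setT (phase k).
Proof.
apply: measurable_sum => i; apply: measurable_funM; first exact: measurable_cst.
exact: measurable_tnth.
Qed.

Lemma phase_tcons d (k : 'I_d.+1 -> int) (x : R) (t : Rd R d) :
  phase k (tcons (x, t)) =
  (k ord0)%:~R * x + phase (fun i => k (lift ord0 i)) t.
Proof.
rewrite /phase big_ord_recl tnth0; congr (_ + _).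
by apply: eq_bigr => i _; rewrite tnthS.
Qed.

Lemma phaseD d (k l : 'I_d -> int) (x : Rd R d) :
  phase (fun i => k i + l i) x = phase k x + phase l x.
Proof.
by rewrite /phase -big_split/=; apply: eq_bigr => i _; rewrite intrD mulrDl.
Qed.

Lemma phaseN d (k : 'I_d -> int) (x : Rd R d) :
  phase (fun i => - k i) x = - phase k x.
Proof.
by rewrite /phase -sumrN; apply: eq_bigr => i _; rewrite mulrNz mulNr.
Qed.

Lemma integrable_cube_cos d (k : 'I_d -> int) (a : R) :
  (lam d).-integrable setT
    (fun x => (cubeI x * cos (2 * pi * phase k x + a))%:E).
Proof.
apply: (@le_integrable _ _ _ (lam d) setT measurableT _
    (fun x => (cubeI x)%:E)).
- apply/measurable_EFinP; apply: measurable_funM; first exact: measurable_cubeI.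
  apply: measurableT_comp; first exact: measurable_cos.
  apply: measurable_funD; last exact: measurable_cst.
  by apply: measurable_funM; [exact: measurable_cst|exact: measurable_phase].
- move=> x _; rewrite !abse_EFin lee_fin normrM ger0_norm ?cubeI_ge0//.
  rewrite ler_piMr ?cubeI_ge0// ler_norml; apply/andP; split.
    exact: cos_geN1.
  exact: cos_le1.
- apply/integrableP; split; first by apply/measurable_EFinP; exact: measurable_cubeI.
  under eq_integral do rewrite gee0_abs ?lee_fin ?cubeI_ge0//.
  by rewrite integral_cubeI ltry.
Qed.

(** Orthogonality of the characters of the torus; the phase [a] covers sines. *)
Lemma integral_cube_cos d (k : 'I_d -> int) (a : R) : (exists i, k i != 0) ->
  (\int[lam d]_x (cubeI x * cos (2 * pi * phase k x + a))%:E = 0)%E.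
Proof.
elim: d k a => [k a [[]]//|d ih k a k_neq0].
rewrite integral_cons; last exact: integrable_cube_cos.
pose k' i := k (lift ord0 i).
have inner (x : R) : (\int[lam d]_t (cubeI (tcons (x, t)) *
      cos (2 * pi * phase k (tcons (x, t)) + a))%:E =
    ((0 <= x < 1)%R%:R : R)%:E * \int[lam d]_t (cubeI t *
      cos (2 * pi * phase k' t + (2 * pi * (k ord0)%:~R * x + a)))%:E)%E.
  rewrite -integralZl//; last exact: integrable_cube_cos.
  apply: eq_integral => t _; rewrite -EFinM; congr EFin.
  rewrite /cubeI cube_tcons -mulnb natrM -mulrA; congr (_ * (_ * cos _)).
  by rewrite phase_tcons -/k'; ring.
under eq_integral do rewrite inner.
have [[i k'i]|/forallNP k'0] := pselect (exists i, k' i != 0).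
  rewrite integral0_eq// => x _; rewrite ih ?mule0//.
  by exists i.
have k'z i : k' i = 0 by apply/eqP/negPn/negP; exact: k'0.
have k00 : k ord0 != 0.
  have [i0] := k_neq0; case: (unliftP ord0 i0) => [j|] -> //.
  by rewrite -[k _]/(k' j) k'z eqxx.
transitivity (\int[mu]_(x in `[0%R, 1%R[)
    (cos (2 * pi * (k ord0)%:~R * x + a))%:E)%E.
  rewrite [RHS]integral_mkcond; apply: eq_integral => x _.
  rewrite patchE mem_setE in_itv/=; case: ifPn => _; last by rewrite mul0e.
  rewrite mul1e.
  have ph0 (t : Rd R d) : phase k' t = 0.
    by rewrite /phase big1// => i _; rewrite k'z mul0r.
  under eq_integral do rewrite ph0 mulr0 add0r mulrC EFinM.
  rewrite integralZl//.
    by rewrite integral_cubeI mule1.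
  apply/integrableP; split; first by apply/measurable_EFinP; exact: measurable_cubeI.
  under eq_integral do rewrite gee0_abs ?lee_fin ?cubeI_ge0//.
  by rewrite integral_cubeI ltry.
rewrite integral_itv_bndo_bndc ?integral_cos_unit_interval//.
apply: measurable_funTS; apply/measurable_EFinP.
apply: measurableT_comp; first exact: measurable_cos.
apply: measurable_funD; last exact: measurable_cst.
by apply: measurable_funM; [exact: measurable_cst|exact: measurable_id].
Qed.

End euclidean_space.

(** * The L2 seminorm, translations and characters *)

Section L2norm_sqnorm.
Context {R : realType} (d : nat).
Local Notation lam := (lebesgue_measured R d).
Local Notation fn := (Rd R d -> R[i]).
Implicit Types f g : fn.

Lemma L2norm_ge0 f : (0 <= L2norm f)%E. Proof. exact: Lnorm_ge0. Qed.

Lemma L2norm_sqr f : (L2norm f ^+ 2 = sqnorm lam f)%E.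
Proof.
have -> : (L2norm f ^+ 2 = L2norm f `^ 2)%E.
  move: (L2norm_ge0 f); case: (L2norm f) => [r r0||]//.
    by rewrite -EFin_expe poweR_EFin powR_mulrn.
  by move=> _; rewrite expe2 mulyy poweRyr.
rewrite /L2norm poweR_Lnorm ?pnatr_eq0//; apply: eq_integral => x _ /=.
by rewrite powR_mulrn ?normr_ge0// real_normK ?num_real// normc_sqmod.
Qed.

Lemma L2norm_lt f (e : R) : 0 < e ->
  (L2norm f < e%:E)%E = (sqnorm lam f < (e ^+ 2)%:E)%E.
Proof.
move=> e0; rewrite -L2norm_sqr.
have := L2norm_ge0 f; case: (L2norm f) => [r||]//.
- by rewrite lee_fin -EFin_expe !lte_fin => r0; rewrite ltr_sqr// nnegrE// ltW.
Qed.

Lemma L2P f : L2 f <-> sqintegrable lam f.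
Proof.
rewrite /L2 /=; split => [[m1 m2 f2]|[[m1 m2] f2]].
  split => //; rewrite -L2norm_sqr.
  by move: f2 (L2norm_ge0 f); case: (L2norm f) => [r _ _||]; rewrite ?ltxx// -EFin_expe ltry.
split => //; move: f2 (L2norm_ge0 f); rewrite -L2norm_sqr.
by case: (L2norm f) => [r _ _||]; rewrite ?ltry// expe2 mulyy.
Qed.

Lemma translateE (k : 'I_d -> int) f x :
  translate k f x = f (shiftv (fun i => (k i)%:~R) x).
Proof. by []. Qed.

Lemma translate_cmeasurable (k : 'I_d -> int) f :
  cmeasurable f -> cmeasurable (translate k f).
Proof.
by move=> mf; apply: (cmeasurable_comp (measurable_shiftv _) mf).
Qed.

Lemma sqnorm_translate (k : 'I_d -> int) f : cmeasurable f ->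
  sqnorm lam (translate k f) = sqnorm lam f.
Proof.
move=> mf; rewrite /sqnorm.
under eq_integral do rewrite translateE.
rewrite (ge0_integral_shiftv _ (f := fun x => (sqmod (f x))%:E))//.
- exact: measurable_Esqmod.
- by move=> x; rewrite lee_fin sqmod_ge0.
Qed.

Lemma sqintegrable_translate (k : 'I_d -> int) f :
  sqintegrable lam f -> sqintegrable lam (translate k f).
Proof.
move=> [mf f2]; split; first exact: translate_cmeasurable.
by rewrite sqnorm_translate.
Qed.

Lemma translate_comp (k l : 'I_d -> int) f :
  translate k (translate l f) = translate (fun i => k i + l i) f.
Proof.
apply/funext => x; rewrite !translateE; congr f; apply: eq_from_tnth => i.
by rewrite !tnth_mktuple intrD opprD addrA.
Qed.

Lemma translate0 f : translate (fun=> 0) f = f.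
Proof.
apply/funext => x; rewrite translateE; congr f; apply: eq_from_tnth => i.
by rewrite tnth_mktuple subr0.
Qed.

(** The character of the torus attached to a lattice vector. *)
Definition echar (k : 'I_d -> int) (w : Rd R d) : R[i] :=
  Complex (cos (2 * pi * phase k w)) (sin (2 * pi * phase k w)).

Lemma cmeasurable_echar k : cmeasurable (echar k).
Proof.
have mp : measurable_fun setT (fun w : Rd R d => 2 * pi * phase k w).
  by apply: measurable_funM; [exact: measurable_cst|exact: measurable_phase].
split; first exact: (measurableT_comp measurable_cos).
exact: (measurableT_comp measurable_sin).
Qed.

Lemma sqmod_echar k w : sqmod (echar k w) = 1.
Proof. exact: cos2Dsin2. Qed.

Lemma echarD k l w : echar (fun i => k i + l i) w = echar k w * echar l w.
Proof.
rewrite /echar phaseD mulrDr cosD sinD; apply/eqP; rewrite eq_complex/= eqxx/=.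
by rewrite addrC [sin _ * _]mulrC eqxx.
Qed.

Lemma echar0 w : echar (fun=> 0) w = 1.
Proof.
rewrite /echar /phase big1 ?mulr0 ?cos0 ?sin0// => i _.
by rewrite mul0r.
Qed.

End L2norm_sqnorm.

(** * Density of trigonometric polynomials *)

Lemma cvge0_lt (R : realType) (u : nat -> \bar R) : u @ \oo --> 0%E ->
  forall e : R, 0 < e -> exists n, (u n < e%:E)%E.
Proof.
move=> /fine_cvgP[ufin /cvgrPdist_lt ucv] e e0; have := ucv _ e0.
move=> /(filterI ufin) [n _ /(_ n (leqnn n))] /= [un].
rewrite sub0r normrN => uen; exists n.
by rewrite -(fineK un) lte_fin; exact: le_lt_trans (ler_norm _) uen.
Qed.

Lemma lte_double_quarters (R : realType) (a b : \bar R) (e : R) :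
  (a < (e / 4)%:E -> b < (e / 4)%:E -> 2%:E * a + 2%:E * b < e%:E)%E.
Proof.
move=> ae be.
have -> : (e%:E = 2%:E * (e / 4)%:E + 2%:E * (e / 4)%:E)%E.
  by rewrite -!EFinM -EFinD; congr EFin; field.
by apply: lteD; rewrite lte_pmul2l// lte_fin.
Qed.

Import HBNNSimple.

Section trigonometric_polynomials.
Context {R : realType} (d : nat).
Local Notation C := R[i].

Definition trig (s : seq (C * ('I_d -> int))) (w : Rd R d) : C :=
  \sum_(p <- s) p.1 * echar p.2 w.

Lemma cmeasurable_trig s : cmeasurable (trig s).
Proof.
apply: cmeasurable_sum => p; apply: cmeasurableM; first exact: cmeasurable_cst.
exact: cmeasurable_echar.
Qed.

Lemma trig_bounded s : exists2 M : R, 0 <= M & forall w, sqmod (trig s w) <= M.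
Proof.
exists (2 ^+ size s * \sum_(p <- s) sqmod p.1).
  rewrite mulr_ge0 ?exprn_ge0//; apply: sumr_ge0 => p _; exact: sqmod_ge0.
move=> w; apply: (le_trans (sqmod_sum_le s xpredT _)).
rewrite ler_pM2l ?exprn_gt0//; apply: ler_sum => p _.
by rewrite sqmodM sqmod_echar mulr1.
Qed.

Lemma trig_cat s t w : trig (s ++ t) w = trig s w + trig t w.
Proof. by rewrite /trig big_cat. Qed.

Lemma trig_mul s t w :
  trig [seq (p.1 * q.1, (fun i => p.2 i + q.2 i)) | p <- s, q <- t] w =
  trig s w * trig t w.
Proof.
rewrite /trig big_allpairs_dep mulr_suml; apply: eq_bigr => p _.
by rewrite mulr_sumr; apply: eq_bigr => q _; rewrite /= echarD; ring.
Qed.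

Lemma trig_cst c w : trig [:: (c, fun=> 0)] w = c.
Proof. by rewrite /trig big_seq1/= echar0 mulr1. Qed.

(* Iterating this cubic on [-1, 1] converges to the sign. *)
Let q (x : R) : R := (3 * x - x ^+ 3) / 2.

Let q_itv x : 0 <= x <= 1 -> x <= q x <= 1.
Proof.
move=> /andP[x0 x1]; rewrite /q.
have : 0 <= x * ((1 - x) * (1 + x)).
  by apply: mulr_ge0 => //; apply: mulr_ge0; lra.
have : 0 <= (1 - x) ^+ 2 * (2 + x) by apply: mulr_ge0; [exact: sqr_ge0|lra].
by move=> h1 h2; apply/andP; split; nra.
Qed.

Let qN x : q (- x) = - q x. Proof. by rewrite /q; field. Qed.

Let iter_qN n x : iter n q (- x) = - iter n q x.
Proof. by elim: n => //= n ->; rewrite qN. Qed.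

Let iter_q_itv n x : 0 <= x <= 1 -> x <= iter n q x <= 1.
Proof.
move=> x01; elim: n => [|n /andP[h1 h2]] /=; first by case/andP: x01 => _ ->; rewrite lexx.
have /andP[h3 h4] : iter n q x <= q (iter n q x) <= 1.
  by apply: q_itv; case/andP: x01 => x0 _; rewrite (le_trans x0 h1).
by rewrite (le_trans h1 h3).
Qed.

Let iter_q_bound n x : `|x| <= 1 -> `|iter n q x| <= 1.
Proof.
wlog x0 : x / 0 <= x => [hw|].
  have [x0|x0] := leP 0 x; first exact: hw.
  by rewrite -normrN -[in X in _ -> X]normrN -iter_qN; apply: hw; rewrite oppr_ge0 ltW.
rewrite ger0_norm// => x1.
have /andP[h1 h2] : x <= iter n q x <= 1 by apply: iter_q_itv; rewrite x0.
by rewrite ger0_norm// (le_trans x0).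
Qed.

Let iter_q_cvg x : `|x| <= 1 -> (fun n => iter n q x) @ \oo --> Num.sg x.
Proof.
wlog x0 : x / 0 < x => [hw|].
  have [x0|x0|x0] := ltrgtP 0 x; first exact: hw.
    rewrite -normrN => x1; have -> : x = - - x by rewrite opprK.
    under eq_fun do rewrite iter_qN.
    by rewrite sgrN; apply: cvgN; apply: hw; rewrite ?oppr_gt0.
  move=> _; rewrite -x0 sgr0; under eq_fun => n.
    have -> : iter n q 0 = 0.
      by elim: n => //= n ->; rewrite /q expr0n mulr0 subr0 mul0r.
    over.
  exact: cvg_cst.
rewrite gtr0_norm// => x1; rewrite gtr0_sg//.
have step n : 1 - iter n q x <= (1 - x / 2) ^+ n.
  elim: n => [|n ih] /=; first by rewrite expr0; lra.
  rewrite exprS.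
  have /andP[] : x <= iter n q x <= 1 by apply: iter_q_itv; rewrite ltW.
  move: (iter n q x) ih => y ih xy y1.
  apply: (@le_trans _ _ ((1 - x / 2) * (1 - y))).
    rewrite /q; have : 0 <= (1 - y) * (y - x + y ^+ 2) / 2.
      by rewrite !mulr_ge0 ?invr_ge0//; nra.
    by nra.
  by rewrite ler_wpM2l//; lra.
apply: (@squeeze_cvgr _ _ _ _ (fun n => 1 - (1 - x / 2) ^+ n) (fun=> 1)).
- apply: nearW => n.
  have /andP[_ ->] : x <= iter n q x <= 1 by apply: iter_q_itv; rewrite ltW.
  by have := step n; lra.
- rewrite -[X in _ --> X]subr0; apply: cvgB; first exact: cvg_cst.
  by apply: cvg_expr; rewrite ger0_norm; lra.
- exact: cvg_cst.
Qed.

Section weighted.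
Context dX (X : measurableType dX).
Variable nu : {measure set (X * Rd R d)%type -> \bar R}.
Variable h : X * Rd R d -> C.
Hypothesis h2 : sqintegrable nu h.
Hypothesis h_cube : forall z, ~~ cube z.2 -> h z = 0.

Let mh : cmeasurable h. Proof. by case: h2. Qed.

Let msnd (b : Rd R d -> C) : cmeasurable b ->
  cmeasurable (fun z : X * Rd R d => b z.2).
Proof. by move=> mb; exact: (cmeasurable_comp measurable_snd mb). Qed.

Definition trig_limit (b : Rd R d -> C) := [/\ cmeasurable b,
  exists2 M : R, 0 <= M & forall w, sqmod (b w) <= M &
  forall e : R, 0 < e -> exists s,
    (sqnorm nu (fun z => ((b z.2 - trig s z.2) * h z)%R) < e%:E)%E].

Let sqnormM_le (b : Rd R d -> C) (M : R) (g : X * Rd R d -> C) : 0 <= M ->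
  cmeasurable b -> cmeasurable g -> (forall w, sqmod (b w) <= M) ->
  (sqnorm nu (fun z => (b z.2 * g z)%R) <= M%:E * sqnorm nu g)%E.
Proof.
move=> M0 mb mg bM.
have := @sqnorm_le_comb _ _ _ nu M 0 g g (fun z => b z.2 * g z) M0 (lexx _) mg mg.
rewrite mul0e adde0; apply; first by apply: cmeasurableM => //; exact: msnd.
by move=> z; rewrite mul0r addr0 sqmodM ler_wpM2r// sqmod_ge0.
Qed.

Let trig_limit_trig s : trig_limit (trig s).
Proof.
split; [exact: cmeasurable_trig|exact: trig_bounded|move=> e e0; exists s].
rewrite (@eq_sqnorm _ _ _ _ _ (fun=> 0)) ?sqnorm0 ?lte_fin// => z.
by rewrite subrr mul0r.
Qed.

Let trig_limitD b c : trig_limit b -> trig_limit c ->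
  trig_limit (fun w => b w + c w).
Proof.
move=> [mb [M M0 bM] tb] [mc [N N0 cN] tc]; split.
- exact: cmeasurableD.
- exists (2 * M + 2 * N); first by rewrite addr_ge0 ?mulr_ge0.
  move=> w; apply: (le_trans (sqmodD_le2 _ _)).
  by rewrite lerD// ler_pM2l.
move=> e e0; have e4 : 0 < e / 4 by rewrite divr_gt0.
have [s hs] := tb _ e4; have [t ht] := tc _ e4.
exists (s ++ t).
have -> : (fun z : X * Rd R d => (b z.2 + c z.2 - trig (s ++ t) z.2) * h z) =
    (fun z => (b z.2 - trig s z.2) * h z + (c z.2 - trig t z.2) * h z).
  by apply/funext => z; rewrite trig_cat; ring.
have mt u : cmeasurable (fun z : X * Rd R d => trig u z.2).
  exact/msnd/cmeasurable_trig.
apply: (le_lt_trans (sqnormD_le2 _ _ _)).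
- by apply: cmeasurableM => //; apply: cmeasurableB => //; exact: msnd.
- by apply: cmeasurableM => //; apply: cmeasurableB => //; exact: msnd.
exact: lte_double_quarters.
Qed.

Let trig_limitM b c : trig_limit b -> trig_limit c ->
  trig_limit (fun w => b w * c w).
Proof.
move=> [mb [M M0 bM] tb] [mc [N N0 cN] tc].
have mt u : cmeasurable (fun z : X * Rd R d => trig u z.2).
  exact/msnd/cmeasurable_trig.
split.
- exact: cmeasurableM.
- exists (M * N); first by rewrite mulr_ge0.
  by move=> w; rewrite sqmodM ler_pM ?sqmod_ge0.
move=> e e0.
have M1 : 0 < M + 1 by lra.
have [|t ht] := tc (e / 4 / (M + 1)); first by rewrite !divr_gt0.
have [L L0 tL] := trig_bounded t; have L1 : 0 < L + 1 by lra.
have [|s hs] := tb (e / 4 / (L + 1)); first by rewrite !divr_gt0.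
exists [seq (p.1 * q.1, (fun i => p.2 i + q.2 i)) | p <- s, q <- t].
have -> : (fun z : X * Rd R d => (b z.2 * c z.2 - trig
      [seq (p.1 * q.1, (fun i => p.2 i + q.2 i)) | p <- s, q <- t] z.2) * h z) =
    (fun z => b z.2 * ((c z.2 - trig t z.2) * h z) +
              trig t z.2 * ((b z.2 - trig s z.2) * h z)).
  by apply/funext => z; rewrite trig_mul; ring.
have mcs : cmeasurable (fun z : X * Rd R d => (c z.2 - trig t z.2) * h z).
  by apply: cmeasurableM => //; apply: cmeasurableB => //; exact: msnd.
have mbs : cmeasurable (fun z : X * Rd R d => (b z.2 - trig s z.2) * h z).
  by apply: cmeasurableM => //; apply: cmeasurableB => //; exact: msnd.
apply: (le_lt_trans (sqnormD_le2 _ _ _)).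
- by apply: cmeasurableM => //; exact: msnd.
- exact: cmeasurableM.
have ME : ((e / 4)%:E = (M + 1)%:E * (e / 4 / (M + 1))%:E)%E.
  by rewrite -EFinM; congr EFin; field; rewrite gt_eqF.
have LE : ((e / 4)%:E = (L + 1)%:E * (e / 4 / (L + 1))%:E)%E.
  by rewrite -EFinM; congr EFin; field; rewrite gt_eqF.
apply: lte_double_quarters.
- apply: le_lt_trans (sqnormM_le (ltW M1) mb mcs _) _.
    by move=> w; rewrite (le_trans (bM w))// lerDl.
  by rewrite ME lte_pmul2l ?lte_fin.
- apply: le_lt_trans (sqnormM_le (ltW L1) (cmeasurable_trig t) mbs _) _.
    by move=> w; rewrite (le_trans (tL w))// lerDl.
  by rewrite LE lte_pmul2l ?lte_fin.
Qed.

Let trig_limit_cst c : trig_limit (fun=> c).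
Proof.
have := trig_limit_trig [:: (c, fun=> 0)].
by rewrite (_ : trig _ = fun=> c)//; apply/funext => w; exact: trig_cst.
Qed.

Let trig_limitZ c b : trig_limit b -> trig_limit (fun w => c * b w).
Proof. by move=> tb; apply: trig_limitM => //; exact: trig_limit_cst. Qed.

Let trig_limitB b c : trig_limit b -> trig_limit c ->
  trig_limit (fun w => b w - c w).
Proof.
move=> tb tc; have := trig_limitD tb (trig_limitZ (-1) tc).
by under eq_fun do rewrite mulN1r.
Qed.

(* Bounded pointwise limits, by dominated convergence. *)
Let trig_limit_lim (u : nat -> Rd R d -> C) (b : Rd R d -> C) (M : R) :
  (forall n, trig_limit (u n)) -> (forall n w, sqmod (u n w) <= M) ->
  cmeasurable b -> (forall w, sqmod (b w) <= M) ->
  (forall w, cube w -> (fun n => sqmod (b w - u n w)) @ \oo --> 0) ->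
  trig_limit b.
Proof.
move=> tu uM mb bM ub.
have M0 : 0 <= M by apply: le_trans (bM point); exact: sqmod_ge0.
split => //; first by exists M.
move=> e e0; have e4 : 0 < e / 4 by rewrite divr_gt0.
have mu n : cmeasurable (u n) by case: (tu n).
have mbu n : cmeasurable (fun z : X * Rd R d => (b z.2 - u n z.2) * h z).
  by apply: cmeasurableM => //; apply: cmeasurableB; exact: msnd.
have cvg0 : (fun n => sqnorm nu (fun z => ((b z.2 - u n z.2) * h z)%R)) @ \oo -->
    (\int[nu]_z 0)%E.
  apply: (@dominated_cvg _ _ _ nu setT measurableT _ _
    (fun z => (4 * M * sqmod (h z))%:E)).
  - by move=> n; exact: measurable_Esqmod.
  - move=> z _; apply: cvg_EFin; first exact: nearW.
    rewrite /comp/=; under eq_fun do rewrite sqmodM.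
    have [z2|z2] := boolP (cube z.2); last first.
      rewrite h_cube// sqmod0; under eq_fun do rewrite mulr0.
      exact: cvg_cst.
    have hz : (fun n => sqmod (b z.2 - u n z.2) * sqmod (h z)) @ \oo -->
        0 * sqmod (h z) by apply: cvgM; [exact: ub|exact: cvg_cst].
    by rewrite mul0r in hz.
  - by [].
  - under eq_fun do rewrite EFinM.
    by apply: integrableZl => //; exact: integrable_sqmod.
  - move=> n z _; rewrite gee0_abs ?lee_fin ?sqmod_ge0// sqmodM.
    rewrite ler_wpM2r ?sqmod_ge0//; apply: (le_trans (sqmodB_le2 _ _)).
    have -> : 4 * M = 2 * M + 2 * M by ring.
    by rewrite lerD// ler_pM2l.
rewrite integral0 in cvg0.
have [n un] := cvge0_lt cvg0 e4.
have [_ _ /(_ _ e4)[s hs]] := tu n; exists s.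
have -> : (fun z : X * Rd R d => (b z.2 - trig s z.2) * h z) =
    (fun z => (b z.2 - u n z.2) * h z + (u n z.2 - trig s z.2) * h z).
  by apply/funext => z; ring.
apply: (le_lt_trans (sqnormD_le2 _ _ _)) => //.
  apply: cmeasurableM => //; apply: cmeasurableB; apply: msnd => //.
  exact: cmeasurable_trig.
exact: lte_double_quarters.
Qed.

Let trig_limit_eq (b c : Rd R d -> C) : trig_limit b -> cmeasurable c ->
  (exists M, forall w, sqmod (c w) <= M) ->
  (forall w, cube w -> b w = c w) -> trig_limit c.
Proof.
move=> tb mc [N cN] bc; have [_ [M M0 bM] _] := tb.
apply: (@trig_limit_lim (fun=> b) c (Num.max M N)) => // [_ w|w|w cw].
- by rewrite le_max bM.
- by rewrite le_max cN orbT.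
- rewrite bc// subrr sqmod0; exact: cvg_cst.
Qed.

Let trig_limit_sum I (s : seq I) (F : I -> Rd R d -> C) :
  (forall i, trig_limit (F i)) -> trig_limit (fun w => \sum_(i <- s) F i w).
Proof.
move=> tF; elim: s => [|i s ih].
  under eq_fun do rewrite big_nil; exact: trig_limit_cst.
by under eq_fun do rewrite big_cons; exact: trig_limitD.
Qed.

Let trig_limit_iter_q (r : Rd R d -> R) n : trig_limit (fun w => (r w)%:C) ->
  trig_limit (fun w => (iter n q (r w))%:C).
Proof.
move=> tr; elim: n => //= n ih.
pose y w := iter n q (r w).
rewrite (_ : (fun w => _) = fun w => (3 / 2)%:C * (y w)%:C -
    (2^-1)%:C * ((y w)%:C * ((y w)%:C * (y w)%:C))); last first.
  apply/funext => w; rewrite -!rmorphM -rmorphB; congr (_%:C).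
  by rewrite -/(y w) /q; field.
apply: trig_limitB; apply: trig_limitZ => //.
by do 2 apply: trig_limitM => //.
Qed.

Let trig_limit_sg (r : Rd R d -> R) : measurable_fun setT r ->
  trig_limit (fun w => (r w)%:C) -> (forall w, `|r w| <= 1) ->
  trig_limit (fun w => (Num.sg (r w))%:C).
Proof.
move=> mr tr r1.
have msg : measurable_fun setT (fun w => Num.sg (r w)).
  apply: (@measurable_fun_cvg _ _ _ _ (fun n w => iter n q (r w))).
    by move=> n; have [[]] := trig_limit_iter_q n tr.
  by move=> w _; exact: iter_q_cvg.
apply: (@trig_limit_lim (fun n w => (iter n q (r w))%:C) _ 1).
- by move=> n; exact: trig_limit_iter_q.
- move=> n w; rewrite sqmod_real -real_normK ?num_real// exprn_ile1//.
  exact: iter_q_bound.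
- exact: cmeasurable_real.
- by move=> w; rewrite sqmod_real sqr_sg; case: (r w != 0).
- move=> w _; under eq_fun do rewrite -rmorphB sqmod_real expr2.
  have h1 : (fun n => Num.sg (r w) - iter n q (r w)) @ \oo --> (0 : R).
    rewrite -(subrr (Num.sg (r w))); apply: cvgB; first exact: cvg_cst.
    exact: iter_q_cvg.
  have h2' : (fun n => (Num.sg (r w) - iter n q (r w)) *
      (Num.sg (r w) - iter n q (r w))) @ \oo --> (0 : R) * 0 by exact: cvgM.
  by rewrite mulr0 in h2'.
Qed.

Let trig_set : set (set (Rd R d)) := [set E | measurable E /\
  trig_limit (fun w => (\1_E w)%:C)].

Let trig_set_gt0 (r : Rd R d -> R) (B : R) : 0 < B ->
  trig_limit (fun w => (r w)%:C) -> (forall w, `|r w| <= B) ->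
  trig_set [set w | 0 < r w].
Proof.
move=> B0 tr rB; have mr : measurable_fun setT r by have [[]] := tr.
have mE : measurable [set w | 0 < r w].
  rewrite -[X in measurable X]setTI.
  apply: (@measurable_fun_ltr _ _ _ setT (fun=> 0) r _ _ measurableT [set true])
    => //; exact: measurable_cst.
split => //; pose r' w := B^-1 * r w.
have tr' : trig_limit (fun w => (r' w)%:C).
  by rewrite /r'; under eq_fun do rewrite rmorphM; exact: trig_limitZ.
have tsg : trig_limit (fun w => (Num.sg (r' w))%:C).
  apply: trig_limit_sg => //; first by have [[]] := tr'.
  move=> w; have Bi : 0 <= B^-1 by rewrite invr_ge0 ltW.
  rewrite /r' normrM (ger0_norm Bi) -[leRHS](mulVf (lt0r_neq0 B0)).
  by rewrite ler_wpM2l.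
rewrite (_ : (fun w => _) = fun w => (2^-1)%:C * ((Num.sg (r' w))%:C +
    (Num.sg (r' w))%:C * (Num.sg (r' w))%:C)).
  by apply: trig_limitZ; apply: trig_limitD => //; exact: trig_limitM.
apply/funext => w; rewrite -rmorphM -rmorphD -rmorphM; congr (_%:C).
rewrite /r' sgrM (gtr0_sg (_ : 0 < B^-1)) ?invr_gt0// mul1r indicE.
have [rw|rw] := boolP (0 < r w).
  by rewrite mem_set// gtr0_sg//=; field.
rewrite memNset; last exact/negP.
by move: rw; rewrite -leNgt le_eqVlt => /predU1P[->|rw];
  rewrite ?sgr0 ?ltr0_sg//=; field.
Qed.

Let trig_setC E : trig_set E -> trig_set (~` E).
Proof.
move=> [mE tE]; split; first exact: measurableC.
rewrite (_ : (fun w => _) = fun w => 1 - (\1_E w)%:C).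
  by apply: trig_limitB => //; exact: trig_limit_cst.
apply/funext => w; rewrite !indicE in_setC; case: (w \in E) => /=.
  by rewrite (rmorph1 (real_complex R)) (rmorph0 (real_complex R)) subrr.
by rewrite (rmorph1 (real_complex R)) (rmorph0 (real_complex R)) subr0.
Qed.

Let trig_setI E F : trig_set E -> trig_set F -> trig_set (E `&` F).
Proof.
move=> [mE tE] [mF tF]; split; first exact: measurableI.
rewrite (_ : (fun w => _) = fun w => (\1_E w)%:C * (\1_F w)%:C).
  exact: trig_limitM.
by apply/funext => w; rewrite -rmorphM indicI.
Qed.

Let trig_setU E F : trig_set E -> trig_set F -> trig_set (E `|` F).
Proof.
move=> tE tF; rewrite -[_ `|` _]setCK setCU.
by apply: trig_setC; apply: trig_setI; exact: trig_setC.
Qed.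

Let trig_set_eq E F : trig_set E -> measurable F ->
  (forall w, cube w -> E w <-> F w) -> trig_set F.
Proof.
move=> [mE tE] mF EF; split => //.
apply: (trig_limit_eq tE).
- apply: cmeasurable_real; exact: measurable_indic.
- exists 1 => w; rewrite sqmod_real indicE; case: (_ \in _);
  by rewrite ?expr1n ?expr0n.
- by move=> w cw; rewrite !indicE; congr ((nat_of_bool _)%:R%:C);
  apply/idP/idP; rewrite !inE EF.
Qed.

Let trig_set_sigma_algebra : sigma_algebra setT trig_set.
Proof.
have t0 : trig_set set0.
  split; first exact: measurable0.
  rewrite (_ : (fun w => _) = fun=> 0); first exact: trig_limit_cst.
  by apply/funext => w; rewrite indicE in_set0.
split => // [E tE|A tA]; first by rewrite setTD; exact: trig_setC.
split; first by apply: bigcupT_measurable => n; case: (tA n).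
pose B n := \big[setU/set0]_(i < n) A i.
have tB n : trig_set (B n).
  rewrite /B; elim: n => [|n ih]; first by rewrite big_ord0.
  by rewrite big_ord_recr/=; exact: trig_setU.
have ind1 E (w : Rd R d) : sqmod (\1_E w)%:C <= 1.
  by rewrite sqmod_real indicE; case: (_ \in _); rewrite ?expr1n ?expr0n.
apply: (@trig_limit_lim (fun n w => (\1_(B n) w)%:C) _ 1) => //.
- by move=> n; case: (tB n).
- apply: cmeasurable_real; apply: measurable_indic.
  by apply: bigcupT_measurable => n; case: (tA n).
move=> w _; have [[k _ Akw]|nA] := pselect ((\bigcup_k A k) w).
  apply: cvg_near_cst; exists k.+1 => // n /= kn.
  rewrite -rmorphB !indicE !mem_set ?subrr ?sqmod0//; last by exists k.
  by rewrite /B -bigcup_mkord; exists k.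
apply: cvg_near_cst; apply: nearW => n.
rewrite -rmorphB !indicE !memNset ?subrr ?sqmod0//.
by rewrite /B -bigcup_mkord => -[k _ Akw]; apply: nA; exists k.
Qed.

Let unitk (i : 'I_d) (j : 'I_d) : int := (j == i)%:R.

Let phase_unitk i (w : Rd R d) : phase (unitk i) w = tnth w i.
Proof.
rewrite /phase (bigD1 i)//= /unitk eqxx mul1r big1 ?addr0// => j ji.
by rewrite (negbTE ji) mul0r.
Qed.

Let trig_limit_cos i : trig_limit (fun w => (cos (2 * pi * tnth w i))%:C).
Proof.
rewrite (_ : (fun w => _) = trig [:: ((2^-1)%:C, unitk i);
    ((2^-1)%:C, (fun j => - unitk i j))]); first exact: trig_limit_trig.
apply/funext => w; rewrite /trig big_cons big_seq1 /echar phaseN phase_unitk /=.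
rewrite mulrN cosN sinN; apply/eqP; rewrite eq_complex/=; apply/andP; split;
  by apply/eqP; field.
Qed.

Let trig_limit_sin i : trig_limit (fun w => (sin (2 * pi * tnth w i))%:C).
Proof.
rewrite (_ : (fun w => _) = trig [:: (Complex 0 (- 2^-1), unitk i);
    (Complex 0 2^-1, (fun j => - unitk i j))]); first exact: trig_limit_trig.
apply/funext => w; rewrite /trig big_cons big_seq1 /echar phaseN phase_unitk /=.
rewrite mulrN cosN sinN; apply/eqP; rewrite eq_complex/=; apply/andP; split;
  by apply/eqP; field.
Qed.

Let cos_itv (x : R) : `|cos x| <= 1.
Proof. by rewrite ler_norml cos_geN1 cos_le1. Qed.

Let sin_lt0E (x : R) : 0 <= x < 1 -> (sin (2 * pi * x) < 0) = (2^-1 < x).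
Proof.
move=> /andP[x0 x1]; have p0 : 0 < pi :> R := pi_gt0 R.
have [x2|x2] := ltP 2^-1 x.
  have -> : 2 * pi * x = (2 * pi * x - pi) + pi by rewrite subrK.
  rewrite sinDpi oppr_lt0 sin_gt0_pi//; apply/andP; split; nra.
apply/negbTE; rewrite -leNgt sin_ge0_pi//; apply/andP; split; nra.
Qed.

Let cos_ltE (x a : R) : 0 <= x <= 2^-1 -> 0 <= a <= 2^-1 ->
  (cos (2 * pi * x) < cos (2 * pi * a)) = (a < x).
Proof.
move=> /andP[x0 x1] /andP[a0 a1]; have p0 : 0 < pi :> R := pi_gt0 R.
rewrite ltr_cos; last 2 first.
- by rewrite in_itv/=; apply/andP; split; nra.
- by rewrite in_itv/=; apply/andP; split; nra.
by rewrite ltr_pM2l// mulr_gt0.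
Qed.

Let cos_refl (x : R) : cos (2 * pi * (1 - x)) = cos (2 * pi * x).
Proof.
have -> : 2 * pi * (1 - x) = - (2 * pi * x) + pi *+ 2.
  by rewrite -[pi *+ 2]mulr_natl; ring.
by rewrite cosD2pi cosN.
Qed.

(* The sign of the sine tells in which half of [0, 1] the coordinate lies, and on
   each half the cosine is monotone. *)
Let trig_set_ray i (a : R) : trig_set [set w | a < tnth w i].
Proof.
have mray : measurable [set w : Rd R d | a < tnth w i].
  rewrite -[X in measurable X]setTI.
  apply: (@measurable_fun_ltr _ _ _ setT (fun=> a) (fun w : Rd R d => tnth w i)
    _ _ measurableT [set true]) => //.
  exact: measurable_tnth.
have w01 (w : Rd R d) : cube w -> 0 <= tnth w i < 1 by move=> /forallP.
have [t0 tC tU] := trig_set_sigma_algebra.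
have tsin : trig_set [set w | 0 < - sin (2 * pi * tnth w i)].
  apply: (@trig_set_gt0 _ 1) => //.
    under eq_fun do rewrite rmorphN -mulN1r.
    by apply: trig_limitZ; exact: trig_limit_sin.
  by move=> w; rewrite normrN ler_norml sin_geN1 sin_le1.
have tcos (b : R) : `|b| <= 1 ->
    trig_set [set w | 0 < b - cos (2 * pi * tnth w i)].
  move=> b1; apply: (@trig_set_gt0 _ 2) => //.
    under eq_fun do rewrite rmorphB.
    by apply: trig_limitB; [exact: trig_limit_cst|exact: trig_limit_cos].
  move=> w; apply: (le_trans (ler_normB _ _)).
  by have := cos_itv (2 * pi * tnth w i); lra.
have tcos' (b : R) : `|b| <= 1 ->
    trig_set [set w | 0 < cos (2 * pi * tnth w i) - b].
  move=> b1; apply: (@trig_set_gt0 _ 2) => //.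
    under eq_fun do rewrite rmorphB.
    by apply: trig_limitB; [exact: trig_limit_cos|exact: trig_limit_cst].
  move=> w; apply: (le_trans (ler_normB _ _)).
  by have := cos_itv (2 * pi * tnth w i); lra.
have [a0|a0] := ltP a 0.
  apply: (trig_set_eq (trig_setC t0)) => // w /w01/andP[w0 _].
  by split => [_|_ []] /=; exact: lt_le_trans a0 w0.
have [a1|a1] := leP 1 a.
  apply: (trig_set_eq t0) => // w /w01/andP[_ w1].
  by split => [[]|] /= ax; have := lt_trans ax w1; rewrite ltNge a1.
have [a2|a2] := ltP a 2^-1.
  apply: (trig_set_eq (trig_setU tsin (tcos _ (cos_itv (2 * pi * a))))) => //.
  move=> w /w01 /=; move: (tnth w i : R) => x x01.
  rewrite oppr_gt0 subr_gt0 sin_lt0E//.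
  have [x2|x2] := ltP 2^-1 x; first by split=> _; [lra|left].
  case/andP: x01 => x0 x1.
  rewrite cos_ltE; [|by rewrite x0|by rewrite a0 ltW].
  by split=> [[]|] //; right.
apply: (trig_set_eq (trig_setI tsin (tcos' _ (cos_itv (2 * pi * a))))) => //.
move=> w /w01 /=; move: (tnth w i : R) => x x01.
rewrite oppr_gt0 subr_gt0 sin_lt0E//.
have [x2|x2] := ltP 2^-1 x; last by split=> [[]//|ax]; exfalso; lra.
case/andP: x01 => x0 x1.
rewrite -(cos_refl x) -(cos_refl a) cos_ltE; last 2 first.
- by apply/andP; split; lra.
- by apply/andP; split; lra.
by split=> [[_ ?]|?]; [lra|split => //; lra].
Qed.

Let trig_set_measurable E : measurable E -> trig_set E.
Proof.
apply: smallest_sub; first exact: trig_set_sigma_algebra.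
move=> F; rewrite -bigcup_seq => -[i _ [B mB <-]]; rewrite setTI.
have [t0 tC tU] := trig_set_sigma_algebra.
pose P : set (set R) := [set A | trig_set ((@tnth d R ^~ i) @^-1` A)].
suff GP : (@RGenOInfty.G R).-sigma.-measurable `<=` P.
  by apply: GP; rewrite -RGenOInfty.measurableE.
apply: smallest_sub; rewrite /P.
  split => /=.
  - by rewrite preimage_set0.
  - by move=> A tA; rewrite setTD preimage_setC; exact: trig_setC.
  - by move=> A tA; rewrite preimage_bigcup; exact: tU.
move=> _ [a ->] /=.
rewrite (_ : _ @^-1` _ = [set w : Rd R d | a < tnth w i]).
  exact: trig_set_ray.
by apply/seteqP; split => w /=; rewrite in_itv/= andbT.
Qed.

Let trig_limit_ge0 (r : Rd R d -> R) (M : R) : measurable_fun setT r ->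
  (forall w, 0 <= r w <= M) -> trig_limit (fun w => (r w)%:C).
Proof.
move=> mr rM; have M0 : 0 <= M by have /andP[] := rM point; exact: le_trans.
have mr' : measurable_fun setT (EFin \o r) by exact/measurable_EFinP.
pose g := nnsfun_approx measurableT mr'.
have gr w : (fun n => g n w) @ \oo --> r w.
  have gcv := @cvg_nnsfun_approx _ _ _ _ measurableT _ mr' _ w Logic.I.
  have /fine_cvgP[_] : EFin \o (fun n => g n w) @ \oo --> (r w)%:E.
    by apply: gcv => x _; rewrite lee_fin; case/andP: (rM x).
  exact.
have gle n w : g n w <= r w.
  apply: (cvgr_to_ge (gr w)); exists n => // k nk.
  by have /lefP/(_ w) := nd_nnsfun_approx measurableT mr' nk.
apply: (@trig_limit_lim (fun n w => (g n w)%:C) _ (M ^+ 2)).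
- move=> n; rewrite (_ : (fun w => _) = fun w =>
      \sum_(y <- finmap.enum_fset (fset_set (range (g n))))
        y%:C * (\1_(g n @^-1` [set y]) w)%:C).
    apply: trig_limit_sum => y; apply: trig_limitZ.
    by apply: (proj2 (trig_set_measurable _)); exact: measurable_funPTI.
  apply/funext => w; rewrite fimfunE fsbig_finite//= rmorph_sum.
  by apply: eq_bigr => y _; rewrite rmorphM.
- move=> n w; rewrite sqmod_real ler_sqr ?nnegrE//.
  by rewrite (le_trans (gle n w))//; case/andP: (rM w).
- exact: cmeasurable_real.
- by move=> w; rewrite sqmod_real; case/andP: (rM w) => *; rewrite ler_sqr ?nnegrE.
- move=> w _; under eq_fun do rewrite -rmorphB sqmod_real expr2.
  have h1 : (fun n => r w - g n w) @ \oo --> (0 : R).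
    by rewrite -(subrr (r w)); apply: cvgB; [exact: cvg_cst|exact: gr].
  have h2' : (fun n => (r w - g n w) * (r w - g n w)) @ \oo --> (0 : R) * 0.
    exact: cvgM.
  by rewrite mulr0 in h2'.
Qed.

(** The functions that can be approximated form an algebra closed under bounded
    pointwise limits; it contains the signs of its real elements, hence the
    indicators of coordinate half-spaces and of all Borel sets. *)
Theorem trig_dense (b : Rd R d -> C) (M e : R) : cmeasurable b ->
  (forall w, sqmod (b w) <= M) -> 0 < e ->
  exists s, (sqnorm nu (fun z => ((b z.2 - trig s z.2) * h z)%R) < e%:E)%E.
Proof.
move=> mb bM e0.
have real_case (r : Rd R d -> R) : measurable_fun setT r ->
    (forall w, r w ^+ 2 <= M) -> trig_limit (fun w => (r w)%:C).
  move=> mr rM; have rM1 w : `|r w| <= M + 1.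
    by have := rM w; rewrite -real_normK ?num_real//; have := normr_ge0 (r w); nra.
  rewrite (_ : (fun w => _) = fun w => (r w + (M + 1))%:C - (M + 1)%:C); last first.
    by apply/funext => w; rewrite -rmorphB addrK.
  apply: trig_limitB; last exact: trig_limit_cst.
  apply: (@trig_limit_ge0 _ (2 * (M + 1))).
    by apply: measurable_funD => //; exact: measurable_cst.
  by move=> w; have := rM1 w; rewrite ler_norml => /andP[? ?]; apply/andP; split; lra.
suff [_ _ tb] : trig_limit b by exact: tb.
rewrite (_ : b = fun w => (Re (b w))%:C + Complex 0 1 * (Im (b w))%:C); last first.
  by apply/funext => w; rewrite [LHS]complexE.
case: mb => mRe mIm; apply: trig_limitD; last apply: trig_limitZ.
- apply: real_case => // w; apply: le_trans (bM w); by rewrite /sqmod lerDl sqr_ge0.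
- apply: real_case => // w; apply: le_trans (bM w); by rewrite /sqmod lerDr sqr_ge0.
Qed.

End weighted.
End trigonometric_polynomials.

(** * The Zak transform *)

Section sum_squares.
Context {R : realType} d (T : measurableType d).
Variable mu : {measure set T -> \bar R}.

Lemma sqnorm_sum I (s : seq I) (F : I -> T -> R[i]) :
  (forall i, sqintegrable mu (F i)) ->
  (sqnorm mu (fun x => (\sum_(i <- s) F i x)%R) =
   \sum_(i <- s) \sum_(j <- s) \int[mu]_x (cdot (F i x) (F j x))%:E)%E.
Proof.
move=> F2; rewrite /sqnorm.
under eq_integral do rewrite sqmod_sum -sumEFin.
rewrite integral_sum//; last first.
  move=> i; under eq_fun do rewrite -sumEFin.
  by apply: integrable_sum => // j _; exact: integrable_cdot.
apply: eq_bigr => i _; under eq_integral do rewrite -sumEFin.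
by rewrite integral_sum// => j; exact: integrable_cdot.
Qed.

(** Continuity of the squared norm, by [sqnormD_le] with [c] small compared with
    [e] and then [t] small compared with [e] and [c]. *)
Lemma sqnorm_near (f : T -> R[i]) (e : R) : sqintegrable mu f -> 0 < e ->
  exists2 t : R, 0 < t & forall g, cmeasurable g ->
    (sqnorm mu (fun x => (f x - g x)%R) < t%:E)%E ->
    (sqnorm mu g <= sqnorm mu f + e%:E /\ sqnorm mu f <= sqnorm mu g + e%:E)%E.
Proof.
move=> f2 e0; have [mf _] := f2.
have := sqnorm_fin f2; have := sqnorm_ge0 mu f.
case Ef : (sqnorm mu f) => [a||]// ; rewrite lee_fin => a0 _.
pose c := e / (4 * (a + e + 1)).
have c0 : 0 < c by rewrite divr_gt0//; lra.
have ca : c * (a + e) <= e / 2.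
  rewrite /c mulrAC ler_pdivrMr; last lra.
  nra.
pose t := e / (2 * (1 + c^-1)).
have ci : 0 < c^-1 by rewrite invr_gt0.
have t0 : 0 < t by rewrite divr_gt0// mulr_gt0//; lra.
have tE : (1 + c^-1) * t = e / 2 by rewrite /t; field; rewrite !gt_eqF//; lra.
exists t => // g mg gt.
have mfg : cmeasurable (fun x => f x - g x) by exact: cmeasurableB.
have hg : (sqnorm mu g <= (a + e)%:E)%E.
  have -> : g = (fun x => f x + (g x - f x)) by apply/funext => x; rewrite addrC subrK.
  apply: (le_trans (sqnormD_le mu c0 mf (cmeasurableB mg mf))).
  apply: (@le_trans _ _ ((1 + c)%:E * a%:E + (1 + c^-1)%:E * t%:E)%E).
    rewrite Ef leeD2l// lee_wpmul2l ?lee_fin ?addr_ge0 ?(ltW ci)//.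
    by rewrite sqnormB ltW.
  by rewrite -!EFinM -EFinD lee_fin tE; nra.
split; first by rewrite -EFinD.
case Eg : (sqnorm mu g) hg => [b||] hg //; last first.
  by have := sqnorm_ge0 mu g; rewrite Eg.
have b0 : 0 <= b by have := sqnorm_ge0 mu g; rewrite Eg lee_fin.
have bae : b <= a + e by rewrite -lee_fin.
rewrite -Ef.
have -> : f = (fun x => g x + (f x - g x)) by apply/funext => x; rewrite addrC subrK.
apply: (le_trans (sqnormD_le mu c0 mg mfg)).
apply: (@le_trans _ _ ((1 + c)%:E * b%:E + (1 + c^-1)%:E * t%:E)%E).
  rewrite Eg leeD2l// lee_wpmul2l ?lee_fin ?addr_ge0 ?(ltW ci)//.
  exact: ltW.
rewrite -!EFinM -EFinD lee_fin tE.
have : c * b <= c * (a + e) by rewrite ler_wpM2l// ltW.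
lra.
Qed.

End sum_squares.

Section zak.
Context {R : realType} (d : nat).
Local Notation C := R[i].
Local Notation lam := (lebesgue_measured R d).
Local Notation lam2 := (lam \x lam)%E.
Local Notation fn := (Rd R d -> C).
Local Notation fn2 := (Rd R d * Rd R d -> C).

Lemma integral_signed_shiftv (c : 'I_d -> R) (f : Rd R d -> \bar R) :
  measurable_fun setT f ->
  (\int[lam]_x f (shiftv c x) = \int[lam]_x f x)%E.
Proof.
move=> mf; rewrite integralE [RHS]integralE; congr (_ - _)%E.
  rewrite -[RHS](ge0_integral_shiftv c (f := f^\+%E))//.
    by apply: eq_integral => x _; rewrite !funeposE.
  exact: measurable_funepos.
rewrite -[RHS](ge0_integral_shiftv c (f := f^\-%E))//.
  by apply: eq_integral => x _; rewrite !funenegE.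
exact: measurable_funeneg.
Qed.

Lemma cube_shiftv_inj (k l : 'I_d -> int) (x : Rd R d) :
  cube (shiftv (fun i => (k i)%:~R) x) -> cube (shiftv (fun i => (l i)%:~R) x) ->
  k = l.
Proof.
move=> /forallP kx /forallP lx; apply/funext => i.
have := kx i; have := lx i; rewrite !tnth_mktuple.
move=> /andP[l0 l1] /andP[k0 k1].
move: (tnth x i : R) l0 l1 k0 k1 => y l0 l1 k0 k1.
apply/eqP; rewrite eq_le -!ltzD1 -!(ltr_int R) !intrD.
by apply/andP; split; lra.
Qed.

Lemma integral_cdot_translate (k l : 'I_d -> int) (a b : fn) :
  cmeasurable a -> cmeasurable b ->
  (forall x, ~~ cube x -> a x = 0) -> (forall x, ~~ cube x -> b x = 0) ->
  (\int[lam]_x (cdot (translate k a x) (translate l b x))%:E =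
   if `[< k = l >] then \int[lam]_x (cdot (a x) (b x))%:E else 0)%E.
Proof.
move=> ma mb a0 b0; case: asboolP => [<-|kl].
  have mab : measurable_fun setT (fun x => (cdot (a x) (b x))%:E).
    by apply/measurable_EFinP; exact: measurable_cdot.
  exact: (integral_signed_shiftv (fun i => (k i)%:~R) mab).
rewrite integral0_eq// => x _; rewrite !translateE; congr EFin.
have [kx|kx] := boolP (cube (shiftv (fun i => (k i)%:~R) x)); last first.
  by rewrite a0// cdot0.
have [lx|lx] := boolP (cube (shiftv (fun i => (l i)%:~R) x)); last first.
  by rewrite b0// cdotC cdot0.
by exfalso; apply: kl; exact: cube_shiftv_inj kx lx.
Qed.

Let cubeI_sqr (w : Rd R d) : cubeI w * cubeI w = cubeI w :> R.
Proof. by rewrite /cubeI; case: cube; rewrite ?mulr1 ?mulr0. Qed.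

(** The function whose Zak transform is [zatom k a] is the translate of [a] by
    [k], when [a] is supported in the cube. *)
Definition zatom (k : 'I_d -> int) (a : fn) : fn2 :=
  fun z => (cubeI z.2)%:C * echar k z.2 * a z.1.

Lemma integral_cdot_echar (k l : 'I_d -> int) (u v : C) :
  (\int[lam]_w (cdot ((cubeI w)%:C * echar k w * u)
                    ((cubeI w)%:C * echar l w * v))%:E =
   if `[< k = l >] then (cdot u v)%:E else 0)%E.
Proof.
pose m i := k i - l i.
pose A := Re u * Re v + Im u * Im v.
pose B := Im u * Re v - Re u * Im v.
transitivity (\int[lam]_w (A%:E * (cubeI w * cos (2 * pi * phase m w + 0))%:E -
    B%:E * (cubeI w * cos (2 * pi * phase m w + - (pi / 2)))%:E))%E.
  apply: eq_integral => w _; rewrite -!EFinM -EFinB; congr EFin.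
  rewrite cosBpihalf addr0 /m.
  have -> : 2 * pi * phase (fun i => k i - l i) w =
      2 * pi * phase k w - 2 * pi * phase l w.
    by rewrite (phaseD k (fun i => - l i)) phaseN; ring.
  rewrite cosB sinB /cdot !cReM !cImM /= -[in RHS]cubeI_sqr /A /B; ring.
rewrite integralB//; last 2 first.
- by apply: integrableZl => //; exact: integrable_cube_cos.
- by apply: integrableZl => //; exact: integrable_cube_cos.
rewrite !integralZl//; try exact: integrable_cube_cos.
case: asboolP => [kl|kl].
  have ph0 w : phase m w = 0.
    by rewrite /phase big1// => i _; rewrite /m kl subrr mul0r.
  under eq_integral do rewrite ph0 mulr0 add0r cos0 mulr1.
  rewrite integral_cubeI mule1.
  under eq_integral do rewrite ph0 mulr0 add0r cosN cos_pihalf mulr0.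
  by rewrite integral0 mule0 sube0.
have [i mi] : exists i, m i != 0.
  apply: contrapT => /forallNP m0; apply: kl; apply/funext => i.
  by apply/eqP; rewrite -subr_eq0; apply/negPn/negP; exact: m0.
by rewrite !integral_cube_cos ?mule0 ?sube0//; exists i.
Qed.

Lemma cmeasurable_zatom k (a : fn) : cmeasurable a -> cmeasurable (zatom k a).
Proof.
move=> ma; apply: cmeasurableM; last exact: (cmeasurable_comp measurable_fst ma).
apply: (cmeasurable_comp measurable_snd (f := fun w => (cubeI w)%:C * echar k w)).
apply: cmeasurableM; last exact: cmeasurable_echar.
by apply: cmeasurable_real; exact: measurable_cubeI.
Qed.

Lemma sqnorm_zatom k (a : fn) : cmeasurable a ->
  sqnorm lam2 (zatom k a) = sqnorm lam a.
Proof.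
move=> ma; rewrite /sqnorm (fubini_tonelli1 (fun z => (sqmod (zatom k a z))%:E)).
- apply: eq_integral => y _; rewrite /fubini_F.
  under eq_integral do rewrite sqmod_cdot.
  by rewrite /zatom/= integral_cdot_echar asboolT// sqmod_cdot.
- by apply: measurable_Esqmod; exact: cmeasurable_zatom.
- by move=> z; rewrite lee_fin sqmod_ge0.
Qed.

Lemma sqintegrable_zatom k (a : fn) : sqintegrable lam a ->
  sqintegrable lam2 (zatom k a).
Proof.
by move=> [ma a2]; split; [exact: cmeasurable_zatom|rewrite sqnorm_zatom].
Qed.

Lemma integral_cdot_zatom (k l : 'I_d -> int) (a b : fn) :
  sqintegrable lam a -> sqintegrable lam b ->
  (\int[lam2]_z (cdot (zatom k a z) (zatom l b z))%:E =
   if `[< k = l >] then \int[lam]_x (cdot (a x) (b x))%:E else 0)%E.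
Proof.
move=> a2 b2; rewrite -integral12_prod_meas1; last first.
  by apply: integrable_cdot; exact: sqintegrable_zatom.
rewrite /fubini_F /zatom/=.
under eq_integral do rewrite integral_cdot_echar.
by case: asboolP => // _; rewrite integral0.
Qed.

(** The Zak transform on finite sums of lattice translates of functions supported
    in the unit cube. A function may be decomposed in several ways, and is then
    related to several expressions, which the isometry shows to agree almost
    everywhere. *)
Definition zak_finite (f : fn) (h : fn2) := exists (I : finType)
  (k : I -> 'I_d -> int) (a : I -> fn),
  [/\ forall i, sqintegrable lam (a i), forall i x, ~~ cube x -> a i x = 0,
      f = (fun x => \sum_i translate (k i) (a i) x) &
      h = (fun z => \sum_i zatom (k i) (a i) z)].

Lemma zak_finite_sqintegrable f h : zak_finite f h ->
  sqintegrable lam f /\ sqintegrable lam2 h.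
Proof.
move=> [I [k [a [a2 _ -> ->]]]]; split; apply: sqintegrable_sum => i.
  exact: sqintegrable_translate.
exact: sqintegrable_zatom.
Qed.

Lemma zak_finite_isometry f h : zak_finite f h -> sqnorm lam2 h = sqnorm lam f.
Proof.
move=> [I [k [a [a2 a0 -> ->]]]].
rewrite !sqnorm_sum; last 2 first.
- by move=> i; exact: sqintegrable_translate.
- by move=> i; exact: sqintegrable_zatom.
apply: eq_bigr => i _; apply: eq_bigr => j _.
rewrite integral_cdot_zatom//.
by rewrite (integral_cdot_translate _ _ (a2 i).1 (a2 j).1 (a0 i) (a0 j)).
Qed.

Lemma zak_finite_cube f h : zak_finite f h -> forall z, ~~ cube z.2 -> h z = 0.
Proof.
move=> [I [k [a [_ _ _ ->]]]] z z2; rewrite big1// => i _.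
by rewrite /zatom /cubeI (negbTE z2) !mul0r.
Qed.

Lemma zak_finiteD f h f' h' : zak_finite f h -> zak_finite f' h' ->
  zak_finite (fun x => f x + f' x) (fun z => h z + h' z).
Proof.
move=> [I [k [a [a2 a0 -> ->]]]] [J [l [b [b2 b0 -> ->]]]].
exists (I + J)%type, (fun s => match s with inl i => k i | inr j => l j end),
  (fun s => match s with inl i => a i | inr j => b j end); split.
- by case.
- by case.
- by apply/funext => x; rewrite big_sumType.
- by apply/funext => x; rewrite big_sumType.
Qed.

Lemma zak_finiteZ (c : C) f h : zak_finite f h ->
  zak_finite (fun x => c * f x) (fun z => c * h z).
Proof.
move=> [I [k [a [a2 a0 -> ->]]]]; exists I, k, (fun i x => c * a i x); split.
- by move=> i; exact: sqintegrableZ.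
- by move=> i x cx; rewrite a0// mulr0.
- by apply/funext => x; rewrite mulr_sumr.
- apply/funext => z; rewrite mulr_sumr; apply: eq_bigr => i _.
  by rewrite /zatom; ring.
Qed.

Lemma zak_finite_translate (l : 'I_d -> int) f h : zak_finite f h ->
  zak_finite (translate l f) (fun z => echar l z.2 * h z).
Proof.
move=> [I [k [a [a2 a0 -> ->]]]].
exists I, (fun i j => l j + k i j), a; split => //.
- apply/funext => x; rewrite translateE; apply: eq_bigr => i _.
  by rewrite -translate_comp.
- apply/funext => z; rewrite mulr_sumr; apply: eq_bigr => i _.
  by rewrite /zatom echarD; ring.
Qed.

End zak.

(** * Extension of the Zak transform to square-integrable functions *)

Lemma cvg_geometric_tail (R : realType) :
  (fun r => (4 * 8 ^- r)%:E) @ \oo --> (0 : \bar R)%E.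
Proof.
apply: cvg_EFin; first exact: nearW.
have h : (fun r => 4 * 8^-1 ^+ r) @ \oo --> (4 * 0 : R).
  apply: cvgM; first exact: cvg_cst.
  by apply: cvg_expr; rewrite ger0_norm ?invr_ge0// invf_lt1// ltr1n.
by rewrite mulr0 in h; under eq_fun do rewrite -exprVn.
Qed.

Section zak_relation.
Context {R : realType} (d : nat).
Local Notation C := R[i].
Local Notation lam := (lebesgue_measured R d).
Local Notation lam2 := (lam \x lam)%E.
Local Notation fn := (Rd R d -> C).
Local Notation fn2 := (Rd R d * Rd R d -> C).
Implicit Types (f : fn) (h : fn2).

(** [zak f h]: [h] is the Zak transform of [f]. It is a relation because [h] is
    determined up to a null set only; it is the closure of [zak_finite]. *)
Definition zak f h := [/\ sqintegrable lam f, sqintegrable lam2 h,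
  forall z, ~~ cube z.2 -> h z = 0 &
  forall e : R, 0 < e -> exists f' h', [/\ zak_finite f' h',
    (sqnorm lam (fun x => (f x - f' x)%R) < e%:E)%E &
    (sqnorm lam2 (fun z => (h z - h' z)%R) < e%:E)%E]].

Lemma zak_of_finite f h : zak_finite f h -> zak f h.
Proof.
move=> fh; have [f2 h2] := zak_finite_sqintegrable fh.
split => //; first exact: zak_finite_cube fh.
move=> e e0; exists f, h; split => //.
  by under eq_fun do rewrite subrr; rewrite sqnorm0 lte_fin.
by under eq_fun do rewrite subrr; rewrite sqnorm0 lte_fin.
Qed.

(** Squared norms are continuous, so that the isometry passes from finite sums to
    their limits. *)
Lemma zak_isometry f h : zak f h -> sqnorm lam2 h = sqnorm lam f.
Proof.
move=> [f2 h2 _ fh].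
have key (e : R) : 0 < e -> (sqnorm lam2 h <= sqnorm lam f + e%:E)%E /\
    (sqnorm lam f <= sqnorm lam2 h + e%:E)%E.
  move=> e0; have e20 : 0 < e / 2 by rewrite divr_gt0.
  have [t t0 tf] := sqnorm_near f2 e20; have [t' t'0 th] := sqnorm_near h2 e20.
  have [|f' [h' [fh' ff' hh']]] := fh (Num.min t t'); first by rewrite lt_min t0.
  have [f'2 h'2] := zak_finite_sqintegrable fh'.
  have [f1 f1'] : (sqnorm lam f' <= sqnorm lam f + (e / 2)%:E /\
      sqnorm lam f <= sqnorm lam f' + (e / 2)%:E)%E.
    apply: tf; first by case: f'2.
    by apply: (lt_le_trans ff'); rewrite lee_fin ge_min lexx.
  have [h1 h1'] : (sqnorm lam2 h' <= sqnorm lam2 h + (e / 2)%:E /\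
      sqnorm lam2 h <= sqnorm lam2 h' + (e / 2)%:E)%E.
    apply: th; first by case: h'2.
    by apply: (lt_le_trans hh'); rewrite lee_fin ge_min lexx orbT.
  have E : (e%:E = (e / 2)%:E + (e / 2)%:E)%E by rewrite -EFinD -splitr.
  have iso := zak_finite_isometry fh'.
  split; rewrite E addeA.
  - by apply: (le_trans h1'); rewrite leeD2r// iso.
  - by apply: (le_trans f1'); rewrite leeD2r// -iso.
apply/eqP; rewrite eq_le; apply/andP; split; apply/lee_addgt0Pr => e e0.
- by have [] := key e e0.
- by have [] := key e e0.
Qed.

Let sqnorm_triangle d1 (T : measurableType d1) (mu : {measure set T -> \bar R})
    (f g k : T -> C) (e : R) :
  cmeasurable f -> cmeasurable g -> cmeasurable k ->
  (sqnorm mu (fun x => (f x - g x)%R) < (e / 4)%:E)%E ->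
  (sqnorm mu (fun x => (g x - k x)%R) < (e / 4)%:E)%E ->
  (sqnorm mu (fun x => (f x - k x)%R) < e%:E)%E.
Proof.
move=> mf mg mk fg gk.
have -> : (fun x => f x - k x) = (fun x => (f x - g x) + (g x - k x)).
  by apply/funext => x; rewrite subrKA.
apply: (le_lt_trans (sqnormD_le2 _ _ _)); [exact: cmeasurableB|exact: cmeasurableB|].
exact: lte_double_quarters.
Qed.

Lemma zak_closed f h : sqintegrable lam f -> sqintegrable lam2 h ->
  (forall z, ~~ cube z.2 -> h z = 0) ->
  (forall e : R, 0 < e -> exists f' h', [/\ zak f' h',
    (sqnorm lam (fun x => (f x - f' x)%R) < e%:E)%E &
    (sqnorm lam2 (fun z => (h z - h' z)%R) < e%:E)%E]) ->
  zak f h.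
Proof.
move=> f2 h2 h0 fh; split => // e e0.
have e4 : 0 < e / 4 by rewrite divr_gt0.
have [f1 [h1 [[[mf1 _] [mh1 _] _ fh1] ff1 hh1]]] := fh _ e4.
have [f' [h' [fh' ff' hh']]] := fh1 _ e4.
have [[mf' _] [mh' _]] := zak_finite_sqintegrable fh'.
exists f', h'; split => //.
  by apply: (@sqnorm_triangle _ _ _ _ f1) => //; case: f2.
by apply: (@sqnorm_triangle _ _ _ _ h1) => //; case: h2.
Qed.

Lemma zakD f h f' h' : zak f h -> zak f' h' ->
  zak (fun x => f x + f' x) (fun z => h z + h' z).
Proof.
move=> [f2 h2 h0 fh] [f'2 h'2 h'0 fh']; split.
- exact: sqintegrableD.
- exact: sqintegrableD.
- by move=> z z2; rewrite h0// h'0// addr0.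
move=> e e0; have e4 : 0 < e / 4 by rewrite divr_gt0.
have [f1 [h1 [fh1 ff1 hh1]]] := fh _ e4.
have [f1' [h1' [fh1' ff1' hh1']]] := fh' _ e4.
have [[mf1 _] [mh1 _]] := zak_finite_sqintegrable fh1.
have [[mf1' _] [mh1' _]] := zak_finite_sqintegrable fh1'.
have [[mf _] [mh _]] := (f2, h2); have [[mf' _] [mh' _]] := (f'2, h'2).
exists (fun x => f1 x + f1' x), (fun z => h1 z + h1' z).
split; first exact: zak_finiteD.
- have -> : (fun x => f x + f' x - (f1 x + f1' x)) =
      (fun x => (f x - f1 x) + (f' x - f1' x)).
    by apply/funext => x; rewrite opprD addrACA.
  apply: (le_lt_trans (sqnormD_le2 _ _ _)); [exact: cmeasurableB|exact: cmeasurableB|].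
  exact: lte_double_quarters.
- have -> : (fun x => h x + h' x - (h1 x + h1' x)) =
      (fun x => (h x - h1 x) + (h' x - h1' x)).
    by apply/funext => x; rewrite opprD addrACA.
  apply: (le_lt_trans (sqnormD_le2 _ _ _)); [exact: cmeasurableB|exact: cmeasurableB|].
  exact: lte_double_quarters.
Qed.

Lemma zakZ (c : C) f h : zak f h -> zak (fun x => c * f x) (fun z => c * h z).
Proof.
move=> [f2 h2 h0 fh]; split.
- exact: sqintegrableZ.
- exact: sqintegrableZ.
- by move=> z z2; rewrite h0// mulr0.
have [[mf _] [mh _]] := (f2, h2).
move=> e e0; have c1 : 0 < sqmod c + 1 by have := sqmod_ge0 c; lra.
have [|f1 [h1 [fh1 ff1 hh1]]] := fh (e / (sqmod c + 1)); first by rewrite divr_gt0.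
have [[mf1 _] [mh1 _]] := zak_finite_sqintegrable fh1.
have eE : (e%:E = (sqmod c + 1)%:E * (e / (sqmod c + 1))%:E)%E.
  by rewrite -EFinM mulrC divfK// gt_eqF.
have small d1 (T : measurableType d1) (mu : {measure set T -> \bar R})
    (g g1 : T -> C) : cmeasurable g -> cmeasurable g1 ->
    (sqnorm mu (fun x => (g x - g1 x)%R) < (e / (sqmod c + 1))%:E)%E ->
    (sqnorm mu (fun x => (c * g x - c * g1 x)%R) < e%:E)%E.
  move=> mg mg1 gg1; under eq_fun do rewrite -mulrBr.
  rewrite sqnormZ; last exact: cmeasurableB.
  apply: (@le_lt_trans _ _ ((sqmod c + 1)%:E * sqnorm mu (fun x => (g x - g1 x)%R))%E).
    by rewrite lee_wpmul2r ?sqnorm_ge0// lee_fin lerDl.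
  by rewrite eE lte_pmul2l// lte_fin.
exists (fun x => c * f1 x), (fun z => c * h1 z).
by split; [exact: zak_finiteZ|exact: small|exact: small].
Qed.

Lemma zakB f h f' h' : zak f h -> zak f' h' ->
  zak (fun x => f x - f' x) (fun z => h z - h' z).
Proof.
move=> fh fh'; have := zakD fh (zakZ (-1) fh').
under eq_fun do rewrite mulN1r; under [X in zak _ X]eq_fun do rewrite mulN1r.
exact.
Qed.

Lemma zak0 : zak (fun=> 0) (fun=> 0).
Proof.
apply: zak_of_finite; exists 'I_0, (fun=> fun=> 0), (fun=> fun=> 0); split => //.
- by case.
- by apply/funext => x; rewrite big_ord0.
- by apply/funext => x; rewrite big_ord0.
Qed.

Lemma zak_sum I (s : seq I) (F : I -> fn) (H : I -> fn2) :
  (forall i, zak (F i) (H i)) ->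
  zak (fun x => \sum_(i <- s) F i x) (fun z => \sum_(i <- s) H i z).
Proof.
move=> FH; elim: s => [|i s ih].
  under eq_fun do rewrite big_nil; under [X in zak _ X]eq_fun do rewrite big_nil.
  exact: zak0.
under eq_fun do rewrite big_cons; under [X in zak _ X]eq_fun do rewrite big_cons.
exact: zakD.
Qed.

Lemma zak_translate (l : 'I_d -> int) f h : zak f h ->
  zak (translate l f) (fun z => echar l z.2 * h z).
Proof.
move=> [f2 h2 h0 fh]; have [[mf _] [mh _]] := (f2, h2).
have me : cmeasurable (fun z : Rd R d * Rd R d => echar l z.2).
  exact: (cmeasurable_comp measurable_snd (cmeasurable_echar l)).
split.
- exact: sqintegrable_translate.
- apply: (@sqintegrable_le _ _ _ _ 1 _ h) => //; first exact: cmeasurableM.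
  by move=> z; rewrite sqmodM sqmod_echar.
- by move=> z z2; rewrite h0// mulr0.
move=> e e0; have [f1 [h1 [fh1 ff1 hh1]]] := fh _ e0.
have [[mf1 _] [mh1 _]] := zak_finite_sqintegrable fh1.
exists (translate l f1), (fun z => echar l z.2 * h1 z).
split; first exact: zak_finite_translate.
- by rewrite -(sqnorm_translate l (cmeasurableB mf mf1)) in ff1.
- rewrite (@eq_sqnorm _ _ _ _ _ (fun z => h z - h1 z))// => z.
  by rewrite -mulrBr sqmodM sqmod_echar mul1r.
Qed.

(** The action of a trigonometric polynomial on a function of the space variable. *)
Definition trig_act (s : seq (C * ('I_d -> int))) f : fn :=
  fun x => \sum_(p <- s) p.1 * translate p.2 f x.

Lemma zak_trig_act s f h : zak f h ->
  zak (trig_act s f) (fun z => trig s z.2 * h z).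
Proof.
move=> fh.
rewrite (_ : (fun z => _) = fun z => \sum_(p <- s) p.1 * (echar p.2 z.2 * h z)).
  by apply: zak_sum => p; apply: zakZ; exact: zak_translate.
by apply/funext => z; rewrite mulr_suml; apply: eq_bigr => p _; rewrite mulrA.
Qed.

(** By isometry, a geometrically Cauchy sequence in the space variable has
    geometrically Cauchy transforms, and both sides converge. *)
Lemma zak_complete (F : nat -> fn) (H : nat -> fn2) :
  (forall r, zak (F r) (H r)) ->
  (forall r, (sqnorm lam (fun x => (F r.+1 x - F r x)%R) <= (8 ^- r)%:E)%E) ->
  exists f h, [/\ zak f h,
    forall r, (sqnorm lam (fun x => (F r x - f x)%R) <= (4 * 8 ^- r)%:E)%E &
    forall r, (sqnorm lam2 (fun z => (H r z - h z)%R) <= (4 * 8 ^- r)%:E)%E].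
Proof.
move=> FH F8.
have F2 r : sqintegrable lam (F r) by case: (FH r).
have H2 r : sqintegrable lam2 (H r) by case: (FH r).
have H8 r : (sqnorm lam2 (fun x => (H r.+1 x - H r x)%R) <= (8 ^- r)%:E)%E.
  by rewrite (zak_isometry (zakB (FH r.+1) (FH r))).
have [f f2 Ff] := sqnorm_complete F2 F8.
have [h0 h02 Hh0] := sqnorm_complete H2 H8.
pose h z := (cubeI z.2)%:C * h0 z.
have cub (z : Rd R d * Rd R d) g : sqmod ((cubeI z.2)%:C * g) <= sqmod g.
  rewrite sqmodM sqmod_real /cubeI; case: cube; rewrite ?expr1n ?mul1r//.
  by rewrite expr0n mul0r sqmod_ge0.
have mcub : cmeasurable (fun z : Rd R d * Rd R d => (cubeI z.2)%:C).
  apply: (cmeasurable_comp measurable_snd (f := fun w => (cubeI w)%:C)).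
  by apply: cmeasurable_real; exact: measurable_cubeI.
have h2 : sqintegrable lam2 h.
  apply: (@sqintegrable_le _ _ _ _ 1 _ h0) => //.
    by apply: cmeasurableM => //; case: h02.
  by move=> z; rewrite mul1r; exact: cub.
have Hh r : (sqnorm lam2 (fun z => (H r z - h z)%R) <= (4 * 8 ^- r)%:E)%E.
  have [mH _] := H2 r; have [mh0 _] := h02; have [mh _] := h2.
  apply: le_trans (Hh0 r); apply: le_sqnorm; [exact: cmeasurableB|exact: cmeasurableB|] => z.
  have -> : H r z - h z = (cubeI z.2)%:C * (H r z - h0 z); last exact: cub.
  rewrite /h mulrBr; congr (_ - _).
  have [zc|zc] := boolP (cube z.2).
    by rewrite /cubeI zc (rmorph1 (real_complex R)) mul1r.
  by have [_ _ -> //] := FH r; rewrite mulr0.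
exists f, h; split => //.
apply: zak_closed => //.
  by move=> z z2; rewrite /h /cubeI (negbTE z2) mul0r.
move=> e e0.
have [r re] := cvge0_lt (@cvg_geometric_tail R) e0; exists (F r), (H r); split => //.
- by rewrite sqnormB; exact: le_lt_trans (Ff r) re.
- by rewrite sqnormB; exact: le_lt_trans (Hh r) re.
Qed.

Let geometric_step d1 (T : measurableType d1) (mu : {measure set T -> \bar R})
    (g : T -> C) (F : nat -> T -> C) : cmeasurable g ->
  (forall r, cmeasurable (F r)) ->
  (forall r, (sqnorm mu (fun x => (g x - F r x)%R) < (8 ^- r / 4)%:E)%E) ->
  forall r, (sqnorm mu (fun x => (F r.+1 x - F r x)%R) <= (8 ^- r)%:E)%E.
Proof.
move=> mg mF gF r.
have -> : (fun x => F r.+1 x - F r x) = (fun x => (F r.+1 x - g x) + (g x - F r x)).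
  by apply/funext => x; rewrite subrKA.
apply: (le_trans (sqnormD_le2 _ _ _)); [exact: cmeasurableB|exact: cmeasurableB|].
apply/ltW; have r0 : 0 < (8 ^+ r)^-1 :> R by rewrite invr_gt0 exprn_gt0.
apply: lte_double_quarters => //; rewrite sqnormB; apply: (lt_le_trans (gF _)).
by rewrite lee_fin exprS invfM; lra.
Qed.

Let geometric_limit_unique d1 (T : measurableType d1)
    (mu : {measure set T -> \bar R}) (f g : T -> C) (F : nat -> T -> C) :
  cmeasurable f -> cmeasurable g -> (forall r, cmeasurable (F r)) ->
  (forall r, (sqnorm mu (fun x => (g x - F r x)%R) < (8 ^- r / 4)%:E)%E) ->
  (forall r, (sqnorm mu (fun x => (F r x - f x)%R) <= (4 * 8 ^- r)%:E)%E) ->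
  forall e : R, 0 < e -> (sqnorm mu (fun x => (g x - f x)%R) < e%:E)%E.
Proof.
move=> mf mg mF gF Ff e e0; have e4 : 0 < e / 4 by rewrite divr_gt0.
have [r re] := cvge0_lt (@cvg_geometric_tail R) e4.
apply: (@sqnorm_triangle _ _ _ _ (F r)) => //.
  apply: (lt_trans (gF r)); apply: le_lt_trans re; rewrite lee_fin.
  have : 0 < (8 ^+ r)^-1 :> R by rewrite invr_gt0 exprn_gt0.
  lra.
exact: le_lt_trans (Ff r) re.
Qed.

(** Approximation in the space variable alone is enough: by isometry the
    transforms of the approximants converge as well. *)
Lemma zak_of_space_limit (g : fn) : sqintegrable lam g ->
  (forall e : R, 0 < e -> exists f h, zak f h /\
    (sqnorm lam (fun x => (g x - f x)%R) < e%:E)%E) ->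
  exists h, zak g h.
Proof.
move=> g2 gP; have [mg _] := g2.
have r0 r : 0 < (8 ^- r / 4) :> R by rewrite divr_gt0// invr_gt0 exprn_gt0.
have /choice[F FP] : forall r, exists f, exists h, zak f h /\
    (sqnorm lam (fun x => (g x - f x)%R) < (8 ^- r / 4)%:E)%E.
  by move=> r; exact: gP (r0 r).
have [H FH] := choice FP.
have mF r : cmeasurable (F r) by case: (FH r) => -[[]].
have gF r := proj2 (FH r).
have [f [h [fh Ff Hh]]] :=
  zak_complete (fun r => proj1 (FH r)) (geometric_step mg mF gF).
exists h; have [[mf _] h2 h0 _] := fh.
apply: zak_closed => // e e0.
exists f, h; split => //; first exact: (geometric_limit_unique mf mg mF gF Ff).
by under eq_fun do rewrite subrr; rewrite sqnorm0 lte_fin.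
Qed.

(** Dually, approximation in the frequency variable alone: the range is closed. *)
Lemma zak_of_frequency_limit (k : fn2) : sqintegrable lam2 k ->
  (forall z, ~~ cube z.2 -> k z = 0) ->
  (forall e : R, 0 < e -> exists f h, zak f h /\
    (sqnorm lam2 (fun z => (k z - h z)%R) < e%:E)%E) ->
  exists g, zak g k.
Proof.
move=> k2 k0 kP; have [mk _] := k2.
have r0 r : 0 < (8 ^- r / 4) :> R by rewrite divr_gt0// invr_gt0 exprn_gt0.
have /choice[F FP] : forall r, exists f, exists h, zak f h /\
    (sqnorm lam2 (fun z => (k z - h z)%R) < (8 ^- r / 4)%:E)%E.
  by move=> r; exact: kP (r0 r).
have [H FH] := choice FP.
have mH r : cmeasurable (H r) by case: (FH r) => -[_ []].
have kH r := proj2 (FH r).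
have [|f [h [fh Ff Hh]]] := zak_complete (fun r => proj1 (FH r)).
  move=> r; rewrite -(zak_isometry (zakB (proj1 (FH r.+1)) (proj1 (FH r)))).
  exact: geometric_step mk mH kH r.
exists f; have [f2 [mh _] h0 _] := fh.
apply: zak_closed => // e e0.
exists f, h; split => //; last exact: (geometric_limit_unique mh mk mH kH Hh).
by under eq_fun do rewrite subrr; rewrite sqnorm0 lte_fin.
Qed.

(** Multiplication of the transform by a bounded function of the frequency stays
    in the range of the Zak transform, because it is a limit of multiplications by
    trigonometric polynomials, that is, of combinations of translations. *)
Lemma zak_multiplier f h (b : Rd R d -> C) (M : R) : zak f h -> cmeasurable b ->
  (forall w, sqmod (b w) <= M) -> exists g, zak g (fun z => b z.2 * h z).
Proof.
move=> fh mb bM; have [f2 h2 h0 _] := fh; have [mh _] := h2.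
have M0 : 0 <= M by apply: le_trans (bM point); exact: sqmod_ge0.
apply: zak_of_frequency_limit.
- apply: (@sqintegrable_le _ _ _ _ M _ h) => //.
    by apply: cmeasurableM => //; exact: (cmeasurable_comp measurable_snd mb).
  by move=> z; rewrite sqmodM ler_wpM2r// sqmod_ge0.
- by move=> z z2; rewrite h0// mulr0.
move=> e e0; have [s hs] := trig_dense h2 h0 mb bM e0.
exists (trig_act s f), (fun z => trig s z.2 * h z); split.
  exact: zak_trig_act.
by under eq_fun do rewrite -mulrBl.
Qed.

(** Cutting a function along the lattice translates of the unit cube. *)
Lemma zak_exists f : sqintegrable lam f -> exists h, zak f h.
Proof.
move=> f2; have [mf _] := f2; apply: zak_of_space_limit => // e e0.
pose piece (k : 'I_d -> int) (y : Rd R d) : C :=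
  (cubeI y)%:C * translate (fun i => - k i) f y.
have piece2 k : sqintegrable lam (piece k).
  apply: (@sqintegrable_le _ _ _ _ 1 _ (translate (fun i => - k i) f)) => //.
  - apply: cmeasurableM; last exact: translate_cmeasurable.
    by apply: cmeasurable_real; exact: measurable_cubeI.
  - exact: sqintegrable_translate.
  - move=> y; rewrite sqmodM sqmod_real /cubeI mul1r.
    by case: cube; rewrite ?expr1n ?mul1r// expr0n mul0r sqmod_ge0.
have pieceE k x : translate k (piece k) x =
    (cubeI (shiftv (fun i => (k i)%:~R) x))%:C * f x.
  rewrite translateE /piece; congr (_ * _).
  rewrite -[shiftv _ x]/(shiftv (fun i => (k i)%:~R) x) -(translateE k).
  rewrite translate_comp (_ : (fun i => _) = fun=> 0) ?translate0//.
  by apply/funext => i; rewrite subrr.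
pose kn (n : nat) : option {ffun 'I_d -> int} := pickle_inv n.
pose Fn n x := \sum_(i < n)
  if kn i is Some k then translate k (piece k) x else 0.
pose cell (x : Rd R d) : {ffun 'I_d -> int} := [ffun i => Num.floor (tnth x i : R)].
have cellP (k : {ffun 'I_d -> int}) x :
    cube (shiftv (fun i => (k i)%:~R) x) = (k == cell x).
  have cx : cube (shiftv (fun i => (cell x i)%:~R) x).
    apply/forallP => i; rewrite tnth_mktuple ffunE.
    have /andP[] := floor_itv (tnth x i : R); rewrite intrD.
    move: (tnth x i : R) => y y1 y2; apply/andP; split; lra.
  apply/idP/eqP => [kx|->//]; apply/ffunP => i.
  by rewrite (cube_shiftv_inj kx cx).
have FnE n x : Fn n x = if (pickle (cell x) < n)%N then f x else 0.
  have termE i : (if kn i is Some k then translate k (piece k) x else 0) =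
      if i == pickle (cell x) then f x else 0.
    case E : (kn i) => [k|].
      rewrite pieceE /cubeI cellP -(inj_eq (pcan_inj (@pickleK _))).
      have -> : pickle k = i.
        move: E; rewrite /kn => E.
        by have := @pickle_invK {ffun 'I_d -> int} i; rewrite E.
      case: eqP => _; first by rewrite (rmorph1 (real_complex R)) mul1r.
      by rewrite (rmorph0 (real_complex R)) mul0r.
    by case: eqP => // ix; move: E; rewrite /kn ix pickleK_inv.
  rewrite /Fn; elim: n => [|n ih]; first by rewrite big_ord0.
  rewrite big_ord_recr/= ih termE ltnS.
  by case: (ltngtP n (pickle (cell x))) => _; rewrite ?addr0 ?add0r.
have zFn n : exists h, zak (Fn n) h.
  elim: n => [|n [h hn]].
    exists (fun=> 0); rewrite (_ : Fn 0 = fun=> 0); first exact: zak0.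
    by apply/funext => x; rewrite /Fn big_ord0.
  rewrite (_ : Fn n.+1 = fun x => Fn n x +
    (if kn n is Some k then translate k (piece k) x else 0)); last first.
    by apply/funext => x; rewrite /Fn big_ord_recr.
  case: (kn n) => [k|]; last first.
    exists h; rewrite (_ : (fun x => _) = Fn n)//.
    by apply/funext => x; rewrite addr0.
  exists (fun z => h z + zatom k (piece k) z); apply: zakD => //.
  apply: zak_of_finite; exists 'I_1, (fun=> k), (fun=> piece k); split => //.
  - by move=> _ x cx; rewrite /piece /cubeI (negbTE cx) mul0r.
  - by apply/funext => x; rewrite big_ord1.
  - by apply/funext => x; rewrite big_ord1.
have mFn n : cmeasurable (Fn n) by have [h [[]]] := zFn n.
have cvg0 : (fun n => sqnorm lam (fun x => (f x - Fn n x)%R)) @ \oo -->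
    (\int[lam]_x 0)%E.
  apply: (@dominated_cvg _ _ _ lam setT measurableT _ _
    (fun x => (sqmod (f x))%:E)) => //.
  - by move=> n; apply: measurable_Esqmod; exact: cmeasurableB.
  - move=> x _; apply: cvg_near_cst; exists (pickle (cell x)).+1 => // n /= xn.
    by rewrite FnE xn subrr sqmod0.
  - exact: integrable_sqmod.
  - move=> n x _; rewrite gee0_abs ?lee_fin ?sqmod_ge0// FnE.
    by case: ifP => _; rewrite ?subrr ?subr0 ?sqmod0 ?sqmod_ge0.
rewrite integral0 in cvg0.
have [n nP] := cvge0_lt cvg0 e0; have [h hn] := zFn n.
by exists (Fn n), h.
Qed.

End zak_relation.

(** * Fibrewise minimization *)

Section complex_sequences.
Context {R : realType}.
Implicit Types (u v : nat -> R[i]) (a b : R[i]).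

Definition ccvg u a := (fun n => Re (u n)) @ \oo --> Re a /\
  (fun n => Im (u n)) @ \oo --> Im a.

Lemma ccvg_cst a : ccvg (fun=> a) a.
Proof. by split; exact: cvg_cst. Qed.

Lemma ccvgD u v a b : ccvg u a -> ccvg v b -> ccvg (fun n => u n + v n) (a + b).
Proof.
move=> [u1 u2] [v1 v2]; split.
- by rewrite cReD; under eq_fun do rewrite cReD; exact: cvgD.
- by rewrite cImD; under eq_fun do rewrite cImD; exact: cvgD.
Qed.

Lemma ccvgN u a : ccvg u a -> ccvg (fun n => - u n) (- a).
Proof.
move=> [u1 u2]; split.
- by rewrite cReN; under eq_fun do rewrite cReN; exact: cvgN.
- by rewrite cImN; under eq_fun do rewrite cImN; exact: cvgN.
Qed.

Lemma ccvgJ u a : ccvg u a -> ccvg (fun n => conjc (u n)) (conjc a).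
Proof.
move=> [u1 u2]; split.
- by rewrite cReJ; under eq_fun do rewrite cReJ.
- by rewrite cImJ; under eq_fun do rewrite cImJ; exact: cvgN.
Qed.

Lemma ccvgM u v a b : ccvg u a -> ccvg v b -> ccvg (fun n => u n * v n) (a * b).
Proof.
move=> [u1 u2] [v1 v2]; split.
- by rewrite cReM; under eq_fun do rewrite cReM; apply: cvgB; exact: cvgM.
- by rewrite cImM; under eq_fun do rewrite cImM; apply: cvgD; exact: cvgM.
Qed.

Lemma ccvg_sum (I : Type) (s : seq I) (U : I -> nat -> R[i]) (A : I -> R[i]) :
  (forall i, ccvg (U i) (A i)) ->
  ccvg (fun n => \sum_(i <- s) U i n) (\sum_(i <- s) A i).
Proof.
move=> UA; elim: s => [|i s ih].
  by rewrite big_nil; under eq_fun do rewrite big_nil; exact: ccvg_cst.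
by rewrite big_cons; under eq_fun do rewrite big_cons; exact: ccvgD.
Qed.

Lemma cvg_sqmod u a : ccvg u a -> (fun n => sqmod (u n)) @ \oo --> sqmod a.
Proof.
move=> [u1 u2]; rewrite /sqmod !expr2; under eq_fun do rewrite !expr2.
by apply: cvgD; exact: cvgM.
Qed.

End complex_sequences.

Section fibres.
Context {R : realType} (d : nat).
Local Notation C := R[i].
Local Notation lam := (lebesgue_measured R d).
Local Notation lam2 := (lam \x lam)%E.
Local Notation fn := (Rd R d -> C).
Local Notation fn2 := (Rd R d * Rd R d -> C).

Lemma sqnorm_fibres (h : fn2) : cmeasurable h ->
  (sqnorm lam2 h = \int[lam]_w \int[lam]_y (sqmod (h (y, w)))%:E)%E.
Proof.
move=> mh; rewrite /sqnorm (fubini_tonelli2 (fun z => (sqmod (h z))%:E))//.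
  exact: measurable_Esqmod.
by move=> z; rewrite lee_fin sqmod_ge0.
Qed.

Lemma measurable_fibre (h : fn2) (w : Rd R d) : cmeasurable h ->
  cmeasurable (fun y => h (y, w)).
Proof. by move=> mh; exact: (cmeasurable_comp (pair2_measurable w) mh). Qed.

(** Almost all fibres have finite norm; the others can be set to zero. *)
Lemma zak_fibres_finite (f : fn) : sqintegrable lam f -> exists2 h, zak f h &
  forall w, (\int[lam]_y (sqmod (h (y, w)))%:E < +oo)%E.
Proof.
move=> f2; have [h fh] := zak_exists f2; have [_ h2 h0 _] := fh.
have [mh _] := h2.
pose G w := (\int[lam]_y (sqmod (h (y, w)))%:E)%E.
have mG : measurable_fun setT G.
  apply: (measurable_fun_fubini_tonelli_G (fun z => (sqmod (h z))%:E)) => //.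
    exact: measurable_Esqmod.
  by move=> z; rewrite lee_fin sqmod_ge0.
have G0 w : (0 <= G w)%E.
  by apply: integral_ge0 => y _; rewrite lee_fin sqmod_ge0.
pose E := [set w | G w \is a fin_num].
have mE : measurable E by rewrite -[E]setTI; exact: emeasurable_fin_num.
have mI : cmeasurable (fun z : Rd R d * Rd R d => (\1_E z.2 : R)%:C).
  have mE1 : cmeasurable (fun w : Rd R d => (\1_E w : R)%:C).
    by apply: cmeasurable_real; exact: measurable_indic.
  exact: (cmeasurable_comp measurable_snd mE1).
pose h' z := (\1_E z.2 : R)%:C * h z.
have mh' : cmeasurable h' by exact: cmeasurableM.
have h'in w y : E w -> h' (y, w) = h (y, w).
  by move=> Ew; rewrite /h' indicE mem_set// (rmorph1 (real_complex R)) mul1r.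
have h'out w y : ~ E w -> h' (y, w) = 0.
  by move=> Ew; rewrite /h' indicE memNset// (rmorph0 (real_complex R)) mul0r.
have hh' : sqnorm lam2 (fun z => h z - h' z) = 0%E.
  rewrite sqnorm_fibres; last exact: cmeasurableB.
  have mhh' : measurable_fun setT
      (fun w => \int[lam]_y (sqmod (h (y, w) - h' (y, w)))%:E)%E.
    apply: (measurable_fun_fubini_tonelli_G (fun z => (sqmod (h z - h' z))%:E)) => //.
      by apply: measurable_Esqmod; exact: cmeasurableB.
    by move=> z; rewrite lee_fin sqmod_ge0.
  rewrite (ae_eq_integral (fun=> 0%E))//; first by rewrite integral0.
  have : {ae lam, forall w, setT w -> G w \is a fin_num}.
    apply: (integrable_ae measurableT); apply/integrableP; split => //.
    under eq_integral do rewrite gee0_abs ?G0//.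
    by rewrite -sqnorm_fibres//; case: h2.
  apply: filterS => w Gw _; rewrite integral0_eq// => y _.
  by rewrite h'in ?subrr ?sqmod0//; exact: Gw.
exists h'; last first.
  move=> w; have [Ew|Ew] := pselect (E w).
    under eq_integral do rewrite h'in//.
    by rewrite -/(G w) -ge0_fin_numE.
  by rewrite integral0_eq// => y _; rewrite h'out// sqmod0.
apply: zak_closed => //.
- apply: (@sqintegrable_le _ _ _ _ 1 _ h) => // z; rewrite mul1r sqmodM sqmod_real.
  rewrite indicE; case: (_ \in _); rewrite ?expr1n ?mul1r//.
  by rewrite expr0n mul0r sqmod_ge0.
- by move=> z z2; rewrite /h' h0// mulr0.
- move=> e e0; exists f, h; split => //.
    by under eq_fun do rewrite subrr; rewrite sqnorm0 lte_fin.
  by rewrite sqnormB hh' lte_fin.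
Qed.

Section minimization.
Variables (m n : nat) (h : 'I_m -> fn2).
Hypothesis h2 : forall i, sqintegrable lam2 (h i).
Hypothesis h_fin : forall i w, (\int[lam]_y (sqmod (h i (y, w)))%:E < +oo)%E.

Let mh i : cmeasurable (h i). Proof. by case: (h2 i). Qed.

Local Notation index := ('I_m * 'I_n * bool)%type.

(* The real coordinates of a complex m x n matrix. *)
Let mat (x : index -> R) : 'M[C]_(m, n) :=
  \matrix_(i, j) Complex (x (i, j, false)) (x (i, j, true)).

Definition residual (B : 'M[C]_(m, n)) (u : 'I_m -> C) (k : 'I_m) : C :=
  u k - \sum_i (B *m adjmx B) k i * u i.

Let cost (x : index -> R) (z : Rd R d * Rd R d) : R :=
  \sum_k sqmod (residual (mat x) (h^~ z) k).

Let cost_ge0 x z : 0 <= cost x z.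
Proof. by apply: sumr_ge0 => k _; exact: sqmod_ge0. Qed.

Let cost_measurable x : measurable_fun setT (cost x).
Proof.
apply: measurable_sum => k; apply: measurable_sqmod; apply: cmeasurableB => //.
by apply: cmeasurable_sum => i; apply: cmeasurableM => //; exact: cmeasurable_cst.
Qed.

Let energy (x : index -> R) (w : Rd R d) : \bar R :=
  (\int[lam]_y (cost x (y, w))%:E)%E.

Let energy_ge0 x w : (0 <= energy x w)%E.
Proof. by apply: integral_ge0 => y _; rewrite lee_fin. Qed.

Let energy_measurable x : measurable_fun setT (energy x).
Proof.
apply: (measurable_fun_fubini_tonelli_G (fun z => (cost x z)%:E)).
  by apply/measurable_EFinP; exact: cost_measurable.
by move=> z; rewrite lee_fin.
Qed.

Let cost_fibre_measurable x w : measurable_fun setT (fun y => (cost x (y, w))%:E).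
Proof.
apply/measurable_EFinP.
by apply: (measurableT_comp (cost_measurable x)); exact: pair2_measurable.
Qed.

Let total z : R := \sum_i sqmod (h i z).

Let total_integrable w :
  lam.-integrable setT (fun y => (total (y, w))%:E).
Proof.
have s0 i y : (0 <= (sqmod (h i (y, w)))%:E)%E by rewrite lee_fin sqmod_ge0.
under eq_fun do rewrite /total -sumEFin.
apply: integrable_sum => // i _; apply/integrableP; split.
  by apply: measurable_Esqmod; exact: measurable_fibre.
by under eq_integral do rewrite gee0_abs//.
Qed.

Let cost_le x z (L : R) : (forall k i, sqmod ((mat x *m adjmx (mat x)) k i) <= L) ->
  cost x z <= (2 + m%:R * (2 * 2 ^+ size (index_enum 'I_m) * L)) * total z.
Proof.
move=> PL.
have -> : (2 + m%:R * (2 * 2 ^+ size (index_enum 'I_m) * L)) * total z =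
    \sum_(k < m) (2 * sqmod (h k z) +
      2 * (2 ^+ size (index_enum 'I_m) * (L * total z))).
  rewrite big_split/= -mulr_sumr -/(total z) sumr_const card_ord -mulr_natl.
  by ring.
apply: ler_sum => k _; apply: (le_trans (sqmodB_le2 _ _)); rewrite lerD2l ler_pM2l//.
apply: (le_trans (sqmod_sum_le _ _ _)); rewrite ler_pM2l ?exprn_gt0//.
rewrite /total mulr_sumr; apply: ler_sum => i _.
by rewrite sqmodM ler_wpM2r// sqmod_ge0.
Qed.

Let energy_fin x w : (energy x w < +oo)%E.
Proof.
pose L := \sum_k \sum_i sqmod ((mat x *m adjmx (mat x)) k i).
have PL k i : sqmod ((mat x *m adjmx (mat x)) k i) <= L.
  rewrite /L (bigD1 k)//= (bigD1 i)//= -addrA lerDl addr_ge0//.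
    by apply: sumr_ge0 => j _; exact: sqmod_ge0.
  by apply: sumr_ge0 => j _; apply: sumr_ge0 => l _; exact: sqmod_ge0.
set K := 2 + m%:R * (2 * 2 ^+ size (index_enum 'I_m) * L).
have : lam.-integrable setT (fun y => (K * total (y, w))%:E).
  under eq_fun do rewrite EFinM.
  by apply: integrableZl => //; exact: total_integrable.
move=> /integrableP[mt /le_lt_trans]; apply.
apply: ge0_le_integral => //.
- by move=> y _; rewrite lee_fin.
- exact: (measurableT_comp (@abse_measurable R setT) mt).
- by move=> y _; rewrite abse_EFin lee_fin (le_trans _ (ler_norm _))// cost_le.
Qed.

Let mat_cvg (u : nat -> index -> R) (x : index -> R) :
  (forall i, u ^~ i @ \oo --> x i) ->
  forall i j, ccvg (fun n => mat (u n) i j) (mat x i j).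
Proof.
move=> ux i j; split; rewrite mxE/=; under eq_fun do rewrite mxE/=.
- exact: ux.
- exact: ux.
Qed.

Let proj_cvg (u : nat -> index -> R) (x : index -> R) :
  (forall i, u ^~ i @ \oo --> x i) ->
  forall k i, ccvg (fun n => (mat (u n) *m adjmx (mat (u n))) k i)
    ((mat x *m adjmx (mat x)) k i).
Proof.
move=> ux k i; rewrite [X in ccvg _ X]mxE; under eq_fun do rewrite mxE.
apply: ccvg_sum => j; apply: ccvgM; first exact: mat_cvg.
by rewrite adjmxE; under eq_fun do rewrite adjmxE; apply: ccvgJ; exact: mat_cvg.
Qed.

Let energy_cvg w (u : nat -> index -> R) (x : index -> R) :
  (forall i, u ^~ i @ \oo --> x i) ->
  (fun k => energy (u k) w) @ \oo --> energy x w.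
Proof.
move=> ux.
have cvgP := proj_cvg ux.
have [L PL] : exists L, forall r k i,
    sqmod ((mat (u r) *m adjmx (mat (u r))) k i) <= L.
  have ex (ki : 'I_m * 'I_m) : exists L, forall r,
      sqmod ((mat (u r) *m adjmx (mat (u r))) ki.1 ki.2) <= L.
    have cv : cvgn (fun r =>
        sqmod ((mat (u r) *m adjmx (mat (u r))) ki.1 ki.2)).
      by apply/cvg_ex; eexists; exact: cvg_sqmod (cvgP ki.1 ki.2).
    have [M [_ uM]] := cvg_seq_bounded cv.
    exists (M + 1) => r; apply: (le_trans (ler_norm _)).
    by apply: uM => //; rewrite ltrDl.
  have [L LP] := choice ex; exists (\sum_ki `|L ki|) => r k i.
  apply: (le_trans (LP (k, i) r)); apply: (le_trans (ler_norm _)).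
  by rewrite (bigD1 (k, i))//= lerDl sumr_ge0.
set K := 2 + m%:R * (2 * 2 ^+ size (index_enum 'I_m) * L).
apply: (@dominated_cvg _ _ _ lam setT measurableT _ _
  (fun y => (K * total (y, w))%:E)) => //.
- move=> y _; apply: cvg_EFin; first exact: nearW.
  rewrite /comp/= /cost; apply: cvg_big => [|k _ /=]; first exact: add_continuous.
  apply: cvg_sqmod; apply: ccvgD; first exact: ccvg_cst.
  apply: ccvgN; apply: ccvg_sum => i.
  by apply: ccvgM; [exact: cvgP|exact: ccvg_cst].
- under eq_fun do rewrite EFinM.
  by apply: integrableZl => //; exact: total_integrable.
- by move=> r y _; rewrite gee0_abs ?lee_fin// cost_le.
Qed.

(** One measurable choice of matrices solves the finite-dimensional approximation
    problem in every fibre at once. *)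
Lemma optimal_matrices : exists B : Rd R d -> 'M[C]_(m, n),
  [/\ forall i j, cmeasurable (fun w => B w i j),
      exists M, forall w i j, sqmod (B w i j) <= M &
      forall (l : nat) (c : Rd R d -> 'M[C]_(m, l)) (v : 'I_l -> fn2) w,
        (l <= n)%N -> (forall j, cmeasurable (v j)) ->
        (\int[lam]_y (\sum_k sqmod (residual (B w) (h^~ (y, w)) k))%:E <=
         \int[lam]_y (\sum_k sqmod (h k (y, w) - \sum_j c w k j * v j (y, w)))%:E)%E].
Proof.
have [||||x [mx xM xmin]] := @measurable_minimizer R _ _ index 1
  (fun w x => fine (energy x w)).
- exact: ler01.
- by move=> x; apply: measurableT_comp => //; exact: energy_measurable.
- by move=> w x; apply: fine_ge0.
- move=> w u x ux.
  have := @energy_cvg w u x ux; rewrite -(fineK (_ : energy x w \is a fin_num)).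
    by move=> /fine_cvgP[].
  by rewrite ge0_fin_numE.
exists (fun w => mat (x w)); split.
- move=> i j; split; under eq_fun do rewrite mxE/=; exact: mx.
- exists 8 => w i j; rewrite mxE /sqmod/=.
  have sq4 (a : R) : `|a| <= 1 + 1 -> a ^+ 2 <= 4.
    move=> a2; have : `|a| ^+ 2 <= (1 + 1) ^+ 2 by rewrite ler_sqr ?nnegrE.
    by rewrite real_normK ?num_real// expr2; lra.
  by have := sq4 _ (xM w (i, j, false)); have := sq4 _ (xM w (i, j, true)); lra.
move=> l c v w ln mv.
have [B B1 Bres] := residual_ge_projection (c w) ln.
pose y (t : index) : R := if t.2 then Im (B t.1.1 t.1.2) else Re (B t.1.1 t.1.2).
have yB : mat y = B.
  by apply/matrixP => i j; rewrite mxE /y/=; case: (B i j).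
have y1 t : `|y t| <= 1.
  have := B1 t.1.1 t.1.2; rewrite /sqmod /y.
  have sq (a b : R) : a ^+ 2 + b ^+ 2 <= 1 -> `|a| <= 1 /\ `|b| <= 1.
    move=> ab; have a2 := sqr_ge0 a; have b2 := sqr_ge0 b.
    by split; rewrite -(@expr_le1 _ 2)// real_normK ?num_real//; lra.
  by move=> /sq[]; case: t.2.
have fE z : energy z w \is a fin_num.
  by rewrite (ge0_fin_numE (energy_ge0 z w)) energy_fin.
have xm : (energy (x w) w <= energy y w)%E.
  by rewrite -(fineK (fE (x w))) -(fineK (fE y)) lee_fin; exact: xmin.
apply: (le_trans xm); rewrite /energy /cost yB.
apply: ge0_le_integral => //.
- by move=> t _; rewrite lee_fin; apply: sumr_ge0 => k _; exact: sqmod_ge0.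
- by have := cost_fibre_measurable y w; rewrite /cost yB.
- apply/measurable_EFinP; apply: measurable_sum => k; apply: measurable_sqmod.
  apply: cmeasurableB; first exact: measurable_fibre.
  apply: cmeasurable_sum => j; apply: cmeasurableM; first exact: cmeasurable_cst.
  exact: measurable_fibre.
- move=> t _; rewrite lee_fin; exact: (Bres (h^~ (t, w)) (fun j => v j (t, w))).
Qed.

End minimization.
End fibres.

(** * The best shift-invariant space with a bounded number of generators *)

Section distances.
Context {R : realType} (d : nat).
Local Notation C := R[i].
Local Notation lam := (lebesgue_measured R d).
Local Notation lam2 := (lam \x lam)%E.
Local Notation fn := (Rd R d -> C).
Local Notation fn2 := (Rd R d * Rd R d -> C).

Lemma d2_ge0 (f : fn) S : (0 <= d2 f S)%E.
Proof. by apply: le_ereal_inf_tmp => _ [g _ <-]; exact: L2norm_ge0. Qed.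

Lemma expe2_le (a b : \bar R) : (0 <= a -> a <= b -> a ^+ 2 <= b ^+ 2)%E.
Proof.
move=> a0 ab; rewrite !expe2; apply: lee_pmul => //.
Qed.

Lemma d2_sqr_le (f : fn) S g : S g ->
  (d2 f S ^+ 2 <= sqnorm lam (fun x => (f x - g x)%R))%E.
Proof.
move=> Sg; rewrite -L2norm_sqr; apply: expe2_le; first exact: d2_ge0.
by apply: ereal_inf_lbound; exists g.
Qed.

Lemma d2_sqr_adherent (f : fn) S (e : R) : 0 < e -> (d2 f S < +oo)%E ->
  exists2 g, S g & (sqnorm lam (fun x => (f x - g x)%R) < d2 f S ^+ 2 + e%:E)%E.
Proof.
move=> e0; have := d2_ge0 f S; case E : (d2 f S) => [r||]// ; rewrite lee_fin => r0 _.
pose t := Num.min 1 (e / (2 * r + 2)).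
have r2 : 0 < 2 * r + 2 by lra.
have t0 : 0 < t by rewrite lt_min ltr01 divr_gt0.
have tr : t * (2 * r + 1) < e.
  have te : t <= e / (2 * r + 2) by rewrite /t ge_min lexx orbT.
  rewrite ler_pdivlMr// in te; apply: lt_le_trans te.
  by rewrite ltr_pM2l//; lra.
have t1 : t <= 1 by rewrite /t ge_min lexx.
have [|_ [g Sg <-]] := @ereal_inf_lt R [set L2norm (fun x => f x - g x) | g in S]
    (r + t)%:E.
  by rewrite -/(d2 f S) E lte_fin ltrDl.
rewrite L2norm_lt; last by rewrite ltr_wpDl.
move=> gt; exists g => //; apply: (lt_trans gt).
by rewrite -EFin_expe -EFinD lte_fin; nra.
Qed.

Definition shifts (l : nat) (psi : 'I_l -> fn) : set fn :=
  [set g | exists i k, g = translate k (psi i)].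

Lemma cspan0 (A : set fn) : cspan A (fun=> 0).
Proof.
exists 0%N, (fun=> 0), (fun=> fun=> 0); split; first by case.
by apply/funext => x; rewrite big_ord0.
Qed.

Lemma cspanD (A : set fn) f g : cspan A f -> cspan A g ->
  cspan A (fun x => f x + g x).
Proof.
move=> [N [c [F [AF ->]]]] [M [b [G [AG ->]]]].
exists (N + M)%N, (fun t => match fintype.split t with inl i => c i | inr j => b j end),
  (fun t => match fintype.split t with inl i => F i | inr j => G j end); split.
  by move=> t; case: (fintype.split t).
apply/funext => x; rewrite big_split_ord/=; congr (_ + _).
- by apply: eq_bigr => i _; rewrite (unsplitK (inl i)).
- by apply: eq_bigr => i _; rewrite (unsplitK (inr i)).
Qed.

Lemma cspan_sum (A : set fn) I (s : seq I) (F : I -> fn) :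
  (forall i, cspan A (F i)) -> cspan A (fun x => \sum_(i <- s) F i x).
Proof.
move=> AF; elim: s => [|i s ih].
  by under eq_fun do rewrite big_nil; exact: cspan0.
by under eq_fun do rewrite big_cons; exact: cspanD.
Qed.

Lemma cspan_scaled (A : set fn) (c : C) f : A f -> cspan A (fun x => c * f x).
Proof.
move=> Af; exists 1%N, (fun=> c), (fun=> f); split => //.
by apply/funext => x; rewrite big_ord1.
Qed.

Lemma cspan_trig_act l (psi : 'I_l -> fn) s i :
  cspan (shifts psi) (trig_act s (psi i)).
Proof.
apply: cspan_sum => p; apply: cspan_scaled.
by exists i, p.2.
Qed.

Lemma SI_spanP l (psi : 'I_l -> fn) g : SI_span psi g -> sqintegrable lam g /\
  forall e : R, 0 < e -> exists2 g', cspan (shifts psi) g' &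
    (sqnorm lam (fun x => (g x - g' x)%R) < e%:E)%E.
Proof.
move=> [/L2P g2 gP]; split => // e e0.
have e1 : 0 < Num.sqrt e by rewrite sqrtr_gt0.
have [g' cg' gg'] := gP _ e1; exists g' => //.
by move: gg'; rewrite L2norm_lt// sqr_sqrtr// ltW.
Qed.

Lemma cspan_SI_span l (psi : 'I_l -> fn) g : sqintegrable lam g ->
  cspan (shifts psi) g -> SI_span psi g.
Proof.
move=> g2 cg; split; first exact/L2P.
move=> e e0; exists g => //; rewrite L2norm_lt//.
by under eq_fun do rewrite subrr; rewrite sqnorm0 lte_fin exprn_gt0.
Qed.

(** Collecting the translates of each generator puts a single trigonometric
    polynomial in front of its transform. *)
Lemma cspan_zak l (psi : 'I_l -> fn) (eta : 'I_l -> fn2) g :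
  (forall i, zak (psi i) (eta i)) -> cspan (shifts psi) g ->
  exists c : 'I_l -> Rd R d -> C, zak g (fun z => \sum_i c i z.2 * eta i z).
Proof.
move=> zpsi [N [a [F [AF ->]]]].
have /choice[i0 i0P] : forall t, exists i, exists k, F t = translate k (psi i) by [].
have [k kP] := choice i0P.
exists (fun i w => \sum_(t < N | i0 t == i) a t * echar (k t) w).
rewrite (_ : (fun z => _) =
    fun z => \sum_(t < N) a t * (echar (k t) z.2 * eta (i0 t) z)); last first.
  apply/funext => z; rewrite (partition_big i0 xpredT)//=.
  apply: eq_bigr => i _; rewrite mulr_suml; apply: eq_bigr => t /eqP ->.
  by rewrite mulrA.
rewrite (_ : (fun x => _) = fun x => \sum_(t < N) a t * translate (k t) (psi (i0 t)) x).
  by apply: zak_sum => t; apply: zakZ; exact: zak_translate.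
by apply/funext => x; apply: eq_bigr => t _; rewrite kP.
Qed.

(** Trigonometric polynomials approximate the bounded coefficients [b], and act as
    combinations of translates, which stay in the span. *)
Lemma d2_SI_span_le n (phi : 'I_n -> fn) (eta : 'I_n -> fn2)
    (b : 'I_n -> Rd R d -> C) (M : R) (f : fn) (h : fn2) :
  zak f h -> (forall j, zak (phi j) (eta j)) -> (forall j, cmeasurable (b j)) ->
  (forall j w, sqmod (b j w) <= M) ->
  (d2 f (SI_span phi) ^+ 2 <=
   sqnorm lam2 (fun z => (h z - \sum_j b j z.2 * eta j z)%R))%E.
Proof.
move=> fh pe mb bM.
have mbe j : sqintegrable lam2 (fun z => b j z.2 * eta j z).
  have [_ e2 _ _] := pe j; have M0 : 0 <= M.
    by apply: le_trans (bM j point); exact: sqmod_ge0.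
  apply: (@sqintegrable_le _ _ _ _ M _ (eta j)) => //.
    apply: cmeasurableM; last by case: e2.
    exact: (cmeasurable_comp measurable_snd (mb j)).
  by move=> z; rewrite sqmodM ler_wpM2r// sqmod_ge0.
pose u z := h z - \sum_j b j z.2 * eta j z.
have [_ h2 _ _] := fh.
have u2 : sqintegrable lam2 u by apply: sqintegrableB => //; exact: sqintegrable_sum.
apply/lee_addgt0Pr => e e0.
have [t t0 tP] := sqnorm_near u2 e0.
pose K : R := 2 ^+ size (index_enum 'I_n) * (n%:R + 1).
have K0 : 0 < K by rewrite mulr_gt0 ?exprn_gt0// ltr_wpDl.
have /choice[s sP] : forall j, exists s, (sqnorm lam2
    (fun z => ((b j z.2 - trig s z.2) * eta j z)%R) < (t / K)%:E)%E.
  move=> j; have [_ e2 e0' _] := pe j.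
  by apply: (trig_dense e2 e0' (mb j) (bM j)); rewrite divr_gt0.
pose g x := \sum_j trig_act (s j) (phi j) x.
pose v z := \sum_j trig (s j) z.2 * eta j z.
have gv : zak g v by apply: zak_sum => j; exact: zak_trig_act.
have fgv := zakB fh gv.
have Sg : SI_span phi g.
  apply: cspan_SI_span; first by case: gv.
  by apply: cspan_sum => j; exact: cspan_trig_act.
apply: (le_trans (d2_sqr_le f Sg)); rewrite -(zak_isometry fgv).
apply: (proj1 (tP _ _ _)).
  by have [_ [? _]] := fgv.
have -> : (fun z => u z - (h z - v z)) =
    (fun z => - \sum_j ((b j z.2 - trig (s j) z.2) * eta j z)).
  apply/funext => z; rewrite /u /v opprB addrC subrKA -[LHS]opprB -sumrB.
  by congr (- _); apply: eq_bigr => j _; rewrite mulrBl.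
rewrite (@eq_sqnorm _ _ _ _ _
  (fun z => \sum_j ((b j z.2 - trig (s j) z.2) * eta j z))); last first.
  by move=> z; rewrite sqmodN.
have mj j : cmeasurable (fun z => (b j z.2 - trig (s j) z.2) * eta j z).
  apply: cmeasurableM; last by have [_ [? _]] := pe j.
  apply: (cmeasurable_comp measurable_snd (f := fun w => b j w - trig (s j) w)).
  by apply: cmeasurableB => //; exact: cmeasurable_trig.
apply: (le_lt_trans (sqnorm_sum_le lam2 (index_enum 'I_n) mj)).
apply: (@le_lt_trans _ _ ((2 ^+ size (index_enum 'I_n))%:E *
    (\sum_(j < n) (t / K)%:E))%E).
  rewrite lee_pmul2l ?lte_fin ?exprn_gt0//.
  by apply: lee_sum => j _; exact: ltW.
rewrite sumEFin -EFinM lte_fin sumr_const card_ord -[_ *+ n]mulr_natl.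
have -> : 2 ^+ size (index_enum 'I_n) * (n%:R * (t / K)) =
    t * (n%:R / (n%:R + 1)) :> R.
  rewrite /K; field; rewrite ?expf_neq0//.
  by rewrite !gt_eqF// ltr_wpDl.
by rewrite gtr_pMr// ltr_pdivrMr ?mul1r ?ltrDl// ltr_wpDl.
Qed.

(** The optimal matrices provide the transforms of the generators. In each fibre a
    competitor is a combination of at most [n] functions, hence is no better than
    the optimal projection, whose bounded coefficients are reached in the closed
    span. *)
Theorem best_generators m n (f : 'I_m -> fn) :
  (forall k, sqintegrable lam (f k)) ->
  exists2 phi : 'I_n -> fn, forall j, sqintegrable lam (phi j) &
    forall l (psi : 'I_l -> fn) (S : set fn), (l <= n)%N ->
      (forall i, sqintegrable lam (psi i)) -> S `<=` SI_span psi ->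
      (\sum_k d2 (f k) (SI_span phi) ^+ 2 <= \sum_k d2 (f k) S ^+ 2)%E.
Proof.
move=> f2.
have /choice[h hP] : forall k, exists h, zak (f k) h /\
    forall w, (\int[lam]_y (sqmod (h (y, w)))%:E < +oo)%E.
  by move=> k; have [h] := zak_fibres_finite (f2 k); exists h.
have zfh k := proj1 (hP k); have h_fin k := proj2 (hP k).
have h2 k : sqintegrable lam2 (h k) by case: (zfh k).
have mh k : cmeasurable (h k) by case: (h2 k).
have [B [mB [M BM] Bmin]] := @optimal_matrices R d m n h h2 h_fin.
pose eta j z := \sum_i conjc (B z.2 i j) * h i z.
have /choice[phi pe] : forall j, exists p, zak p (eta j).
  move=> j.
  have /choice[p pP] : forall i, exists p, zak p (fun z => conjc (B z.2 i j) * h i z).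
    move=> i; apply: (@zak_multiplier _ _ (f i) (h i) (fun w => conjc (B w i j)) M) => //.
      exact: cmeasurableJ.
    by move=> w; rewrite sqmodJ.
  by exists (fun x => \sum_i p i x); exact: zak_sum.
have resE k z : residual (B z.2) (h^~ z) k = h k z - \sum_j B z.2 k j * eta j z.
  rewrite /residual; congr (_ - _).
  under eq_bigr do rewrite mxE mulr_suml.
  rewrite exchange_big; apply: eq_bigr => j _; rewrite /eta mulr_sumr.
  by apply: eq_bigr => i _; rewrite adjmxE mulrA.
have mres k : cmeasurable (fun z => h k z - \sum_j B z.2 k j * eta j z).
  apply: cmeasurableB => //; apply: cmeasurable_sum => j; apply: cmeasurableM.
    exact: (cmeasurable_comp measurable_snd (mB k j)).
  by have [_ [? _]] := pe j.
exists phi; first by move=> j; case: (pe j).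
move=> l psi S ln psi2 Spsi.
pose optimum := (\int[lam]_w \int[lam]_y
  (\sum_k sqmod (residual (B w) (h^~ (y, w)) k))%:E)%E.
have upper : (\sum_k d2 (f k) (SI_span phi) ^+ 2 <= optimum)%E.
  apply: (@le_trans _ _ (\sum_k sqnorm lam2
      (fun z => (h k z - \sum_j B z.2 k j * eta j z)%R))%E).
    apply: lee_sum => k _.
    exact: (@d2_SI_span_le _ _ _ (fun j w => B w k j) M).
  have s0 k z : (0 <= (sqmod (h k z - \sum_j B z.2 k j * eta j z))%:E)%E.
    by rewrite lee_fin sqmod_ge0.
  rewrite /sqnorm -ge0_integral_sum//; last first.
    by move=> k; exact: measurable_Esqmod.
  rewrite fubini_tonelli2; last 2 first.
  - by apply: emeasurable_sum => k; exact: measurable_Esqmod.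
  - by move=> z; apply: sume_ge0 => k _.
  rewrite /fubini_G /optimum le_eqVlt; apply/orP; left; apply/eqP.
  apply: eq_integral => w _; apply: eq_integral => y _.
  rewrite sumEFin; congr EFin; apply: eq_bigr => k _.
  by rewrite (resE k (y, w)).
apply: (le_trans upper).
have [/existsP[k /eqP dk]|/existsPn dfin] :=
    boolP [exists k, d2 (f k) S == +oo%E].
  rewrite (bigD1 k)//= dk ?expe2 mulyy addye ?leey//.
  rewrite -ltNye (@lt_le_trans _ _ 0%E)//; apply: sume_ge0 => i _.
  by apply: (@expe_ge0 _ _ 2); exact: d2_ge0.
apply/lee_addgt0Pr => e e0.
pose e' := e / (2 * (m%:R + 1)).
have m1 : 0 < m%:R + 1 :> R by rewrite ltr_wpDl.
have e'0 : 0 < e' by rewrite divr_gt0// mulr_gt0.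
have /choice[g gP] : forall k, exists g, cspan (shifts psi) g /\
    (sqnorm lam (fun x => (f k x - g x)%R) <= d2 (f k) S ^+ 2 + (e' + e')%:E)%E.
  move=> k; have dk : (d2 (f k) S < +oo)%E by rewrite ltey dfin.
  have [g0 Sg0 fg0] := d2_sqr_adherent e'0 dk.
  have [g02 g0P] := SI_spanP (Spsi _ Sg0).
  have fg2 : sqintegrable lam (fun x => f k x - g0 x) by exact: sqintegrableB.
  have [t t0 tP] := sqnorm_near fg2 e'0.
  have [g cg g0g] := g0P _ t0; exists g; split => //.
  have mg : cmeasurable g.
    have [eta' /= etaP] : exists eta', zak g eta'.
      have /choice[et etP] : forall i, exists et, zak (psi i) et.
        by move=> i; exact: zak_exists.
      by have [c zc] := cspan_zak etP cg; eexists; exact: zc.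
    by case: etaP => -[].
  rewrite EFinD addeA; apply: (@le_trans _ _ (sqnorm lam (fun x => (f k x - g0 x)%R) + e'%:E)%E).
    apply: (proj1 (tP _ _ _)).
      by apply: cmeasurableB => //; case: (f2 k).
    rewrite (@eq_sqnorm _ _ _ _ _ (fun x => g0 x - g x))// => x.
    by rewrite -sqmodN; congr sqmod; ring.
  by rewrite leeD2r// ltW.
have /choice[et etP] : forall i, exists et, zak (psi i) et.
  by move=> i; exact: zak_exists.
have /choice[c cP] : forall k, exists c : 'I_l -> Rd R d -> C,
    zak (g k) (fun z => \sum_i c i z.2 * et i z).
  by move=> k; apply: (cspan_zak etP); case: (gP k).
pose cm w : 'M[C]_(m, l) := \matrix_(k, i) c k i w.
have met i : cmeasurable (et i) by have [_ [? _]] := etP i.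
apply: (@le_trans _ _ (\sum_k sqnorm lam2
    (fun z => (h k z - \sum_i c k i z.2 * et i z)%R))%E); last first.
  apply: (@le_trans _ _ (\sum_k (d2 (f k) S ^+ 2 + (e' + e')%:E))%E).
    apply: lee_sum => k _; rewrite (zak_isometry (zakB (zfh k) (cP k))).
    by case: (gP k).
  rewrite big_split/= leeD2l// sumEFin lee_fin sumr_const card_ord -[_ *+ m]mulr_natl.
  have -> : m%:R * (e' + e') = e * (m%:R / (m%:R + 1)).
    by rewrite /e'; field; rewrite gt_eqF.
  by rewrite ger_pMr// ler_pdivrMr// mul1r lerDl.
have mdiff k : cmeasurable (fun z => h k z - \sum_i c k i z.2 * et i z).
  by have [_ [? _]] := zakB (zfh k) (cP k).
rewrite /sqnorm -ge0_integral_sum//; last 2 first.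
- by move=> k; exact: measurable_Esqmod.
- by move=> k z _; rewrite lee_fin sqmod_ge0.
rewrite fubini_tonelli2; last 2 first.
- by apply: emeasurable_sum => k; exact: measurable_Esqmod.
- by move=> z; apply: sume_ge0 => k _; rewrite lee_fin sqmod_ge0.
rewrite /fubini_G /optimum; apply: ge0_le_integral => //.
- move=> w _; apply: integral_ge0 => y _; rewrite lee_fin.
  by apply: sumr_ge0 => k _; exact: sqmod_ge0.
- have := @measurable_fun_fubini_tonelli_G _ _ _ _ R lam
    (fun z => (\sum_k sqmod (residual (B z.2) (h^~ z) k))%:E).
  apply.
    apply/measurable_EFinP; apply: measurable_sum => k; apply: measurable_sqmod.
    by under eq_fun do rewrite resE.
  by move=> z; rewrite lee_fin; apply: sumr_ge0 => k _; exact: sqmod_ge0.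
- have := @measurable_fun_fubini_tonelli_G _ _ _ _ R lam
    (fun z => \sum_k (sqmod (h k z - \sum_i c k i z.2 * et i z))%:E)%E.
  apply; first by apply: emeasurable_sum => k; exact: measurable_Esqmod.
  by move=> z; apply: sume_ge0 => k _; rewrite lee_fin sqmod_ge0.
- move=> w _; have := Bmin l cm et w ln met; congr (_ <= _)%E.
  apply: eq_integral => y _; rewrite sumEFin; congr EFin.
  apply: eq_bigr => k _; congr (sqmod (_ - _)); apply: eq_bigr => i _.
  by rewrite mxE.
Qed.

End distances.

(** * Length, and bundles of spaces *)

Section bundles.
Context {R : realType} (d : nat).
Local Notation C := R[i].
Local Notation lam := (lebesgue_measured R d).
Local Notation fn := (Rd R d -> C).

Lemma SI_span_generator n (phi : 'I_n -> fn) i :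
  (forall j, sqintegrable lam (phi j)) -> SI_span phi (phi i).
Proof.
move=> phi2; apply: cspan_SI_span => //.
rewrite (_ : phi i = fun x => 1 * translate (fun=> 0) (phi i) x).
  by apply: cspan_scaled; exists i, (fun=> 0).
by apply/funext => x; rewrite translate0 mul1r.
Qed.

(** The length, a minimal number of generators, exists because [phi] already
    generates. *)
Lemma length_le_SI_span n (phi : 'I_n -> fn) : (0 < n)%N ->
  (forall j, sqintegrable lam (phi j)) -> length_le n (SI_span phi).
Proof.
move=> n0 phi2; split; first by exists n, phi; split => // i; exact/L2P.
have [S0|S0] := pselect (SI_span phi = @zero_space R d).
  by exists 0%N => //; left.
have gen : generated_by (SI_span phi) n.
  by exists phi; split => // i; exact: SI_span_generator.
have ex : exists k, `[< (0 < k)%N /\ generated_by (SI_span phi) k >].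
  by exists n; apply/asboolP.
case: (ex_minnP ex) => l /asboolP[l0 lgen] lmin.
exists l; last by apply: lmin; apply/asboolP.
by right; split => // k k0 kgen; apply: lmin; apply/asboolP.
Qed.

Lemma length_le_subset n (S : set fn) : length_le n S ->
  S (fun=> 0) /\ exists l (psi : 'I_l -> fn),
    [/\ (l <= n)%N, forall i, sqintegrable lam (psi i) & S `<=` SI_span psi].
Proof.
move=> [_ [l Sl ln]].
have SI0 k (psi : 'I_k -> fn) : SI_span psi (fun=> 0).
  by apply: cspan_SI_span; [exact: sqintegrable0|exact: cspan0].
case: Sl => [[-> l0]|[_ _ [psi [Spsi SE]] _]].
  split.
    split; first by apply/L2P; exact: sqintegrable0.
    have := @L2norm_sqr R d (fun=> 0); rewrite sqnorm0 => /eqP.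
    by rewrite expe_eq0/= => /eqP.
  exists 0%N, (fun=> fun=> 0); split => //; first by case.
  move=> g [g2 g0]; split => // e e0; exists (fun=> 0); first exact: cspan0.
  by under eq_fun do rewrite subr0; rewrite g0 lte_fin.
split; first by rewrite SE; exact: SI0.
exists l, psi; split => //; last by rewrite SE.
move=> i; have := Spsi i; rewrite SE => /SI_spanP; tauto.
Qed.

Lemma d2_sqr_zero (S : set fn) : S (fun=> 0) -> (d2 (fun=> 0%R) S ^+ 2 = 0)%E.
Proof.
move=> S0; apply/eqP; rewrite eq_le expe_ge0 ?d2_ge0// andbT.
apply: (le_trans (d2_sqr_le _ S0)).
by under eq_fun do rewrite subr0; rewrite sqnorm0.
Qed.

(** A best space for a subfamily: the other functions are replaced by zero, which
    costs nothing. *)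
Lemma best_space m n (f : 'I_m -> fn) (I : {set 'I_m}) : (0 < n)%N ->
  (forall i, L2 (f i)) ->
  exists2 S0 : set fn, length_le n S0 & forall S, length_le n S ->
    (\sum_(i in I) d2 (f i) S0 ^+ 2 <= \sum_(i in I) d2 (f i) S ^+ 2)%E.
Proof.
move=> n0 f2; pose fI i : fn := if i \in I then f i else fun=> 0.
have fI2 i : sqintegrable lam (fI i).
  by rewrite /fI; case: ifP => _; [exact/L2P|exact: sqintegrable0].
have [phi phi2 best] := best_generators n fI2.
exists (SI_span phi); first exact: length_le_SI_span.
move=> S /length_le_subset[S0 [l [psi [ln psi2 Spsi]]]].
have split_sum (S' : set fn) : (\sum_k d2 (fI k) S' ^+ 2 =
    \sum_(i in I) d2 (f i) S' ^+ 2 + \sum_(i | i \notin I) d2 (fun=> 0%R) S' ^+ 2)%E.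
  rewrite (bigID (mem I))/=; congr (_ + _)%E.
    by apply: eq_bigr => i iI; rewrite /fI iI.
  by apply: eq_bigr => i iI; rewrite /fI (negbTE iI).
have rest0 (S' : set fn) : S' (fun=> 0) ->
    (\sum_(i | i \notin I) d2 (fun=> 0%R) S' ^+ 2 = 0)%E.
  by move=> S'0; rewrite big1// => i _; exact: d2_sqr_zero.
have [phi0 _] := length_le_subset (length_le_SI_span n0 phi2).
by have := best l psi S ln psi2 Spsi; rewrite !split_sum !rest0// !adde0.
Qed.

Lemma bigmine_le l (F : 'I_l -> \bar R) j :
  (\big[mine/+oo]_(i < l) F i <= F j)%E.
Proof.
have : j \in index_enum 'I_l by rewrite mem_index_enum.
elim: (index_enum _) => // i s ih; rewrite inE big_cons ge_min.
by move=> /predU1P[->|/ih ->]; rewrite ?lexx ?orbT.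
Qed.

Lemma le_bigmine l (F : 'I_l -> \bar R) (a : \bar R) :
  (forall j, a <= F j)%E -> (a <= \big[mine/+oo]_(i < l) F i)%E.
Proof.
move=> aF; elim/big_ind : _ => //; first exact: leey.
by move=> x y ax ay; rewrite le_min ax.
Qed.

End bundles.

Theorem theorem3p3 (R : realType) (d m n l : nat) (f : 'I_m -> Rd R d -> R[i])
    (hd : (0 < d)%N) (hf : forall i, L2 (f i))
    (hn : (0 < n)%N) (hnm : (n < m)%N) (hl : (1 <= l)%N) (hlm : (l <= m)%N) :
  exists2 S0 : 'I_l -> set (Rd R d -> R[i]), bundle n S0 &
    forall S : 'I_l -> set (Rd R d -> R[i]), bundle n S ->
      (bundle_error f S0 <= bundle_error f S)%E.
Proof.
have /choice[best bestP] : forall I : {set 'I_m}, exists S0, length_le n S0 /\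
    forall S, length_le n S ->
      (\sum_(i in I) d2 (f i) S0 ^+ 2 <= \sum_(i in I) d2 (f i) S ^+ 2)%E.
  by move=> I; have [S0] := best_space I hn hf; exists S0.
(* An assignment [s] of functions to spaces determines the blocks, and the blocks
   determine the best spaces; the cost is minimized over assignments. *)
pose block (s : {ffun 'I_m -> 'I_l}) j := [set i | s i == j]%SET.
pose cost (s : {ffun 'I_m -> 'I_l}) : \bar R :=
  (\sum_i d2 (f i) (best (block s (s i))) ^+ 2)%E.
pose s1 : {ffun 'I_m -> 'I_l} := [ffun=> Ordinal hl].
pose s0 := [arg min_(s < s1) cost s]%O.
have s0P s : (cost s0 <= cost s)%E.
  by rewrite /s0; case: arg_minP => // t _; exact.
exists (fun j => best (block s0 j)) => [j|S bS]; first by case: (bestP (block s0 j)).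
(* The assignment of each function to the nearest space of the competitor. *)
pose s : {ffun 'I_m -> 'I_l} :=
  [ffun i => [arg min_(j < Ordinal hl) (d2 (f i) (S j) ^+ 2)%E]%O].
have sP i j : (d2 (f i) (S (s i)) ^+ 2 <= d2 (f i) (S j) ^+ 2)%E.
  by rewrite ffunE; case: arg_minP => // t _; exact.
apply: (@le_trans _ _ (cost s0)).
  by apply: lee_sum => i _; exact: bigmine_le.
apply: (le_trans (s0P s)).
apply: (@le_trans _ _ (\sum_i d2 (f i) (S (s i)) ^+ 2)%E); last first.
  by apply: lee_sum => i _; apply: le_bigmine => j; exact: sP.
rewrite /cost (partition_big s xpredT)//= [leRHS](partition_big s xpredT)//=.
apply: lee_sum => j _.
have [_ /(_ (S j) (bS j))] := bestP (block s j).
rewrite [X in (X <= _)%E -> _](eq_bigl (fun i => s i == j)); last first.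
  by move=> i; rewrite inE.
rewrite [X in (_ <= X)%E -> _](eq_bigl (fun i => s i == j)); last first.
  by move=> i; rewrite inE.
by congr (_ <= _)%E; apply: eq_bigr => i /eqP ->.
Qed.
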